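(* Let $r\in \mathbb{N}$, $\alpha\in (0,1)$ and let $\mathcal{G}$ be a hereditary graph class such that every $G\in \mathcal{G}$ with $n$ vertices has $O(n)$ cliques of order less than $r$ and treewidth $O(n^\alpha)$. Then there exists an algorithm that solves $K_r$-Cover on graphs of $\mathcal{G}$ in time $2^{O_r(k^{2/(1+1/\alpha)} \log k)} \cdot n^{O_r(1)}$.
   Context: In the $K_r$-Cover problem, given a graph $G$ and an integer $k$, one has to decide whether there is a set of at most $k$ vertices of $G$ whose deletion yields a graph with no clique on $r$ vertices. A graph class is hereditary if it is closed under taking induced subgraphs. $n$ is the number of vertices of the input graph; $O_r(\cdot)$ hides constants depending on $r$. *)

(* Defs.v *)
From HB Require Import structures.
From mathcomp Require Import all_boot all_order all_algebra.
From mathcomp Require Import boolp reals exp.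

Set Implicit Arguments.
Unset Strict Implicit.
Unset Printing Implicit Defensive.

Record sgraph := SGraph {
  vertex :> finType;
  edge : rel vertex;
  edge_sym : symmetric edge;
  edge_irr : irreflexive edge }.

Section Induced.
Variables (G : sgraph) (A : {set G}).

Definition induced_edge : rel {x : G | x \in A} :=
  fun x y => edge (val x) (val y).

Lemma induced_edge_sym : symmetric induced_edge.
Proof. by move=> x y; apply: edge_sym. Qed.

Lemma induced_edge_irr : irreflexive induced_edge.
Proof. by move=> x; apply: edge_irr. Qed.

Definition induced := SGraph induced_edge_sym induced_edge_irr.
End Induced.

Definition isomorphic (G H : sgraph) : Prop :=
  exists2 f : G -> H, bijective f & forall x y, edge (f x) (f y) = edge x y.

(* As usual, a graph class is invariant under isomorphism. *)
Definition hereditary (C : sgraph -> Prop) : Prop :=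
  (forall G H : sgraph, isomorphic G H -> C G -> C H) /\
  (forall (G : sgraph) (A : {set G}), C G -> C (induced A)).

(* Not necessarily maximal; the empty set is a clique of order 0. *)
Definition clique (G : sgraph) (K : {set G}) : bool :=
  [forall x in K, forall y in K, (x != y) ==> edge x y].

Definition cliques_lt (G : sgraph) (r : nat) : {set {set G}} :=
  [set K : {set G} | clique K & #|K| < r].

Definition Kr_free (r : nat) (G : sgraph) : Prop :=
  forall K : {set G}, clique K -> #|K| <> r.

Definition Kr_cover (r : nat) (G : sgraph) (k : nat) : Prop :=
  exists2 S : {set G}, #|S| <= k & Kr_free r (induced (~: S)).

Definition is_tree (T : sgraph) : Prop :=
  [/\ 0 < #|T|,
      forall s t : T, connect (@edge T) s t
    & forall c : seq T, 2 < size c -> ~ ucycle (@edge T) c].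

Definition tree_decomposition (G T : sgraph) (B : T -> {set G}) : Prop :=
  [/\ is_tree T,
      forall x : G, exists t : T, x \in B t,
      forall x y : G, edge x y -> exists t : T, (x \in B t) && (y \in B t)
    & forall (x : G) (s t : T), x \in B s -> x \in B t ->
        connect [rel u v : T | [&& edge u v, x \in B u & x \in B v]] s t].

(* The predecessor is truncated, so the graph without vertices gets
   treewidth 0 instead of -1. *)
Definition width (G T : sgraph) (B : T -> {set G}) : nat :=
  (\max_(t : T) #|B t|).-1.

Definition has_width (G : sgraph) (w : nat) : Prop :=
  exists (T : sgraph) (B : T -> {set G}), tree_decomposition B /\ width B = w.

Lemma has_width_trivial (G : sgraph) : exists w, `[< has_width G w >].
Proof.
have sym0 : symmetric (fun _ _ : unit => false) by [].
have irr0 : irreflexive (fun _ : unit => (fun _ => false) : pred unit) by [].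
pose T := SGraph sym0 irr0; pose B (t : T) := [set: G].
exists (width B); apply/asboolP; exists T, B; split=> //; split.
- split; first by rewrite card_unit.
  + by case=> -[]; apply: connect0.
  + by case=> [|a [|b c]].
- by move=> x; exists tt; rewrite inE.
- by move=> x y _; exists tt; rewrite !inE.
- by move=> x [] [] _ _; apply: connect0.
Qed.

Definition treewidth (G : sgraph) : nat := ex_minn (has_width_trivial G).

(* While programs for a random access machine with finitely many registers per
   program, an indirectly addressed memory, and unit cost for each operation
   and each test.  There is no multiplication or shift: a step at most doubles
   the largest value stored, so running times agree with those of Turing
   machines up to a polynomial (and the size of the input numbers). *)

Inductive program :=
  | Skip
  | Const (i c : nat)           (* R_i := c *)
  | Add (i j l : nat)           (* R_i := R_j + R_l *)
  | Sub (i j l : nat)           (* R_i := R_j - R_l, truncated *)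
  | Read (i j : nat)            (* R_i := M[R_j] *)
  | Write (i j : nat)           (* M[R_i] := R_j *)
  | Seq (p q : program)
  | If (i : nat) (p q : program)  (* tests R_i <> 0 *)
  | While (i : nat) (p : program).

Record state := State { reg : nat -> nat; mem : nat -> nat }.

Definition set_reg (s : state) (i v : nat) : state :=
  State [eta reg s with i |-> v] (mem s).

Definition set_mem (s : state) (a v : nat) : state :=
  State (reg s) [eta mem s with a |-> v].

(* [exec p s t s']: started in [s], [p] halts in [s'] after time [t]. *)
Inductive exec : program -> state -> nat -> state -> Prop :=
  | ExecSkip s : exec Skip s 1 s
  | ExecConst s i c : exec (Const i c) s 1 (set_reg s i c)
  | ExecAdd s i j l :
      exec (Add i j l) s 1 (set_reg s i (reg s j + reg s l))
  | ExecSub s i j l :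
      exec (Sub i j l) s 1 (set_reg s i (reg s j - reg s l))
  | ExecRead s i j : exec (Read i j) s 1 (set_reg s i (mem s (reg s j)))
  | ExecWrite s i j : exec (Write i j) s 1 (set_mem s (reg s i) (reg s j))
  | ExecSeq p q s1 s2 s3 t1 t2 :
      exec p s1 t1 s2 -> exec q s2 t2 s3 -> exec (Seq p q) s1 (t1 + t2) s3
  | ExecIfTrue i p q s t s' :
      reg s i <> 0 -> exec p s t s' -> exec (If i p q) s t.+1 s'
  | ExecIfFalse i p q s t s' :
      reg s i = 0 -> exec q s t s' -> exec (If i p q) s t.+1 s'
  | ExecWhileTrue i p s1 s2 s3 t1 t2 :
      reg s1 i <> 0 -> exec p s1 t1 s2 -> exec (While i p) s2 t2 s3 ->
      exec (While i p) s1 (t1 + t2).+1 s3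
  | ExecWhileFalse i p s :
      reg s i = 0 -> exec (While i p) s 1 s.

(* R_0 = n, R_1 = k, and M holds the n x n adjacency matrix, row by row, for
   the numbering [num] of the vertices; everything else is 0. *)
Definition input (G : sgraph) (num : 'I_#|G| -> G) (k : nat) : state :=
  State [eta fun=> 0 with 0 |-> #|G|, 1 |-> k]
    (fun a => [exists i : 'I_#|G|, exists j : 'I_#|G|,
                 (a == i * #|G| + j) && edge (num i) (num j)] : nat).

(* On inputs from the class [C] (a promise: nothing is asked for other graphs),
   [p] decides [P G k], as read off R_0, within time [T n k]. *)
Definition solves_within (R : realType) (C : sgraph -> Prop)
    (P : sgraph -> nat -> Prop) (p : program) (T : nat -> nat -> R) : Prop :=
  forall (G : sgraph) (num : 'I_#|G| -> G) (k : nat), C G -> bijective num ->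
    exists (t : nat) (s : state),
      [/\ exec p (input num k) t s,
          reg s 0 <> 0 <-> P G k
        & (t%:R <= T #|G| k)%R].

(* Main.v *)
Require Import Defs.
From mathcomp Require Import all_boot all_order all_algebra.
From mathcomp Require Import boolp reals exp.
From mathcomp Require Import zify ring lra.

Set Implicit Arguments.
Unset Strict Implicit.
Unset Printing Implicit Defensive.

Import Order.TTheory GRing.Theory Num.Theory.

(* The algorithm decides vertices, in or out of the solution, one at a time and
   treats the connected components of the r-cliques not yet hit separately; once
   excluded, a vertex no longer connects the cliques through it.  Let the torso
   of a set [A] be the graph on [A] in which vertices are joined if they are
   adjacent or have a common neighbour outside [A].  If a solution [S] lies in a
   set [A] whose torso has elimination depth [h], then deciding the vertices of
   [A] in the elimination order makes at most [h] decisions on every branch, so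
   a table indexed by decision sequences of length at most [h] is enough.

   For every [gamma > alpha] there is such an [A] with [h = O(|S|^gamma)].
   Small treewidth gives balanced separators of size [O(m^alpha)] of sets of [m]
   vertices.  If the 1-subdivision of a graph on [m] vertices lies in [G], that
   graph has [O(m^(1+eta))] edges: there are [O(m)] edges meeting every pair of
   vertex sets with a constant fraction of all edges across; the two sides of a
   balanced separator of the branch vertices and the subdivision vertices of
   these [O(m)] edges have none of them across, hence few edges at all, and one
   inducts on the sides.  By this density bound, adding to [S] vertices with
   many neighbours inside stops before the set has doubled.  In the resulting
   [A], outside vertices have [O(|S|^eta)] neighbours, and the torso edges of
   [B], a subset of [A], have [O(|B|^(1+eta))] witnesses in all, so a separator
   of [B] and the witnesses yields one of the torso.

   Of the r-cliques only [(k+1)^r] are needed: go through them in order and drop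
   those with a subset [mu] lying in [(k+1)^(r-|mu|)] cliques kept before.  The
   exponent [gamma] is a rational [a/b] with [alpha < a/b <= 2 alpha/(1+alpha)],
   and the program finds [h] by counting the [x < k] with [x^b < k^a]. *)

(** * Balanced separators *)

(** The depth has to be bounded in terms of [k], not of [n], so [A] is built from an unknown
    solution and is never computed: the table minimises over all decision sequences. Its values up
    to [k] are attained by actual hitting sets whatever the depth; [A] only shows that sequences of
    length [h] reach the optimum.

    The exponent [2 alpha / (1 + alpha)] exceeds [alpha] because [alpha < 1]. This gap pays for
    every factor [k^eta], from the density bound and from the degrees of outside vertices, and for
    rounding to a rational. For fixed [r] a decision has [O(m)] options when [m] cliques are kept;
    the kernel makes [m] polynomial in [k], so [h] decisions cost [2^(O(h log k))] instead of [n^h].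

    The degree of the polynomial in [n] is fixed before [alpha] and the class. Hence the command
    list depends on [r] alone, and the constants of the class reach it as data in registers. The
    machine has neither multiplication nor recursion, so the algorithm is a fixed list of tables
    filled by arithmetic expressions; a bound on the table entries then bounds the running time. *)

Section Centroid.
Variables (V : finType) (T : sgraph) (Bag : T -> {set V}) (B : {set V}).
Hypotheses (T_tree : is_tree T) (Bag_cover : forall x, exists t, x \in Bag t).

(** Isolating [u] instead of removing it keeps the vertex type, so components of [T - u] for
    different [u] can be compared. *)
Definition cut (u : T) : rel T :=
  fun x y => [&& edge x y, x != u & y != u].

Lemma cut_sym u : connect_sym (cut u).
Proof.
apply: sym_connect_sym => x y; rewrite /cut.
by rewrite edge_sym; congr andb; apply: andbC.
Qed.

Lemma connect_cut_neq u x y : x != u -> connect (cut u) x y -> y != u.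
Proof.
move=> xu /connectP[p]; elim: p x xu => [|z p IHp] x xu /= => [_ ->//|].
by case/andP=> /and3P[_ _ zu]; apply: IHp.
Qed.

(** Otherwise a walk from [t] to [s] avoiding [u], followed by one from [s] to [u] avoiding [t],
    joins [t] to [u] without the edge between them and closes a cycle. *)
Lemma tree_bridge u t s :
  edge u t -> connect (cut u) t s -> ~~ connect (cut t) u s.
Proof.
move=> ut ts; apply/negP => us.
pose e := [rel x y : T | edge x y &&
  ~~ ((x == u) && (y == t) || (x == t) && (y == u))].
have sub_e v : v \in [:: u; t] -> subrel (cut v) (connect e).
  move=> vut x y /= /and3P[xy xv yv]; apply: connect1 => /=.
  move: vut; rewrite xy !inE => /orP[]/eqP <-.
    by rewrite (negPf xv) (negPf yv) andbF.
  by rewrite (negPf xv) (negPf yv) andbF.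
have tu : connect e t u.
  apply: (connect_trans (connect_sub (sub_e u _) ts)); first by rewrite inE eqxx.
  rewrite cut_sym in us.
  by apply: (connect_sub (sub_e t _) us); rewrite !inE eqxx orbT.
case/connectP: tu => p0 p0P; case/shortenP: p0P => p pe Up _ uE.
case: T_tree => _ _ /(_ (t :: p)); apply; last first.
  rewrite /ucycle Up andbT /= rcons_path -uE ut andbT.
  by apply: sub_path pe => x y /andP[].
case: p pe Up uE => [|v [|w p]] //=.
  by move=> _ _ uE; rewrite uE edge_irr in ut.
by rewrite andbT => + _ uE; rewrite -uE !eqxx orbT andbF.
Qed.

Lemma connect_cut_nbr u c : c != u -> exists2 t, edge u t & connect (cut u) c t.
Proof.
case: T_tree => _ /(_ c u)/connectP[p] + + _.
elim: p c => [|z p IHp] c /=; first by move=> _ ->; rewrite eqxx.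
case/andP=> cz pz uE cu; have [zu|zu] := eqVneq z u.
  by exists c => //; rewrite edge_sym -zu.
have [t ut zt] := IHp z pz uE zu; exists t => //.
by apply: connect_trans zt; apply: connect1; rewrite /cut cz cu zu.
Qed.

Definition inside u c : {set V} :=
  [set b in B | (b \notin Bag u) && [forall s, (b \in Bag s) ==> connect (cut u) c s]].

Lemma inside_conn u c t : connect (cut u) c t -> inside u c = inside u t.
Proof.
move=> ct; apply/setP => b; rewrite !inE; congr [&& _, _ & _].
by apply: eq_forallb => s; rewrite (same_connect (cut_sym u) ct).
Qed.

(** If every node had a heavy component, take a heavy pair with the smallest component and step to
    the neighbour [t] of [u] inside it. A heavy component at [t] containing [u] would be disjoint
    from the first, too much for [B]; one avoiding [u] lies in the first and misses [t], against
    minimality. *)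
Lemma centroid : exists u, forall c, c != u -> 2 * #|inside u c| <= #|B|.
Proof.
have [//|nex] := EM (exists u, forall c, c != u -> 2 * #|inside u c| <= #|B|).
exfalso; pose heavy := [pred uc : T * T | (uc.2 != uc.1) && (#|B| < 2 * #|inside uc.1 uc.2|)].
have hv u : exists c, heavy (u, c).
  apply/not_existsP => nc; apply: nex; exists u => c cu; rewrite leqNgt.
  by apply/negP => lt; apply: (nc c); rewrite /= cu.
have [u0 _] : exists u0 : T, true by case: T_tree => /card_gt0P[u _] _ _; exists u.
have [c0 hc0] := hv u0.
case: (arg_minnP (fun uc : T * T => #|[set s | connect (cut uc.1) uc.2 s]|) hc0).
case=> u c /= /andP[cu huc] minuc {u0 c0 hc0}.
have [t ut ct] := connect_cut_nbr cu.
have tu : t != u by apply: contraTneq ut => ->; rewrite edge_irr.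
rewrite (inside_conn ct) in huc.
have [c' /=/andP[c't hc']] := hv t.
have [c'u|nc'u] := boolP (connect (cut t) c' u).
  rewrite (inside_conn c'u) in hc'.
  suff : #|inside u t| + #|inside t u| <= #|B| by lia.
  have -> : #|inside u t| + #|inside t u| = #|inside u t :|: inside t u|.
    rewrite cardsU (_ : _ :&: _ = set0) ?cards0 ?subn0 //.
    apply/setP => b; rewrite !inE; apply/negP => /andP[].
    case/and3P=> _ _ /forallP h1 /and3P[_ _ /forallP h2].
    have [s bs] := Bag_cover b.
    by have := tree_bridge ut (implyP (h1 s) bs); rewrite (implyP (h2 s) bs).
  by apply: subset_leq_card; apply/subsetP => b; rewrite !inE => /orP[]/andP[].
have [t' tt' c't'] := connect_cut_nbr c't.
have keep s : connect (cut t) c' s -> connect (cut u) c' s.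
  case/connectP=> p; elim/last_ind: p s => [|p z IHp] s; first by move=> _ ->.
  rewrite rcons_path last_rcons => /andP[pp pz] ->{s}.
  have cp : connect (cut t) c' (last c' p) by apply/connectP; exists p.
  have cz : connect (cut t) c' z by apply: connect_trans cp (connect1 pz).
  apply: connect_trans (IHp _ pp erefl) (connect1 _).
  have ncu v : connect (cut t) c' v -> v != u.
    by move=> c'v; apply/negP => /eqP vu; rewrite -vu c'v in nc'u.
  by case/and3P: pz => lz _ _; rewrite /cut lz /= !ncu.
have ut' : t' != u by apply/negP => /eqP tu'; rewrite -tu' c't' in nc'u.
have c't2 : connect (cut u) c' t.
  apply: connect_trans (keep _ c't') (connect1 _).
  by rewrite /cut edge_sym tt' ut' tu.
have := minuc (t, c'); rewrite /= c't hc' => /(_ isT); rewrite leqNgt => /negP; apply.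
apply: proper_card; apply/properP; split.
  apply/subsetP => s; rewrite !inE => /keep c's.
  rewrite (same_connect (cut_sym u) ct).
  by rewrite cut_sym in c't2; apply: connect_trans c't2 c's.
exists t; rewrite !inE //; apply/negP => /(connect_cut_neq c't).
by rewrite eqxx.
Qed.

End Centroid.

(** A weight of at least [N / 3] can stand alone. If all are smaller and the total exceeds [2N / 3],
    a smallest set of weight at least [N / 3] overshoots by less than one weight. *)
Lemma balanced_grouping (I : finType) (w : I -> nat) (N : nat) :
    \sum_i w i <= N -> (forall i, 2 * w i <= N) ->
  exists J : {set I}, 3 * \sum_(i in J) w i <= 2 * N
    /\ 3 * \sum_(i in ~: J) w i <= 2 * N.
Proof.
move=> sumw half.
have splitw (J : {set I}) : \sum_i w i = \sum_(i in J) w i + \sum_(i in ~: J) w i.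
  rewrite (bigID (mem J)) /=; congr addn; apply: eq_bigl => i; by rewrite inE.
have [[j hj]|nbig] := EM (exists j, N <= 3 * w j).
  exists [set j]; have := splitw [set j]; rewrite big_set1; have := half j; lia.
have small j : 3 * w j < N by rewrite ltnNge; apply/negP => hj; apply: nbig; exists j.
have [le|gt] := leqP (3 * \sum_i w i) (2 * N).
  by exists setT; have := splitw setT; rewrite setCT big_set0 addn0 => <-; split=> //; rewrite muln0.
have PT : N <= 3 * \sum_(i in [set: I]) w i.
  by have := splitw setT; rewrite setCT big_set0 addn0 => <-; lia.
case: (arg_minnP (P := fun J : {set I} => N <= 3 * \sum_(i in J) w i)
  (fun J : {set I} => #|J|) PT) => J /= PJ minJ.
exists J; have := splitw J; split; last by lia.
have [J0|[j jJ]] := set_0Vmem J; first by rewrite J0 big_set0 muln0.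
have : ~~ (N <= 3 * \sum_(i in J :\ j) w i).
  apply/negP => /minJ; rewrite [#|J|](cardsD1 j) jJ; lia.
by rewrite (big_setD1 j jJ) /=; have := small j; lia.
Qed.

Definition separation (G : sgraph) (Z V1 V2 : {set G}) : Prop :=
  [/\ [disjoint V1 & V2], [disjoint Z & V1 :|: V2]
    & forall x y, x \in V1 -> y \in V2 -> ~~ edge x y].

Lemma treedec_separation (G T : sgraph) (Bag : T -> {set G}) (B : {set G}) :
    tree_decomposition Bag ->
  exists Z V1 V2 : {set G}, [/\ separation Z V1 V2, Z :|: V1 :|: V2 = setT,
    #|Z| <= (width Bag).+1,
    3 * #|V1 :&: B| <= 2 * #|B| & 3 * #|V2 :&: B| <= 2 * #|B|].
Proof.
case=> T_tree cover edges conn.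
have [u hu] := centroid B T_tree cover.
pose node x := xchoose (cover x).
have nodeP x : x \in Bag (node x) := xchooseP (cover x).
(* Outside the bag of the centroid, all bags of a vertex lie in one component of [T - u]; its
   canonical root serves as a label, and whole components are then grouped. *)
pose lab x := fingraph.root (cut u) (node x).
have nodes x s : x \notin Bag u -> x \in Bag s -> connect (cut u) (node x) s.
  move=> xu xs; have := conn x _ _ (nodeP x) xs; apply: connect_sub => a b /=.
  case/and3P=> ab xa xb; apply: connect1; rewrite /cut ab /=.
  by apply/andP; split; apply/negP => /eqP E; move: xa xb; rewrite E (negPf xu).
have labP x s : x \notin Bag u -> x \in Bag s -> fingraph.root (cut u) s = lab x.
  by move=> xu xs; apply/esym/(fingraph.rootP (cut_sym u)); apply: nodes.
pose w i := #|[set b in B | (b \notin Bag u) && (lab b == i)]|.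
have sumw (J : {set T}) :
    \sum_(i in J) w i = #|[set b in B | (b \notin Bag u) && (lab b \in J)]|.
  rewrite -sum1_card (partition_big lab (mem J)) /=; last first.
    by move=> b; rewrite inE => /and3P[].
  apply: eq_bigr => i iJ; rewrite /w -sum1_card; apply: eq_bigl => b.
  by rewrite !inE; have [->|] := eqVneq (lab b) i; rewrite ?iJ ?andbT ?andbF.
have [J [J1 J2]] : exists J : {set T}, 3 * \sum_(i in J) w i <= 2 * #|B|
    /\ 3 * \sum_(i in ~: J) w i <= 2 * #|B|.
  apply: balanced_grouping.
    have := sumw setT; rewrite (eq_bigl xpredT) => [->|i]; last by rewrite inE.
    by apply: subset_leq_card; apply/subsetP => b; rewrite inE => /andP[].
  move=> i; have [iu|iu] := eqVneq i u.
    rewrite (_ : w i = 0) //; apply: eq_card0 => b; rewrite !inE.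
    apply/negP => /and3P[_ bu /eqP labi].
    have nu : node b != u by apply/negP => /eqP E; move: bu; rewrite -E nodeP.
    have := connect_cut_neq nu (connect_root (cut u) (node b)).
    by rewrite -/(lab b) labi iu eqxx.
  apply: leq_trans (hu i iu); rewrite leq_pmul2l //.
  apply: subset_leq_card; apply/subsetP => b; rewrite !inE.
  case/and3P=> -> bu /eqP labi; rewrite bu /=; apply/forallP => s.
  apply/implyP => bs; rewrite -labi (cut_sym u).
  apply: (@connect_trans _ _ (node b)); last exact: connect_root.
  by rewrite (cut_sym u); apply: nodes.
rewrite !sumw in J1 J2.
exists (Bag u), [set x | (x \notin Bag u) && (lab x \in J)],
  [set x | (x \notin Bag u) && (lab x \notin J)]; split.
- split.
  + rewrite -setI_eq0; apply/eqP/setP => x; rewrite !inE.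
    by case: (lab x \in J); rewrite ?andbF.
  + rewrite -setI_eq0; apply/eqP/setP => x; rewrite !inE.
    by case: (x \in Bag u).
  + move=> x y; rewrite !inE => /andP[xu xJ] /andP[yu yJ]; apply/negP => /edges.
    case=> s /andP[xs ys]; move: yJ; rewrite -(labP y s yu ys) (labP x s xu xs).
    by rewrite xJ.
- by apply/setP => x; rewrite !inE; case: (x \in Bag u) => //=; case: (lab x \in J).
- apply: leq_trans (leqSpred _).
  exact: (leq_bigmax (F := fun t => #|Bag t|)).
- move: J1; rewrite (_ : [set x | _] :&: B = [set b in B | (b \notin Bag u) && (lab b \in J)]) //.
  by apply/setP => b; rewrite !inE andbC.
- move: J2; rewrite (_ : [set x | _] :&: B = [set b in B | (b \notin Bag u) && (lab b \in ~: J)]) //.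
  by apply/setP => b; rewrite !inE andbC.
Qed.

Section Separable.
Local Open Scope ring_scope.
Variable R : realType.

(** Heredity is built in by letting [A] range over all vertex sets of one graph, so separator
    arguments need no induced subgraphs. Balance is asked for [B] only, because [A] will also
    contain auxiliary vertices: subdivision vertices or witnesses. *)
Definition separable (c alpha : R) (G : sgraph) : Prop :=
  forall A B : {set G}, B \subset A -> exists Z V1 V2 : {set G},
    [/\ separation Z V1 V2, Z :|: V1 :|: V2 = A,
        #|Z|%:R <= c * #|A|%:R `^ alpha,
        (3 * #|V1 :&: B| <= 2 * #|B|)%N & (3 * #|V2 :&: B| <= 2 * #|B|)%N].

Lemma powR_nat_ge1 (n : nat) (x : R) : (0 < n)%N -> 0 <= x -> 1 <= n%:R `^ x.
Proof.
by move=> n0 x0; rewrite -[leLHS](powRr0 n%:R); apply: ler_powR => //; rewrite ler1n.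
Qed.

Lemma hereditary_separable (C : sgraph -> Prop) (alpha : R) :
    0 < alpha -> hereditary C ->
    (exists (c : R) (N : nat), forall G : sgraph, C G -> (N <= #|G|)%N ->
       (treewidth G)%:R <= c * #|G|%:R `^ alpha) ->
  exists2 c : R, 0 < c & forall G, C G -> separable c alpha G.
Proof.
move=> a0 [_ Cind] [c [N tw]].
(* [N] pays for sets of fewer than [N] vertices, which are their own separators; [1] pays for a bag
   being one larger than the width. *)
exists (`|c| + N%:R + 1); first by rewrite ltr_wpDl // addr_ge0.
move=> G CG A B BA.
have cge0 : 0 <= `|c| + N%:R + 1 by rewrite !addr_ge0.
have cardA : #|induced A| = #|A| by rewrite card_sig; apply: eq_card => x; rewrite !inE.
have [->|[a aA]] := set_0Vmem A.
  exists set0, set0, set0; split; rewrite ?set0U ?set0I ?cards0 ?mulr_ge0 ?powR_ge0 //.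
  by split; rewrite ?set0U -?setI_eq0 ?set0I // => x y; rewrite inE.
have A_gt0 : (0 < #|A|)%N by apply/card_gt0P; exists a.
have pA := powR_nat_ge1 A_gt0 (ltW a0).
have [ltN|geN] := ltnP #|A| N.
  exists A, set0, set0; split; rewrite ?setU0 ?set0I ?cards0 //.
    by split; rewrite ?setU0 -?setI_eq0 ?setI0 // => x y; rewrite inE.
  apply: (@le_trans _ _ (N%:R * 1)); first by rewrite mulr1 ler_nat ltnW.
  by apply: ler_pM => //; rewrite -addrA addrCA ler_wpDr // addr_ge0.
have := tw _ (Cind G A CG); rewrite cardA => /(_ geN).
rewrite /treewidth; case: ex_minnP => w /asboolP[T [Bag [dec wE]]] _ wle.
pose B' := [set x : induced A | val x \in B].
have [Z [V1 [V2 [[d1 d2 ne] cov sz s1 s2]]]] := treedec_separation B' dec.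
have val_inj' : injective (val : induced A -> G) by apply: val_inj.
have inA (x : G) (U : {set induced A}) : x \in val @: U -> x \in A.
  by case/imsetP => y _ ->; apply: (valP y).
have dis (U1 U2 : {set induced A}) : [disjoint U1 & U2] ->
    [disjoint val @: U1 & val @: U2].
  rewrite -!setI_eq0 => /eqP d; apply/eqP/setP => x; rewrite !inE.
  apply/negP => /andP[/imsetP[y yU ->]] /imsetP[z zU /val_inj' yz].
  by have := in_set0 y; rewrite -d !inE yU yz zU.
have cardI (U : {set induced A}) : #|val @: U :&: B| = #|U :&: B'|.
  rewrite -(card_imset _ val_inj'); apply: eq_card => x; rewrite !inE.
  apply/andP/imsetP => [[/imsetP[y yU ->] yB]|[y]].
    by exists y => //; rewrite !inE yU.
  by rewrite !inE => /andP[yU yB] ->; split=> //; apply: imset_f.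
have B'B : (#|B'| <= #|B|)%N.
  rewrite -(card_imset _ val_inj'); apply: subset_leq_card.
  by apply/subsetP => x /imsetP[y]; rewrite inE => yB ->.
exists (val @: Z), (val @: V1), (val @: V2); split.
- split; [exact: dis | by rewrite -imsetU; apply: dis | ].
  by move=> x y /imsetP[x' xV ->] /imsetP[y' yV ->]; apply: (ne x' y').
- apply/setP => x; rewrite !inE; apply/idP/idP.
    by case/orP=> [/orP[]|]; apply: inA.
  move=> xA; have : (Sub x xA : induced A) \in Z :|: V1 :|: V2 by rewrite cov inE.
  rewrite !inE => /orP[/orP[]|] h; apply/orP; [left; apply/orP; left|left; apply/orP; right|right];
  by apply/imsetP; eexists; first exact: h.
- rewrite (card_imset _ val_inj').
  apply: (@le_trans _ _ (w%:R + 1)); first by rewrite natr1 ler_nat -wE.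
  rewrite -addrA mulrDl; apply: lerD.
    by apply: le_trans wle _; apply: ler_wpM2r; rewrite ?powR_ge0 ?ler_norm.
  apply: le_trans pA _; rewrite -{1}[X in X <= _]mul1r.
  by apply: ler_wpM2r; rewrite ?powR_ge0 // ler_wpDl.
- by rewrite cardI (leq_trans s1) // leq_mul2l.
- by rewrite cardI (leq_trans s2) // leq_mul2l.
Qed.

End Separable.

(** By averaging, some element of [E] lies in a fraction [1 / q] of the sets not yet hit. Each pick
    therefore scales their number by at most [(q - 1) / q], and after [N] picks fewer than one is
    left. *)
Lemma greedy_hitting_set (I J : finType) (E : {set I}) (P : {set J})
    (F : J -> {set I}) (q N : nat) :
    0 < #|E| -> 0 < q ->
    (forall j, j \in P -> F j \subset E) ->
    (forall j, j \in P -> #|E| <= q * #|F j|) ->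
    #|P| * q.-1 ^ N < q ^ N ->
  exists E0 : {set I}, [/\ E0 \subset E, #|E0| <= N
    & forall j, j \in P -> ~~ [disjoint F j & E0]].
Proof.
move=> E0 q0 FE Fbig PN.
pose U (X : {set I}) := [set j in P | [disjoint F j & X]].
suff [X [XE XN XU]] : exists X : {set I},
    [/\ X \subset E, #|X| <= N & #|U X| * q ^ N <= #|P| * q.-1 ^ N].
  exists X; split=> // j jP; apply/negP => dis.
  have : 0 < #|U X| by apply/card_gt0P; exists j; rewrite inE jP.
  by move: XU; rewrite leqNgt => /negP + U0; apply; apply: leq_trans PN _; rewrite leq_pmull.
elim: N {PN} => [|N [X [XE XN XU]]].
  exists set0; split; rewrite ?sub0set ?cards0 ?muln1 //.
  by apply: subset_leq_card; apply/subsetP => j; rewrite inE => /andP[].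
have [e eE he] : exists2 e, e \in E & #|U X| <= q * #|[set j in U X | e \in F j]|.
  have [//|nex] := EM (exists2 e, e \in E & #|U X| <= q * #|[set j in U X | e \in F j]|).
  exfalso; have lt e : e \in E -> q * #|[set j in U X | e \in F j]| < #|U X|.
    by move=> eE; rewrite ltnNge; apply/negP => le; apply: nex; exists e.
  have : \sum_(j in U X) q * #|F j| < #|E| * #|U X|.
    have -> : \sum_(j in U X) q * #|F j| =
        \sum_(e in E) q * #|[set j in U X | e \in F j]|.
      rewrite -!big_distrr /=; congr muln.
      transitivity (\sum_(j in U X) \sum_(e in E | e \in F j) 1).
        apply: eq_bigr => j; rewrite inE => /andP[jP _].
        rewrite -sum1_card; apply: eq_bigl => e.
        by have [/(subsetP (FE _ jP)) ->|] := boolP (e \in F j); rewrite ?andbF.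
      rewrite (exchange_big_dep (mem E)) /=; last by move=> j e _ /andP[].
      apply: eq_bigr => e eE; rewrite -sum1_card; apply: eq_bigl => j.
      by rewrite [in RHS]inE eE.
    rewrite -sum_nat_const; case/card_gt0P: (E0) => e eE.
    rewrite (bigD1 e) //= [X in _ < X](bigD1 e) //= -addSn.
    by apply: leq_add; [exact: lt | apply: leq_sum => i /andP[/lt/ltnW]].
  rewrite ltnNge => /negP; apply; rewrite mulnC -sum_nat_const.
  by apply: leq_sum => j; rewrite inE => /andP[/Fbig].
exists (e |: X); split.
- by apply/subsetP => x; rewrite !inE => /orP[/eqP->//|]; apply: (subsetP XE).
- by rewrite cardsU1; case: (e \notin X) => /=; lia.
have -> : #|U (e |: X)| = #|U X| - #|[set j in U X | e \in F j]|.
  rewrite -(cardsID [set j | e \in F j] (U X)).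
  rewrite (_ : U X :&: _ = [set j in U X | e \in F j]); last first.
    by apply/setP => j; rewrite in_setI [in RHS]inE [X in _ && X]inE.
  rewrite addKn; apply: eq_card => j; rewrite !inE.
  have [jP|] //= := boolP (j \in P); last by rewrite andbF.
  by rewrite -!setI_eq0 setIUr setU_eq0 setI_eq0 disjoint_sym disjoints1.
rewrite !expnS; move: he XU; case: q q0 {Fbig} => // q _ /=.
set a := #|U X|; set b := #|_|; set p := #|P|; move=> he XU.
apply: (@leq_trans (a * q * q.+1 ^ N)); last first.
  by rewrite mulnAC mulnCA mulnC leq_mul2l XU orbT.
rewrite mulnA leq_mul2r; apply/orP; right; rewrite mulnBl; lia.
Qed.

(** * Density of subdivisions *)

(* [E] is a set of pairs of [B] that are joined by an edge or, for pairwise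
   distinct vertices [w e] outside [B], by a path of length two through [w e]. *)
Definition subdivided (G : sgraph) (B : {set G}) (E : {set G * G})
    (w : G * G -> G) : Prop :=
  [/\ E \subset setX B B,
      forall e, e \in E -> w e = e.1 \/ (w e \notin B /\ edge (w e) e.1),
      forall e, e \in E -> edge (w e) e.2
    & forall e e', e \in E -> e' \in E -> w e \notin B -> w e = w e' -> e = e'].

Lemma mem_setX (T1 T2 : finType) (A1 : {set T1}) (A2 : {set T2}) (e : T1 * T2) :
  (e \in setX A1 A2) = (e.1 \in A1) && (e.2 \in A2).
Proof. by rewrite inE. Qed.

Lemma subdividedI (G : sgraph) (B B' : {set G}) (E : {set G * G}) w :
  B' \subset B -> subdivided B E w -> subdivided B' (E :&: setX B' B') w.
Proof.
move=> B'B [EB w1 w2 winj]; split.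
- exact: subsetIr.
- move=> e; rewrite inE => /andP[eE _]; have [->|[wB ->]] := w1 e eE; [by left|right].
  by split=> //; apply: contra wB; apply: (subsetP B'B).
- by move=> e; rewrite inE => /andP[eE _]; apply: w2.
- move=> e e'; rewrite !in_setI => /andP[eE] + /andP[e'E _] weB wee'.
  rewrite inE => /andP[e1 _].
  have [we|[wB _]] := w1 e eE; first by rewrite we e1 in weB.
  exact: winj wee'.
Qed.

(** Bernoulli: [(1 + 1/p)^N >= 1 + N/p], which exceeds 4 at [N = 3p + 1]. The 4 comes from the
    [4 ^ #|B|] pairs of subsets of [B]: a number of picks linear in [#|B|] hits all the dense
    ones. *)
Lemma expn_pred_lt p : 4 * p ^ (3 * p).+1 < p.+1 ^ (3 * p).+1.
Proof.
have bern N : p ^ N * (p + N) <= p * p.+1 ^ N.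
  elim: N => [|N IH]; first by rewrite !expn0 addn0 mul1n muln1.
  rewrite !expnS; apply: (@leq_trans (p.+1 * (p ^ N * (p + N)))); last by rewrite [leqRHS]mulnCA leq_mul2l IH orbT.
  by move: (p ^ N) => x; nia.
case: p bern => [|p] bern; first by rewrite exp0n // exp1n.
have := bern (3 * p.+1).+1; set a := _ ^ _; set b := _ ^ _ => h.
have a0 : 0 < a by rewrite expn_gt0.
rewrite -(ltn_pmul2l (ltn0Sn p)); nia.
Qed.

Section Density.
Local Open Scope ring_scope.
Variable R : realType.

Lemma subdivided_split (c alpha : R) (q : nat) (G : sgraph) (B : {set G}) E w :
    (0 < q)%N -> 0 <= c -> 0 <= alpha -> separable c alpha G -> subdivided B E w -> (0 < #|E|)%N ->
  exists (B1 B2 : {set G}) (s x : nat),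
    [/\ B1 \subset B, B2 \subset B,
        (#|E| <= #|E :&: setX B1 B1| + #|E :&: setX B2 B2| + x)%N /\
        (q * x <= #|E|)%N,
        [/\ #|B1| + #|B2| <= #|B| + s, 3 * #|B1| <= 2 * #|B| + 3 * s &
            3 * #|B2| <= 2 * #|B| + 3 * s]%N
      & s%:R <= c * (#|B| * (3 * q.-1).+2)%:R `^ alpha].
Proof.
move=> q0 c0 al0 sep [EB w1 w2 winj] E0.
pose cross (P : {set G} * {set G}) := E :&: (setX P.1 P.2 :|: setX P.2 P.1).
pose big := [set P in setX (powerset B) (powerset B) | (#|E| <= q * #|cross P|)%N].
pose N := (#|B| * (3 * q.-1).+1)%N.
have B0 : (0 < #|B|)%N.
  case/card_gt0P: E0 => e /(subsetP EB); rewrite inE => /andP[e1 _].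
  by apply/card_gt0P; exists e.1.
have bigE P : P \in big -> (#|E| <= q * #|cross P|)%N by rewrite inE => /andP[].
have bigN : (#|big| * q.-1 ^ N < q ^ N)%N.
  apply: (@leq_ltn_trans (4 ^ #|B| * q.-1 ^ N)%N).
    rewrite leq_mul2r; apply/orP; right.
    apply: (@leq_trans #|setX (powerset B) (powerset B)|).
      by apply: subset_leq_card; apply/subsetP => P; rewrite inE => /andP[].
    by rewrite cardsX !card_powerset -expnMn.
  rewrite /N mulnC [(#|B| * _)%N]mulnC !expnM -expnMn ltn_exp2r //.
  by have := expn_pred_lt q.-1; rewrite (prednK q0) mulnC.
have [E0' [E0E E0N hit]] := greedy_hitting_set E0 q0
  (fun P _ => subsetIl _ _) bigE bigN.
pose W := B :|: [set w e | e in E0'].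
have BW : B \subset W by apply: subsetUl.
have [Z [V1 [V2 [[d12 dZ nV] cov sz h1 h2]]]] := sep W B BW.
(* The separator is moved into [B]: a subdivision vertex in [Z] belongs to a single edge and is
   traded for one end of it, so the size does not grow. *)
pose Z' := (Z :&: B) :|: [set e.1 | e in [set e in E0' | (w e \in Z) && (w e \notin B)]].
have Z'Z : (#|Z'| <= #|Z|)%N.
  apply: (leq_trans (leq_card_setU _ _)); rewrite -(cardsID B Z) leq_add2l.
  apply: leq_trans (leq_imset_card _ _) _.
  rewrite -(card_in_imset (f := w)).
    apply: subset_leq_card; apply/subsetP => x /imsetP[e]; rewrite !inE.
    by case/and3P=> _ eZ eB ->; rewrite eZ eB.
  move=> e e'; rewrite !inE => /and3P[eE _ eB] /and3P[e'E _ _] ee'.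
  by apply: (winj e e' _ _ eB ee'); apply: (subsetP E0E).
have Z'B : Z' \subset B.
  apply/subsetP => x; rewrite !inE => /orP[/andP[]//|/imsetP[e]].
  rewrite inE => /andP[/(subsetP E0E)/(subsetP EB) + _ ->].
  by rewrite inE => /andP[].
pose C1 := (V1 :&: B) :\: Z'; pose C2 := (V2 :&: B) :\: Z'.
have C1B : C1 \subset B by apply/subsetP => x; rewrite !inE => /and3P[].
have C2B : C2 \subset B by apply/subsetP => x; rewrite !inE => /and3P[].
have V12 x : x \in V1 -> x \in V2 -> False.
  by move=> x1 x2; have := disjointFr d12 x1; rewrite x2.
(* The middle of a chosen edge with both ends off [Z'] lies in [V1] or in [V2], so its two ends
   cannot be on different sides. *)
have nE0 e : e \in E0' -> e \notin cross (C1, C2).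
  move=> eE0; have eE := subsetP E0E _ eE0.
  apply/negP; rewrite inE => /andP[_].
  have wW : w e \in Z :|: V1 :|: V2.
    by rewrite cov inE; apply/orP; right; apply: imset_f.
  have Z'1 : e.1 \notin Z' -> w e \notin Z.
    apply: contra => wZ; rewrite inE; have [we|[wB _]] := w1 e eE.
      by rewrite inE -we wZ we; have := subsetP EB _ eE; rewrite inE => /andP[->].
    by apply/orP; right; apply: imset_f; rewrite inE eE0 wZ.
  have e12 : w e = e.1 \/ edge (w e) e.1 by case: (w1 e eE) => [|[]]; [left|right].
  have we2 := w2 e eE.
  rewrite !in_setU in wW; rewrite in_setU !mem_setX !(in_setD, in_setI) /=.
  case/orP=> /andP[/and3P[e1Z e1V _] /and3P[_ e2V _]];
    rewrite (negPf (Z'1 e1Z)) /= in wW; case/orP: wW => wV.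
  - by move: we2; apply/negP; apply: nV.
  - case: e12 => [we|]; first by apply: (V12 e.1) => //; rewrite -we.
    by rewrite edge_sym; apply/negP; apply: nV.
  - case: e12 => [we|]; first by apply: (V12 e.1) => //; rewrite -we.
    by apply/negP; apply: nV.
  - by move: we2; rewrite edge_sym; apply/negP; apply: nV.
have ncross : (q * #|cross (C1, C2)| < #|E|)%N.
  rewrite ltnNge; apply/negP => le.
  have /hit/negP[] : (C1, C2) \in big by rewrite inE le andbT inE !powersetE C1B C2B.
  rewrite -setI_eq0; apply/eqP/setP => e; rewrite in_set0 in_setI.
  by apply/negP => /andP[eX /nE0/negP].
have cardC (U : {set G}) : (#|(U :&: B) :\: Z'| <= #|U :&: B|)%N by apply/subset_leq_card/subsetDl.
have C12 : (#|C1| + #|C2| + #|Z'| <= #|B|)%N.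
  have -> : (#|C1| + #|C2| = #|C1 :|: C2|)%N.
    rewrite cardsU (_ : C1 :&: C2 = set0) ?cards0 ?subn0 //.
    apply/setP => x; rewrite !inE; apply/negP => /andP[/and3P[_ x1 _] /and3P[_ x2 _]].
    exact: V12 x1 x2.
  have -> : (#|C1 :|: C2| + #|Z'| = #|C1 :|: C2 :|: Z'|)%N.
    rewrite [#|_ :|: Z'|]cardsU (_ : _ :&: Z' = set0) ?cards0 ?subn0 //.
    apply/setP => x; rewrite in_set0 in_setI in_setU !(in_setD _ Z').
    by case: (x \in Z'); rewrite /= ?andbF.
  by apply: subset_leq_card; rewrite 2!subUset C1B C2B Z'B.
(* Both sides receive [Z'], so that every edge that does not cross lies within one of them. *)
exists (C1 :|: Z'), (C2 :|: Z'), #|Z|, #|cross (C1, C2)|; split.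
- by rewrite subUset C1B Z'B.
- by rewrite subUset C2B Z'B.
- split; last exact: ltnW.
  apply: leq_trans (leq_add (leq_card_setU _ _) (leqnn _)).
  apply: leq_trans (leq_card_setU _ _).
  apply: subset_leq_card; apply/subsetP => e eE; have := subsetP EB _ eE.
  have dec x : x \in B -> [|| x \in C1, x \in C2 | x \in Z'].
    move=> xB; have := subsetP BW _ xB; rewrite -cov !inE xB !andbT.
    by case: (x \in Z) => //=; case: (x \in V1); case: (x \in V2); rewrite ?orbT //=; case: (x \in [set _ | _ in _]).
  rewrite mem_setX => /andP[/dec + /dec]; rewrite !(in_setU, in_setI, mem_setX) eE /=.
  by do 2![case/or3P => ->]; rewrite ?orbT.
- have := (leq_card_setU C1 Z').1; have := (leq_card_setU C2 Z').1.
  have := cardC V1; have := cardC V2; rewrite -/C1 -/C2.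
  by clear - C12 Z'Z h1 h2; split; lia.
- apply: (le_trans sz); apply: ler_wpM2l => //.
  apply: ge0_ler_powR => //; rewrite ?nnegrE ?ler0n // ler_nat.
  apply: (leq_trans (leq_card_setU _ _)).
  apply: (@leq_trans (#|B| + N)); last by rewrite /N -mulnS.
  by rewrite leq_add2l; apply: leq_trans (leq_imset_card _ _) _.
Qed.

End Density.

Section DensityBound.
Local Open Scope ring_scope.
Variable R : realType.

Lemma powR_natS (m : nat) (x : R) : 0 <= x -> m%:R `^ (1 + x) = m%:R * m%:R `^ x :> R.
Proof.
move=> x0; case: m => [|m]; last by rewrite powRD ?powRr1 // pnatr_eq0 implybT.
by rewrite mul0r powR0 // gt_eqF // ltr_wpDr.
Qed.

Lemma powR_leN (m n : nat) (x : R) : 0 <= x -> (m <= n)%N -> m%:R `^ x <= n%:R `^ x :> R.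
Proof. by move=> x0 mn; apply: ge0_ler_powR; rewrite ?nnegrE ?ler0n ?ler_nat. Qed.

Lemma subdivided_density (c alpha eta : R) :
    0 <= c -> 0 < alpha < 1 -> 0 < eta ->
  exists2 K : R, 1 <= K & forall (G : sgraph), separable c alpha G ->
    forall (B : {set G}) E w, subdivided B E w ->
    #|E|%:R <= K * #|B|%:R `^ (1 + eta).
Proof.
move=> c0 /andP[a0 a1] eta0.
pose la : R := (3 / 4) `^ eta.
have la0 : 0 <= la by apply: powR_ge0.
have la1 : la < 1.
  have := @gt0_ltr_powR R eta eta0 (3 / 4) 1; rewrite powR1; apply.
  - by rewrite nnegrE; lra.
  - by rewrite nnegrE ler01.
  - by lra.
(* Parts have at most [3m / 4] vertices, which gains the factor [la]. The losses are a fraction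
   [1 / q] of the edges and an increase of the total size by the factor [1 + 1 / q]. The gain wins
   if [la * (q + 1) <= q - 1], and this choice of [q] ensures it. *)
have [q hq] : exists q : nat, 2 <= q%:R * (1 - la).
  exists (Num.bound (2 / (1 - la))); rewrite -ler_pdivrMr ?subr_gt0 //.
  by apply/ltW/archi_boundP; rewrite divr_ge0 // subr_ge0 ltW.
have q0 : (0 < q)%N by case: q hq => //; rewrite mul0r => h; exfalso; lra.
have q1 : 1 < q%:R :> R.
  have : q%:R * la >= 0 by rewrite mulr_ge0.
  by clear - hq la1; lra.
pose P := (3 * q.-1).+2.
pose M : R := 12 * q%:R * c * P%:R `^ alpha.
have M0 : 0 <= M by rewrite !mulr_ge0 ?powR_ge0.
(* From [m0] on, [M * m^alpha <= m], hence [12 * q * s <= m] for the separator size [s]. Below [m0]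
   the trivial bound [m^2] on the number of pairs suffices. *)
pose m0 : R := M `^ (1 - alpha)^-1.
have m00 : 0 <= m0 by apply: powR_ge0.
exists (1 + m0); first by rewrite lerDl.
set K := 1 + m0; have K1 : 1 <= K by rewrite lerDl.
have K0 : 0 <= K by apply: le_trans K1.
move=> G sep B; have [n] := ubnP #|B|; elim: n B => // n IH B /ltnSE Bn E w sub.
have [->|[e eE]] := set_0Vmem E; first by rewrite cards0 mulr_ge0 // powR_ge0.
have E0 : (0 < #|E|)%N by apply/card_gt0P; exists e.
have B0 : (0 < #|B|)%N.
  have [EB _ _ _] := sub; have := subsetP EB e eE; rewrite mem_setX => /andP[e1 _].
  by apply/card_gt0P; exists e.1.
set m := #|B| in Bn B0 *.
have y1 : 1 <= (m%:R : R) `^ eta := powR_nat_ge1 B0 (ltW eta0).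
rewrite powR_natS; last exact: ltW.
set y := _ `^ eta in y1 *.
have mR0 : 0 <= m%:R :> R by [].
have [small|big] := ltP (m%:R : R) m0.
  apply: (@le_trans _ _ (m%:R * m%:R)).
    rewrite -natrM ler_nat -cardsX; apply: subset_leq_card; by case: sub.
  rewrite [K * _]mulrC -mulrA; apply: ler_wpM2l => //.
  apply: (@le_trans _ _ (1 * K)); first by rewrite mul1r /K; lra.
  by apply: ler_wpM2r.
have [B1 [B2 [s [x [B1B B2B [split_E qx] [B12 sB1 sB2] hs]]]]] :=
  subdivided_split q0 c0 (ltW a0) sep sub E0.
rewrite -/m in B12 sB1 sB2 hs.
have s_small : (12 * q * s <= m)%N.
  rewrite -(ler_nat R) natrM natrM.
  apply: (@le_trans _ _ (M * m%:R `^ alpha)).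
    rewrite /M -[X in _ <= X]mulrA -[X in _ <= X]mulrA.
    apply: ler_wpM2l; first by rewrite mulr_ge0.
    by apply: (le_trans hs); rewrite mulnC natrM powRM.
  have mE : (m%:R : R) = m%:R `^ (1 - alpha) * m%:R `^ alpha.
    rewrite -powRD; first by rewrite subrK powRr1.
    by rewrite subrK pnatr_eq0 -lt0n B0 implybT.
  rewrite [leRHS]mE; apply: ler_wpM2r; first exact: powR_ge0.
  have -> : M = m0 `^ (1 - alpha).
    by rewrite -powRrM mulVf ?powRr1 // subr_eq0 gt_eqF.
  by apply: ge0_ler_powR; rewrite ?nnegrE // subr_ge0 ltW.
have qs_m : (12 * (q * s) <= m)%N by rewrite mulnA.
have s12 : (12 * s <= m)%N by apply: leq_trans qs_m; rewrite leq_mul2l leq_pmull.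
have half b : (3 * b <= 2 * m + 3 * s)%N -> (4 * b <= 3 * m)%N /\ (b < m)%N.
  by clear - s12 B0 => hb; split; lia.
have part b : (4 * b <= 3 * m)%N -> b%:R `^ (1 + eta) <= b%:R * (la * y).
  move=> hb; rewrite (powR_natS _ (ltW eta0)); apply: ler_wpM2l => //.
  have h34 : 0 <= 3 / 4 :> R by clear; lra.
  rewrite /la /y -(powRM _ h34 mR0).
  apply: ge0_ler_powR; [exact: ltW | by rewrite nnegrE | by rewrite nnegrE mulr_ge0 |].
  by move: hb; rewrite -(ler_nat R) !natrM; clear; lra.
have [h1 lt1] := half _ sB1; have [h2 lt2] := half _ sB2.
have e1 : #|E :&: setX B1 B1|%:R <= K * (#|B1|%:R * (la * y)).
  apply: le_trans (IH B1 (leq_trans lt1 Bn) _ w (subdividedI B1B sub)) _.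
  by apply: ler_wpM2l => //; apply: part.
have e2 : #|E :&: setX B2 B2|%:R <= K * (#|B2|%:R * (la * y)).
  apply: le_trans (IH B2 (leq_trans lt2 Bn) _ w (subdividedI B2B sub)) _.
  by apply: ler_wpM2l => //; apply: part.
have b12 : q%:R * (#|B1|%:R + #|B2|%:R) <= (q%:R + 1) * m%:R :> R.
  rewrite -natrD natr1 -!natrM ler_nat.
  apply: (@leq_trans (q * (m + s))); first by rewrite leq_mul2l B12 orbT.
  by clear - qs_m; rewrite mulnDr mulSn [(m + _)%N]addnC leq_add2l; lia.
have eR : #|E|%:R <= #|E :&: setX B1 B1|%:R + #|E :&: setX B2 B2|%:R + x%:R :> R.
  by rewrite -!natrD ler_nat.
have xR : q%:R * x%:R <= #|E|%:R :> R by rewrite -natrM ler_nat.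
have Ky0 : 0 <= K * (la * y) by rewrite !mulr_ge0 // powR_ge0.
have step : (q%:R - 1) * #|E|%:R <= K * (la * y) * ((q%:R + 1) * m%:R).
  apply: (@le_trans _ _ (K * (la * y) * (q%:R * (#|B1|%:R + #|B2|%:R)))); last exact: ler_wpM2l.
  have : q%:R * #|E|%:R <= q%:R * (K * (#|B1|%:R * (la * y)) + K * (#|B2|%:R * (la * y))) + #|E|%:R :> R.
    apply: (@le_trans _ _ (q%:R * (#|E :&: setX B1 B1|%:R + #|E :&: setX B2 B2|%:R + x%:R))); first exact: ler_wpM2l.
    rewrite mulrDr; apply: lerD => //; apply: ler_wpM2l => //; exact: lerD.
  by clear; move: (#|E|%:R) (q%:R) (#|B1|%:R) (#|B2|%:R) => u v b1 b2; rewrite mulrBl mul1r lerBlDr; move/le_trans; apply; rewrite le_eqVlt; apply/orP; left; apply/eqP; ring.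
have laq : la * (q%:R + 1) <= q%:R - 1 by clear - hq la1; lra.
rewrite -(ler_pM2l (x := q%:R - 1)) ?subr_gt0 //.
apply: (le_trans step).
have -> : K * (la * y) * ((q%:R + 1) * m%:R) = la * (q%:R + 1) * (K * (m%:R * y)) by ring.
by apply: ler_wpM2r => //; rewrite !mulr_ge0 // powR_ge0.
Qed.

End DensityBound.

(** * Elimination depth of torsos *)

(** A certificate that the graph [H] on [B] has treedepth at most [d]. Splitting is free, and the
    parts need not be connected. *)
Inductive elim (V : finType) (H : rel V) : nat -> {set V} -> Prop :=
  | Elim0 d : elim H d set0
  | ElimDel d (B : {set V}) a : elim H d (B :\ a) -> elim H d.+1 B
  | ElimSplit d (B1 B2 : {set V}) : (forall x y, x \in B1 -> y \in B2 -> ~~ H x y) ->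
      elim H d B1 -> elim H d B2 -> elim H d (B1 :|: B2).

Lemma elim_setD (V : finType) (H : rel V) d (B Z : {set V}) :
  elim H d (B :\: Z) -> elim H (#|Z| + d) B.
Proof.
have [n] := ubnP #|Z|; elim: n Z B => // n IH Z B /ltnSE Zn.
have [->|[z zZ]] := set_0Vmem Z; first by rewrite setD0 cards0.
rewrite (cardsD1 z) zZ /= -addnA => el; apply: (ElimDel (a := z)).
apply: IH; first by move: Zn; rewrite (cardsD1 z) zZ.
rewrite (_ : _ :\: _ = B :\: Z) //; apply/setP => x; rewrite !inE.
by have [->|] := eqVneq x z; rewrite ?zZ ?andbF.
Qed.

Definition torso (G : sgraph) (A : {set G}) : rel G :=
  fun u v => edge u v || [exists x, [&& x \notin A, edge x u & edge x v]].

Definition nbrs (G : sgraph) (A : {set G}) (x : G) : {set G} :=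
  [set u in A | edge x u].

Definition edges (G : sgraph) (A : {set G}) : {set G * G} :=
  [set e in setX A A | edge e.1 e.2].

Lemma subdivided_edges (G : sgraph) (A : {set G}) :
  subdivided A (edges A) (fun e => e.1).
Proof.
split.
- by apply/subsetP => e; rewrite inE => /andP[].
- by left.
- by move=> e; rewrite inE => /andP[].
- by move=> e e'; rewrite !inE => /andP[/andP[-> _] _].
Qed.

Lemma card_bigcup_le (I T : finType) (A : {set I}) (F : I -> {set T}) (q : nat) :
  (forall i, i \in A -> #|F i| <= q) -> #|\bigcup_(i in A) F i| <= q * #|A|.
Proof.
move=> Fq; rewrite mulnC -sum_nat_const.
elim/big_ind2: _ => [|X n Y p hX hY|i /Fq //]; first by rewrite cards0.
by apply: leq_trans (leq_add hX hY); apply: leq_card_setU.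
Qed.

(* In a minimal set of witnesses each has a pair of its own, so the witnesses
   subdivide the edges of a graph on [B]. *)
Lemma torso_witnesses (G : sgraph) (A B : {set G}) : B \subset A ->
  exists (X : {set G}) (E : {set G * G}) (w : G * G -> G),
    [/\ [disjoint X & A], subdivided B E w, #|E| = #|X|
      & forall u v, u \in B -> v \in B -> torso A u v ->
          edge u v \/ exists2 x, x \in X & edge x u && edge x v].
Proof.
move=> BA.
pose P (X : {set G}) := [disjoint X & A] && [forall u in B, forall v in B,
  [exists x, [&& x \notin A, edge x u & edge x v]] ==>
  [exists x in X, edge x u && edge x v]].
have PC : P (~: A).
  rewrite /P disjoint_sym -setI_eq0 setICr eqxx /=.
  apply/forall_inP => u uB; apply/forall_inP => v vB; apply/implyP.
  by case/existsP => x /andP[xA xuv]; apply/existsP; exists x; rewrite inE xA.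
case: (arg_minnP (P := P) (fun X : {set G} => #|X|) PC) => X /andP[XA /forall_inP cov] minX.
pose own x (e : G * G) := [&& e \in setX B B, edge x e.1, edge x e.2 &
  [forall x' in X, edge x' e.1 && edge x' e.2 ==> (x' == x)]].
have ownX x : x \in X -> exists e, own x e.
  move=> xX; apply/not_existsP => nown.
  have : P (X :\ x).
    rewrite /P (disjointWl _ XA) ?subsetDl //=.
    apply/forall_inP => u uB; apply/forall_inP => v vB; apply/implyP => ex.
    have /forall_inP/(_ v vB)/implyP/(_ ex)/existsP[y /andP[yX yuv]] := cov u uB.
    have [yx|yx] := eqVneq y x; last by apply/existsP; exists y; rewrite !inE yx yX.
    have [//|] := boolP [exists x0 in X :\ x, edge x0 u && edge x0 v].
    rewrite negb_exists => /forallP none; case: (nown (u, v)).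
    rewrite -yx /own mem_setX /= uB vB; case/andP: (yuv) => -> -> /=.
    apply/forall_inP => z zX; apply/implyP => zuv; rewrite yx.
    by have := none z; rewrite !inE zX zuv !andbT negbK.
  by move/minX; rewrite (cardsD1 x) xX ltnn.
pose pe x := odflt (x, x) [pick e | own x e].
have peP x : x \in X -> own x (pe x).
  by rewrite /pe; case: pickP => //= nown /ownX[e]; rewrite nown.
have pe_inj : {in X &, injective pe}.
  move=> x y xX yX pexy; have /and4P[_ e1 e2 _] := peP x xX.
  have /and4P[_ _ _ /forall_inP h] := peP y yX.
  by apply/eqP; apply: (implyP (h x xX)); rewrite -pexy e1.
pose w e := odflt e.1 [pick x in X | pe x == e].
have wP x : x \in X -> w (pe x) = x.
  move=> xX; rewrite /w; case: pickP => [y /andP[yX /eqP/pe_inj->//]|/(_ x)] /=.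
  by rewrite xX eqxx.
exists X, (pe @: X), w; split.
- exact: XA.
- split.
  + by apply/subsetP => e /imsetP[x xX ->]; case/and4P: (peP x xX).
  + move=> e /imsetP[x xX ->]; rewrite wP //; right.
    case/and4P: (peP x xX) => _ -> _ _; split=> //.
    by apply: contraL xX => /(subsetP BA) xA; rewrite (disjointFl XA).
  + by move=> e /imsetP[x xX ->]; rewrite wP //; case/and4P: (peP x xX).
  + by move=> e e' /imsetP[x xX ->] /imsetP[y yX ->] _; rewrite !wP // => ->.
- by rewrite card_in_imset.
- move=> u v uB vB /orP[|ex]; [by left|right].
  have /forall_inP/(_ v vB)/implyP/(_ ex)/existsP[x /andP[xX xuv]] := cov u uB.
  by exists x.
Qed.

Section TorsoElimination.
Local Open Scope ring_scope.
Variable R : realType.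

(** The process is replaced by a largest [A] among those of size at most [2 * #|S|] with
    [q * (#|A| - #|S|) <= #|edges A|]. A vertex with more than [q] neighbours in [A] would preserve
    the inequality, so [A] would already have size [2 * #|S|] and more edges than the density bound
    allows. *)
Lemma dense_closure (K eta : R) (G : sgraph) (S : {set G}) (q : nat) :
    (0 < #|S|)%N ->
    (forall A : {set G}, #|edges A|%:R <= K * #|A|%:R `^ (1 + eta)) ->
    K * (2 * #|S|)%:R `^ (1 + eta) < (q * #|S|)%:R ->
  exists A : {set G}, [/\ S \subset A, (#|A| <= 2 * #|S|)%N
    & forall x, x \notin A -> (#|nbrs A x| <= q)%N].
Proof.
move=> S0 dens hq.
pose P (A : {set G}) := [&& S \subset A, #|A| <= 2 * #|S|
  & q * (#|A| - #|S|) <= #|edges A|]%N.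
have PS : P S by rewrite /P subxx leq_pmull // subnn muln0.
case: (arg_maxnP (P := P) (fun A : {set G} => #|A|) PS) => A /and3P[SA A2 hA] maxA.
exists A; split=> // x xA; rewrite leqNgt; apply/negP => big.
have cA : #|x |: A| = #|A|.+1 by rewrite cardsU1 xA.
have eA : (q + #|edges A| <= #|edges (x |: A)|)%N.
  have dis : [disjoint [set (x, u) | u in nbrs A x] & edges A].
    rewrite -setI_eq0; apply/eqP/setP => e; rewrite !inE; apply/negP.
    by case/andP => /imsetP[u _ ->] /=; rewrite (negPf xA).
  apply: (@leq_trans #|[set (x, u) | u in nbrs A x] :|: edges A|).
    have /eqP -> : #|[set (x, u) | u in nbrs A x] :|: edges A| ==
        (#|[set (x, u) | u in nbrs A x]| + #|edges A|)%N.
      by rewrite (leq_card_setU _ _).2.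
    by rewrite leq_add2r card_imset ?(ltnW big) // => u v [].
  apply: subset_leq_card; apply/subsetP => e; rewrite in_setU => /orP[].
    by case/imsetP=> u; rewrite !inE => /andP[uA xu] ->; rewrite /= eqxx uA orbT.
  by rewrite !inE => /andP[/andP[-> ->] ->]; rewrite !orbT.
have SA' := subset_leq_card SA.
have : ~~ P (x |: A) by apply/negP => /maxA; rewrite /= cA; clear; lia.
rewrite /P (subset_trans SA (subsetUr _ _)) cA.
rewrite (subSn SA') mulnS (leq_trans _ eA) ?leq_add2l // andbT -ltnNge ltnS => A2'.
have cA2 : #|A| = (2 * #|S|)%N by apply/eqP; rewrite eqn_leq A2.
have := dens A; rewrite cA2 => /le_lt_trans/(_ hq).
by rewrite ltr_nat ltnNge (leq_trans _ hA) // cA2 mul2n -addnn addnK.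
Qed.

(** A witness in the separator is not in [A]; its at most [q] neighbours in [B] are removed in its
    place, whence the factor [q]. The exponent [(1 + eta) * alpha] arises because [B] and its
    witnesses number at most [(1 + K) * #|B|^(1 + eta)]. *)
Lemma torso_separator (c alpha eta K : R) (G : sgraph) (A B : {set G}) (q : nat) :
    0 <= c -> 0 < alpha -> 0 <= eta -> 0 <= K -> separable c alpha G ->
    (forall (B : {set G}) E w, subdivided B E w ->
       #|E|%:R <= K * #|B|%:R `^ (1 + eta)) ->
    (0 < q)%N -> (forall x, x \notin A -> (#|nbrs A x| <= q)%N) ->
    B \subset A -> (0 < #|B|)%N ->
  exists Z B1 B2 : {set G},
    [/\ B :\: Z = B1 :|: B2, B1 \subset B /\ B2 \subset B,
        forall x y, x \in B1 -> y \in B2 -> ~~ torso A x y,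
        (3 * #|B1| <= 2 * #|B|)%N /\ (3 * #|B2| <= 2 * #|B|)%N
      & #|Z|%:R <= q%:R * (c * (1 + K) `^ alpha * #|B|%:R `^ ((1 + eta) * alpha))].
Proof.
move=> c0 a0 e0 K0 sep dens q0 degA BA B0.
have [X [E [w [XA sub EX wit]]]] := torso_witnesses BA.
pose W := B :|: X.
have [Z [V1 [V2 [[d12 dZ nV] cov sz h1 h2]]]] := sep W B (subsetUl _ _).
pose Z' := (Z :&: B) :|: \bigcup_(x in Z :\: B) (nbrs A x :&: B).
have ZW : Z \subset W by rewrite -cov -setUA subsetUl.
have Z'Z : (#|Z'| <= q * #|Z|)%N.
  apply: (leq_trans (leq_card_setU _ _)).
  rewrite -(cardsID B Z) mulnDr; apply: leq_add; first by rewrite leq_pmull.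
  apply: card_bigcup_le => x; rewrite inE => /andP[xB /(subsetP ZW)].
  rewrite inE (negPf xB) /= => xX; apply: leq_trans (degA x _).
    by apply: subset_leq_card; apply: subsetIl.
  by apply: contraL xX => xA; rewrite (disjointFl XA).
exists Z', ((V1 :&: B) :\: Z'), ((V2 :&: B) :\: Z'); split.
- apply/setP => x; rewrite in_setU !in_setD !in_setI.
  have [xZ'|xZ'] := boolP (x \in Z') => //=.
  have [xB|_] := boolP (x \in B); rewrite ?andbF //= !andbT.
  have : x \in W by rewrite inE xB.
  rewrite -cov !inE; case: (boolP (x \in Z)) => //= xZ.
  by move: xZ'; rewrite inE inE xZ xB.
- by split; apply/subsetP => x; rewrite in_setD in_setI => /and3P[].
- move=> u v; rewrite !in_setD !in_setI => /and3P[uZ uV uB] /and3P[vZ vV vB].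
  apply/negP => /(wit u v uB vB) [|[x xX /andP[xu xv]]].
    by apply/negP; apply: nV.
  have xnB : x \notin B.
    by apply: contraL xX => /(subsetP BA) xA; rewrite (disjointFl XA).
  have : x \in Z :|: V1 :|: V2 by rewrite cov inE xX orbT.
  rewrite !inE => /orP[/orP[]|] xV.
  + case/negP: uZ; rewrite inE; apply/orP; right; apply/bigcupP; exists x.
      by rewrite inE xnB.
    by rewrite !inE xu uB andbT (subsetP BA).
  + by move: xv; apply/negP; apply: nV.
  + by move: xu; rewrite edge_sym; apply/negP; apply: nV.
- have cardD (V : {set G}) : (#|(V :&: B) :\: Z'| <= #|V :&: B|)%N by apply/subset_leq_card/subsetDl.
  split; [apply: leq_trans h1 | apply: leq_trans h2]; by rewrite leq_mul2l cardD.
- apply: (@le_trans _ _ (q * #|Z|)%:R); first by rewrite ler_nat.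
  rewrite natrM; apply: ler_wpM2l => //; apply: (le_trans sz).
  rewrite -mulrA; apply: ler_wpM2l => //.
  rewrite powRrM -powRM ?powR_ge0 ?addr_ge0 //.
  apply: ge0_ler_powR; rewrite ?nnegrE ?mulr_ge0 ?powR_ge0 ?addr_ge0 ?(ltW a0) //.
  apply: (@le_trans _ _ (#|B|%:R + #|X|%:R)).
    by rewrite -natrD ler_nat; apply: leq_card_setU.
  rewrite mulrDl mul1r; apply: lerD; last by rewrite -EX; apply: dens sub.
  rewrite powR_natS // -{1}[#|B|%:R]mulr1; apply: ler_wpM2l => //.
  exact: powR_nat_ge1.
Qed.

Lemma torso_elim (c alpha gamma : R) :
    0 <= c -> 0 < alpha < 1 -> alpha < gamma ->
  exists C : R, forall G : sgraph, separable c alpha G ->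
    forall S : {set G}, exists2 A : {set G}, S \subset A &
      forall h : nat, C * #|S|%:R `^ gamma <= h%:R -> elim (torso A) h A.
Proof.
move=> c0 a01 ag; have /andP[a0 a1] := a01.
(* The degree bound [q] contributes [k^eta] and the separators [k^((1 + eta) * alpha)]; as
   [alpha < 1], the exponents add up to at most [alpha + 2 * eta = gamma]. *)
pose eta := (gamma - alpha) / 2.
have e0 : 0 < eta by rewrite /eta; lra.
have [K K1 dens] := subdivided_density c0 a01 e0.
have K0 : 0 <= K by apply: le_trans K1.
pose g0 := (1 + eta) * alpha.
have g00 : 0 < g0 by rewrite mulr_gt0 // addr_gt0.
pose mu : R := (2 / 3) `^ g0.
have mu0 : 0 <= mu by apply: powR_ge0.
have mu1 : mu < 1.
  have := @gt0_ltr_powR R g0 g00 (2 / 3) 1; rewrite powR1; apply.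
  - by rewrite nnegrE; clear; lra.
  - by rewrite nnegrE ler01.
  - by clear; lra.
pose C4 := c * (1 + K) `^ alpha.
have C40 : 0 <= C4 by rewrite mulr_ge0 // powR_ge0.
(* The sum of the geometric series of separator sizes: each level shrinks [#|B|^g0] by the factor
   [mu], and [C4 + C5 * mu = C5]. *)
pose C5 := C4 / (1 - mu).
have C50 : 0 <= C5 by rewrite divr_ge0 // subr_ge0 ltW.
have C5E : C5 - C4 = C5 * mu.
  rewrite /C5; field; rewrite subr_eq0 gt_eqF //.
pose C2 := K * 2 `^ (1 + eta) + 1.
have C20 : 0 <= C2 by rewrite addr_ge0 // mulr_ge0 // powR_ge0.
exists (C5 * C2 * 2 `^ g0) => G sep S.
have [->|[s sS]] := set_0Vmem S; first by exists set0 => // h _; apply: Elim0.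
have S0 : (0 < #|S|)%N by apply/card_gt0P; exists s.
set k := #|S| in S0 *.
have kR0 : 0 <= k%:R :> R by [].
have ke := powR_nat_ge1 S0 (ltW e0).
pose x := K * 2 `^ (1 + eta) * k%:R `^ eta.
have x0 : 0 <= x by rewrite !mulr_ge0 ?powR_ge0 //.
pose q := (Num.truncn x).+1.
have /andP[qx xq] := truncn_itv x0.
have [|A [SA A2 degA]] := @dense_closure K eta G S q S0 (fun A => dens G sep A _ _ (subdivided_edges A)).
  rewrite -/k natrM powRM // natrM (powR_natS k (ltW e0)).
  have -> : K * (2 `^ (1 + eta) * (k%:R * k%:R `^ eta)) = x * k%:R by rewrite /x; ring.
  by rewrite ltr_pM2r // ltr0n.
exists A => // h hh.
have qC : q%:R <= C2 * k%:R `^ eta.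
  rewrite /q -natr1 /C2 mulrDl mul1r; exact: lerD.
suff main n (B : {set G}) : (#|B| <= n)%N -> B \subset A -> forall h : nat,
    C5 * q%:R * #|B|%:R `^ g0 <= h%:R -> elim (torso A) h B.
  apply: (main #|A|) => //; apply: le_trans hh.
  apply: (@le_trans _ _ (C5 * (C2 * k%:R `^ eta) * (2 `^ g0 * k%:R `^ g0))).
    apply: ler_pM; [by rewrite mulr_ge0 | exact: powR_ge0 | exact: ler_wpM2l |].
    by rewrite -powRM // -natrM; apply: powR_leN => //; apply: ltW.
  have -> : C5 * (C2 * k%:R `^ eta) * (2 `^ g0 * k%:R `^ g0) =
     C5 * C2 * 2 `^ g0 * (k%:R `^ eta * k%:R `^ g0) by ring.
  apply: ler_wpM2l; first by apply: mulr_ge0; [exact: mulr_ge0 | exact: powR_ge0].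
  rewrite -powRD; last by rewrite pnatr_eq0 -lt0n S0 implybT.
  apply: ler_powR; first by rewrite ler1n.
  have : eta * alpha <= eta by rewrite ler_piMr // ltW.
  rewrite /g0 /eta; clear; lra.
elim: n B {h hh} => [|n IH] B Bn BA h hB.
  by move: Bn; rewrite leqn0 cards_eq0 => /eqP->; apply: Elim0.
have [->|[b bB]] := set_0Vmem B; first exact: Elim0.
have B0 : (0 < #|B|)%N by apply/card_gt0P; exists b.
have [Z [B1 [B2 [BZ [B1B B2B] nt [s1 s2] sz]]]] :=
  torso_separator c0 a0 (ltW e0) K0 sep (dens G sep) (ltn0Sn _ : (0 < q)%N) degA BA B0.
rewrite -/C4 -/g0 in sz.
have hZ : (#|Z| <= h)%N.
  rewrite -(ler_nat R); apply: (le_trans sz); apply: le_trans hB.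
  rewrite mulrA [_ * C4]mulrC; apply: ler_wpM2r; first exact: powR_ge0.
  apply: ler_wpM2r => //; rewrite -subr_ge0 C5E; exact: mulr_ge0.
rewrite -(subnKC hZ); apply: elim_setD; rewrite BZ.
have sub (B' : {set G}) : (3 * #|B'| <= 2 * #|B|)%N -> B' \subset B -> elim (torso A) (h - #|Z|) B'.
  move=> B'3 B'B; apply: IH.
  - by clear - Bn B'3 B0; lia.
  - exact: subset_trans BA.
  - rewrite natrB //; apply: (@le_trans _ _ ((C5 - C4) * q%:R * #|B|%:R `^ g0)); last first.
      have -> : (C5 - C4) * q%:R * #|B|%:R `^ g0 =
        C5 * q%:R * #|B|%:R `^ g0 - q%:R * (C4 * #|B|%:R `^ g0) by ring.
      by rewrite lerD // lerN2.
    have -> : (C5 - C4) * q%:R * #|B|%:R `^ g0 = C5 * q%:R * (mu * #|B|%:R `^ g0).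
      by rewrite C5E; ring.
    apply: ler_wpM2l; first by rewrite mulr_ge0.
    have h23 : 0 <= 2 / 3 :> R by clear; lra.
    rewrite /mu -powRM //; apply: ge0_ler_powR.
    + exact: ltW.
    + by rewrite nnegrE.
    + by rewrite nnegrE mulr_ge0.
    + by move: B'3; rewrite -(ler_nat R) !natrM; clear; lra.
by apply: ElimSplit => //; apply: sub.
Qed.

End TorsoElimination.

(** * Branching over components *)

Lemma sum_card_disjoint (I T : finType) (P : pred I) (F : I -> {set T}) (U : {set T}) :
    (forall i, P i -> F i \subset U) ->
    (forall i j, P i -> P j -> forall x, x \in F i -> x \in F j -> i = j) ->
  \sum_(i | P i) #|F i| <= #|U|.
Proof.
move=> FU dis; under eq_bigr do rewrite -sum1_card.
rewrite (exchange_big_dep (mem U)) /=; last by move=> i x /FU/subsetP; apply.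
rewrite -sum1_card; apply: leq_sum => x _; rewrite sum1_card.
by apply/card_le1_eqP => i j /andP[Pi xi] /andP[Pj xj]; apply: (dis _ _ _ _ x).
Qed.

Section Solver.
Variables (m k B : nat) (tup : nat -> seq nat) (xv : nat -> nat).

(* An odd choice [c] puts the vertex [xv c] into the solution,
   an even one excludes it. *)
Definition live (p : seq nat) (T : nat) : bool :=
  ~~ has (fun c => odd c && (xv c \in tup T)) p.

Definition excluded (p : seq nat) (x : nat) : bool :=
  has (fun c => ~~ odd c && (xv c == x)) p.

Definition adjacent (p : seq nat) (T T' : nat) : bool :=
  [&& live p T, live p T' & has (fun x => (x \in tup T') && ~~ excluded p x) (tup T)].

Definition conn (p : seq nat) : rel 'I_m := connect (fun i j : 'I_m => adjacent p i j).

Definition rep (p : seq nat) (T : 'I_m) : bool :=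
  [forall T' : 'I_m, (T' < T) ==> ~~ conn p T' T].

(* The least value of [f] below [B], capped at [k.+1], as a sum of tests:
   the expressions evaluated by the program have no minimum. *)
Definition capmin (f : nat -> nat) : nat :=
  \sum_(v < k.+1) ~~ [exists ch : 'I_B, f ch <= v].

(** The value is 0 off representatives, so the inner sum counts every new component once. When no
    decisions are left, [k.+1] stands for infinity. *)
Fixpoint cost (d : nat) (p : seq nat) (T : 'I_m) : nat :=
  if live p T && rep p T then
    if d is d'.+1 then
      capmin (fun ch => odd ch + \sum_(T' : 'I_m | conn p T T') cost d' (ch :: p) T')
    else k.+1
  else 0.

Lemma capmin_le f ch : ch < B -> capmin f <= f ch.
Proof.
move=> chB; apply: (@leq_trans (\sum_(v < k.+1) (v < f ch))).
  apply: leq_sum => v _; case: (ltnP v (f ch)) => [|le]; first by case: (~~ _).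
  by rewrite (_ : [exists ch : 'I_B, f ch <= v]) //; apply/existsP; exists (Ordinal chB).
elim: (k.+1) => [|n IH]; first by rewrite big_ord0.
rewrite big_ord_recr /=; have [lt|] := ltnP n (f ch); last by rewrite addn0.
rewrite addn1; apply: leq_ltn_trans lt.
apply: leq_trans (_ : \sum_(i < n) 1 <= n); first by apply: leq_sum => i _; apply: leq_b1.
by rewrite sum1_card card_ord.
Qed.

(** Otherwise the tests for [v = 0, ..., capmin f] would all succeed, one more than their sum. *)
Lemma capmin_ex f : capmin f <= k -> exists2 ch, ch < B & f ch <= capmin f.
Proof.
move=> ck; have [/existsP[ch hch]|none] := boolP [exists ch : 'I_B, f ch <= capmin f].
  by exists ch.
suff : capmin f < capmin f by rewrite ltnn.
rewrite {2}/capmin (bigID (fun v : 'I_k.+1 => v <= capmin f)) /=.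
apply: leq_trans (leq_addr _ _).
have cardI : \sum_(v < k.+1 | v <= capmin f) 1 = (capmin f).+1.
  rewrite -(big_ord_widen k.+1 (fun=> 1) (n1 := (capmin f).+1)) ?ltnS //.
  by rewrite sum1_card card_ord.
rewrite -{1}cardI; apply: leq_sum => v vc; rewrite lt0b.
apply: contra none => /existsP[ch hch]; apply/existsP; exists ch.
exact: leq_trans vc.
Qed.

Lemma adjacent_sym p : symmetric (adjacent p).
Proof.
move=> T T'; rewrite /adjacent andbCA; congr [&& _, _ & _].
by apply/hasP/hasP => -[x xT /andP[xT' ox]]; exists x => //; rewrite xT.
Qed.

Lemma conn_sym p : symmetric (conn p).
Proof. by apply: sym_connect_sym => i j; apply: adjacent_sym. Qed.

Lemma conn_trans p : transitive (conn p).
Proof. exact: connect_trans. Qed.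

Lemma live_cons c p T : live (c :: p) T = ~~ (odd c && (xv c \in tup T)) && live p T.
Proof. by rewrite /live /= negb_or. Qed.

Lemma conn_cons c p T T' : conn (c :: p) T T' -> conn p T T'.
Proof.
apply: connect_sub => i j /and3P[li lj /hasP[x xi /andP[xj ox]]].
apply: connect1; move: li lj; rewrite !live_cons => /andP[_ li] /andP[_ lj].
apply/and3P; split=> //; apply/hasP; exists x => //; rewrite xj /=.
by move: ox; rewrite /excluded /= negb_or => /andP[].
Qed.

Lemma conn_live p (T T' : 'I_m) : conn p T T' -> live p T -> live p T'.
Proof.
case/connectP => q; elim: q T => [|j q IH] T /=; first by move=> _ ->.
by case/andP=> /and3P[_ lj _] /IH{}IH /IH /(_ lj).
Qed.

Lemma rep_ex p (T : 'I_m) : exists2 T0, rep p T0 & conn p T0 T.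
Proof.
have PT : conn p T T by apply: connect0.
case: (arg_minnP (P := fun T0 => conn p T0 T) (fun T0 : 'I_m => T0 : nat) PT) => T0 cT0 minT0.
exists T0 => //; apply/forall_inP => T' lt; apply/negP => cT'.
by have := minT0 T' (conn_trans cT' cT0); rewrite leqNgt lt.
Qed.

Lemma rep_uniq p T1 T2 : rep p T1 -> rep p T2 -> conn p T1 T2 -> T1 = T2.
Proof.
move=> /forall_inP r1 /forall_inP r2 c12; apply: val_inj => /=.
have [lt|gt|//] := ltngtP T1 T2; first by have := r2 _ lt; rewrite c12.
by have := r1 _ gt; rewrite conn_sym c12.
Qed.

(** Excluding a vertex only cuts components apart and never declares a clique hit. So the solutions
    of the new components, with the chosen vertex if there is one, hit the whole old component. This
    holds for every [d]. *)
Lemma cost_sound d p (T : 'I_m) : live p T -> rep p T -> cost d p T <= k ->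
  exists2 S : seq nat, size S <= cost d p T
    & forall T', conn p T T' -> has (mem S) (tup T').
Proof.
elim: d p T => [|d IH] p T lT rT /=; rewrite lT rT /=; first by rewrite ltnn.
move=> ck; have [ch _ hch] := capmin_ex ck.
have hS T' : exists S : seq nat, size S <= cost d (ch :: p) T' /\
    (conn p T T' -> live (ch :: p) T' -> rep (ch :: p) T' ->
     forall T'', conn (ch :: p) T' T'' -> has (mem S) (tup T'')).
  have [c'|nc] := boolP (conn p T T'); last by exists [::]; split.
  have [l'|nl] := boolP (live (ch :: p) T'); last by exists [::]; split=> // _ /negP[].
  have [r'|nr] := boolP (rep (ch :: p) T'); last by exists [::]; split=> // _ _ /negP[].
  have [|S sS hitS] := IH (ch :: p) T' l' r'; last by exists S.
  apply: leq_trans ck; apply: leq_trans hch; apply: leq_trans (leq_addl _ _).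
  by rewrite (bigD1 T') //= leq_addr.
have [S hS'] := fin_all_exists hS.
exists (nseq (odd ch) (xv ch) ++ flatten [seq S T' | T' <- enum (conn p T)]).
  apply: leq_trans hch; rewrite size_cat size_nseq leq_add2l size_flatten /shape -map_comp.
  rewrite sumnE big_map big_enum /=; apply: leq_sum => T' _; exact: (hS' T').1.
move=> T'' cT''; have lT'' := conn_live cT'' lT.
have [l''|] := boolP (live (ch :: p) T''); last first.
  rewrite live_cons lT'' andbT negbK => /andP[och xT]; apply/hasP; exists (xv ch) => //=.
  by rewrite mem_cat och mem_seq1 eqxx.
have [T0 r0 c0] := rep_ex (ch :: p) T''.
have cT0 : conn p T T0 by apply: conn_trans cT'' _; rewrite conn_sym; apply: conn_cons c0.
have l0 : live (ch :: p) T0 by rewrite conn_sym in c0; apply: conn_live l''.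
have /hasP[x xT /= xS] := (hS' T0).2 cT0 l0 r0 _ c0.
apply/hasP; exists x => //=; rewrite mem_cat; apply/orP; right.
apply/flattenP; exists (S T0) => //; apply: map_f.
by rewrite mem_enum.
Qed.

Variables (V : finType) (code : V -> nat) (Tset : 'I_m -> {set V}).
Variables (S A : {set V}) (H : rel V).
Hypotheses (code_inj : injective code)
  (tupE : forall (T : 'I_m) x, (x \in tup T) = [exists v in Tset T, code v == x])
  (xv_ex : forall T v (b : bool), v \in Tset T ->
     exists ch, [/\ ch < B, odd ch = b & xv ch = code v])
  (SA : S \subset A)
  (S_hits : forall T, exists2 v, v \in S & v \in Tset T)
  (H_in : forall T u v, u \in Tset T -> v \in Tset T -> u \in A -> v \in A ->
     u != v -> H u v)
  (H_out : forall T T' x u v, x \in Tset T -> x \in Tset T' -> x \notin A ->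
     u \in Tset T -> v \in Tset T' -> u \in A -> v \in A -> u != v -> H u v).

Definition consistent (p : seq nat) : Prop :=
  forall c, c \in p -> odd c = [exists v in S, code v == xv c].

Definition residue (p : seq nat) (T : 'I_m) : {set V} :=
  [set v in Tset T | ~~ excluded p (code v)].

Definition component (p : seq nat) (T : 'I_m) : {set V} :=
  \bigcup_(T' | conn p T T') residue p T'.

Lemma mem_tup (T : 'I_m) v : v \in Tset T -> code v \in tup T.
Proof. by move=> vT; rewrite tupE; apply/existsP; exists v; rewrite vT eqxx. Qed.

Lemma consistent_kept p v : consistent p -> v \in S -> ~~ excluded p (code v).
Proof.
move=> cp vS; apply/negP => /hasP[c cP /andP[oc /eqP xc]].
case/negP: oc; rewrite (cp c cP); apply/existsP; exists v.
by rewrite vS xc eqxx.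
Qed.

(** Decisions that agree with [S] never exclude a vertex of [S]. In particular every component keeps
    a vertex of [A], so it cannot outlast the elimination of [A]. *)
Lemma residue_hit p T : consistent p -> exists v, [/\ v \in S, v \in A & v \in residue p T].
Proof.
move=> cp; have [v vS vT] := S_hits T; exists v.
by rewrite vS (subsetP SA) // inE vT consistent_kept.
Qed.

Lemma residue_conn p (T T' : 'I_m) v : live p T -> live p T' ->
  v \in residue p T -> v \in residue p T' -> conn p T T'.
Proof.
move=> lT lT'; rewrite !inE => /andP[vT ov] /andP[vT' _].
apply: connect1; rewrite /adjacent lT lT' /=; apply/hasP; exists (code v).
  exact: mem_tup.
by rewrite mem_tup.
Qed.

(* Cliques sharing a vertex outside [A] have their vertices in [A] pairwise
   joined by [H], so no component reaches both sides of a split. *)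
Lemma component_side p (T : 'I_m) (B1 B2 : {set V}) : consistent p -> live p T ->
  (forall x y, x \in B1 -> y \in B2 -> ~~ H x y) ->
  A :&: component p T \subset B1 :|: B2 ->
  A :&: component p T \subset B1 \/ A :&: component p T \subset B2.
Proof.
move=> cp lT nH sub.
have inB T' v : conn p T T' -> v \in residue p T' -> v \in A -> v \notin B1 -> v \in B2.
  move=> cT' vT' vA v1; have : v \in B1 :|: B2.
    by apply: (subsetP sub); rewrite inE vA; apply/bigcupP; exists T'.
  by rewrite inE (negPf v1).
have resT T' v : v \in residue p T' -> v \in Tset T' by rewrite inE => /andP[].
have nH12 x y : x \in B1 -> y \in B2 -> y \notin B1 -> H x y -> False.
  by move=> x1 y2 _ xy; have := nH x y x1 y2; rewrite xy.
have neq x y : x \in B1 -> y \notin B1 -> x != y.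
  by move=> x1 y1; apply: contraNneq y1 => <-.
pose in1 T' := A :&: residue p T' \subset B1.
have step T1 T2 : conn p T T1 -> conn p T T2 -> adjacent p T1 T2 -> in1 T1 -> in1 T2.
  move=> c1 c2 /and3P[_ _ /hasP[z z1 /andP[z2 oz]]] i1.
  move: z1; rewrite tupE => /existsP[x /andP[x1 /eqP xz]].
  have x2 : x \in Tset T2.
    move: z2; rewrite -xz tupE => /existsP[x' /andP[x'2 /eqP/code_inj <-]] //.
  apply/subsetP => y; rewrite inE => /andP[yA y2]; have [//|y1] := boolP (y \in B1).
  have yB2 := inB _ _ c2 y2 yA y1; exfalso.
  have [u [_ uA uR]] := residue_hit T1 cp.
  have u1 : u \in B1 by apply: (subsetP i1); rewrite inE uA.
  have [xA|xA] := boolP (x \in A).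
    have x1' : x \in B1 by apply: (subsetP i1); rewrite !inE xA x1 xz.
    by apply: (nH12 x y) => //; apply: (H_in x2 (resT _ _ y2)) => //; apply: neq.
  by apply: (nH12 u y) => //; apply: (H_out x1 x2 xA (resT _ _ uR) (resT _ _ y2)) => //; apply: neq.
have all1 T1 T2 : conn p T T1 -> conn p T1 T2 -> in1 T1 -> in1 T2.
  move=> c1 /connectP[q]; elim: q T1 c1 => [|j q IH] T1 c1 /=; first by move=> _ ->.
  case/andP=> a1 qP E i1; have cj : conn p T j by apply: (conn_trans c1); apply: connect1.
  by apply: (IH j) => //; apply: (step T1).
have [in1T|nin1T] := boolP (in1 T).
  left; apply/subsetP => v; rewrite inE => /andP[vA /bigcupP[T' cT' vT']].
  have /subsetP := all1 T T' (connect0 _ _) cT' in1T; apply.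
  by rewrite inE vA.
right; apply/subsetP => v; rewrite inE => /andP[vA /bigcupP[T' cT' vT']].
have [v1|v1] := boolP (v \in B1); last exact: inB vT' vA v1.
have nin1T' : ~~ in1 T'.
  by apply: contra nin1T; apply: all1 => //; rewrite -/(conn p) conn_sym.
case/subsetPn: nin1T' => y; rewrite inE => /andP[yA yT'] y1; exfalso.
apply: (nH12 v y) => //; first exact: inB yT' yA y1.
by apply: (H_in (resT _ _ vT') (resT _ _ yT')) => //; apply: neq.
Qed.

Lemma component_cons c p T T' : conn p T T' -> component (c :: p) T' \subset component p T.
Proof.
move=> cT'; apply/bigcupsP => T'' cT''; apply: bigcup_max (conn_trans cT' (conn_cons cT'')) _.
apply/subsetP => v; rewrite !inE => /andP[->].
by rewrite /excluded /= negb_or => /andP[].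
Qed.

Lemma decided_gone c p (T : 'I_m) v : live (c :: p) T -> xv c = code v -> v \notin residue (c :: p) T.
Proof.
move=> lT xc; rewrite inE negb_and negbK /excluded /= xc eqxx andbT.
case: (boolP (odd c)) => oc /=; last by rewrite orbT.
rewrite live_cons oc xc /= in lT; case/andP: lT => + _.
by have [/mem_tup ->|] := boolP (v \in Tset T).
Qed.

(** Along the elimination, each vertex is decided as [S] decides it. The bound is additive since
    distinct representatives have disjoint components, and a split needs no decision since a
    component falls on one side. *)
Lemma cost_complete d X : elim H d X -> #|S| <= k ->
  forall d' p (T : 'I_m), d <= d' -> consistent p -> live p T ->
    A :&: component p T \subset X -> cost d' p T <= #|S :&: component p T|.
Proof.
move=> el _; elim: el => {d X}.
- move=> d d' p T _ cp lT sub; exfalso; have [v [_ vA vR]] := residue_hit T cp.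
  suff : v \in set0 by rewrite inE.
  apply: (subsetP sub); rewrite inE vA; apply/bigcupP; exists T => //; exact: connect0.
- move=> d X a _ IH d' p T; case: d' => // d'; rewrite ltnS => dd' cp lT sub.
  (* A vertex outside the component is skipped without spending a decision; this is why the
     statement allows any [d' >= d]. *)
  have [aC|aC] := boolP (a \in A :&: component p T); last first.
    apply: IH => //; first exact: leqW.
    apply/subsetP => v vC; rewrite !inE (subsetP sub) // andbT.
    by apply: contraNneq aC => <-.
  rewrite /= lT /=; case: (rep p T) => //.
  move: aC; rewrite inE => /andP[aA /bigcupP[Ta cTa aTa]].
  have aT : a \in Tset Ta by move: aTa; rewrite inE => /andP[].
  have [ch [chB och xch]] := xv_ex (a \in S) aT.
  apply: leq_trans (capmin_le _ chB) _.
  have cp' : consistent (ch :: p).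
    move=> c; rewrite inE => /orP[/eqP->|]; last exact: cp.
    rewrite och xch; apply/idP/existsP => [aS|[v /andP[vS /eqP/code_inj <-//]]].
    by exists a; rewrite aS eqxx.
  pose p' := ch :: p.
  have IH' T' : conn p T T' -> cost d' p' T' <=
      if live p' T' && rep p' T' then #|S :&: component p' T'| else 0.
    move=> cT'; case: (boolP (live p' T' && rep p' T')) => [/andP[lT' _]|nlr]; last first.
      by case: d' {dd'} => [|d'] /=; rewrite (negPf nlr).
    apply: IH => //; apply/subsetP => v; rewrite inE => /andP[vA vC].
    have vC0 := subsetP (component_cons ch cT') v vC.
    rewrite !inE; apply/andP; split; last by apply: (subsetP sub); rewrite inE vA.
    case/bigcupP: vC => T'' cT'' vT''; apply: contraTneq vT'' => ->.
    exact: decided_gone (conn_live cT'' lT') xch.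
  apply: (@leq_trans ((a \in S) + \sum_(T' | conn p T T' && (live p' T' && rep p' T')) #|S :&: component p' T'|)).
    by rewrite och leq_add2l big_mkcondr; apply: leq_sum => T' /IH'.
  have aC : a \in component p T by apply/bigcupP; exists Ta.
  have -> : #|S :&: component p T| = (a \in S) + #|(S :&: component p T) :\ a|.
    by rewrite (cardsD1 a) inE aC andbT.
  rewrite leq_add2l; apply: sum_card_disjoint => [T' /and3P[cT' lT' _]|T1 T2].
    apply/subsetP => v; rewrite !inE => /andP[-> vC].
    rewrite (subsetP (component_cons ch cT') v vC) !andbT.
    case/bigcupP: vC => T'' cT'' vT''; apply: contraTneq vT'' => ->.
    exact: decided_gone (conn_live cT'' lT') xch.
  case/and3P=> cT1 lT1 rT1 /and3P[cT2 lT2 rT2] v; rewrite !inE => /andP[_ v1] /andP[_ v2].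
  case/bigcupP: v1 => T1' c1 v1; case/bigcupP: v2 => T2' c2 v2.
  apply: (rep_uniq rT1 rT2); apply: (conn_trans c1).
  rewrite conn_sym; apply: (conn_trans c2); rewrite conn_sym.
  exact: residue_conn (conn_live c1 lT1) (conn_live c2 lT2) v1 v2.
- move=> d X1 X2 nH _ IH1 _ IH2 d' p T dd' cp lT sub.
  by have [h|h] := component_side cp lT nH sub; [apply: IH1|apply: IH2].
Qed.

End Solver.

Section Root.
Variables (m k B : nat) (tup : nat -> seq nat) (xv : nat -> nat).

Lemma root_sound h : \sum_(T < m) cost k B tup xv h [::] T <= k ->
  exists2 S : seq nat, size S <= k & forall T : 'I_m, has (mem S) (tup T).
Proof.
move=> sk.
have hS (T : 'I_m) : exists S : seq nat, size S <= cost k B tup xv h [::] T /\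
    (rep tup xv [::] T -> forall T', conn tup xv [::] T T' -> has (mem S) (tup T')).
  have [r|nr] := boolP (rep tup xv [::] T); last by exists [::]; split=> // /negP[].
  have [||S sS hitS] := @cost_sound m k B tup xv h [::] T _ r; [by []| |by exists S].
  by apply: leq_trans sk; rewrite (bigD1 T) //= leq_addr.
have [S hS'] := fin_all_exists hS.
exists (flatten [seq S T | T <- enum 'I_m]).
  apply: leq_trans sk; rewrite size_flatten /shape -map_comp.
  rewrite sumnE big_map big_enum /=; apply: leq_sum => T _; exact: (hS' T).1.
move=> T; have [T0 r0 c0] := rep_ex tup xv [::] T.
have /hasP[x xT /= xS] := (hS' T0).2 r0 _ c0.
apply/hasP; exists x => //=; apply/flattenP; exists (S T0) => //; apply: map_f.
by rewrite mem_enum.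
Qed.

Variables (V : finType) (code : V -> nat) (Tset : 'I_m -> {set V}).
Variables (S A : {set V}) (H : rel V).
Hypotheses (code_inj : injective code)
  (tupE : forall (T : 'I_m) x, (x \in tup T) = [exists v in Tset T, code v == x])
  (xv_ex : forall T v (b : bool), v \in Tset T ->
     exists ch, [/\ ch < B, odd ch = b & xv ch = code v])
  (SA : S \subset A)
  (S_hits : forall T, exists2 v, v \in S & v \in Tset T)
  (H_in : forall T u v, u \in Tset T -> v \in Tset T -> u \in A -> v \in A ->
     u != v -> H u v)
  (H_out : forall T T' x u v, x \in Tset T -> x \in Tset T' -> x \notin A ->
     u \in Tset T -> v \in Tset T' -> u \in A -> v \in A -> u != v -> H u v).

Lemma root_complete h : elim H h A -> #|S| <= k ->
  \sum_(T < m) cost k B tup xv h [::] T <= k.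
Proof.
move=> el Sk; apply: (leq_trans _ Sk).
have cp : consistent xv code S [::] by [].
apply: (@leq_trans (\sum_(T < m | rep tup xv [::] T) #|S :&: component tup xv code Tset [::] T|)).
  rewrite [X in _ <= X]big_mkcond; apply: leq_sum => T _.
  have [r|nr] := boolP (rep tup xv [::] T); last by case: (h) => [|h'] /=; rewrite (negPf nr).
  apply: (cost_complete code_inj tupE xv_ex SA S_hits H_in H_out el) => //.
  exact: subsetIl.
apply: sum_card_disjoint => [T _|T1 T2 r1 r2 v]; first exact: subsetIl.
rewrite !inE => /andP[_ /bigcupP[T1' c1 v1]] /andP[_ /bigcupP[T2' c2 v2]].
apply: (rep_uniq r1 r2); apply: (conn_trans c1).
rewrite conn_sym; apply: (conn_trans c2); rewrite conn_sym.
by apply: (residue_conn tupE _ _ v1 v2).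
Qed.

End Root.

(** * The kernel *)

(** Applied to the list of positions in a tuple, so that the subsets to be tested are known from [r]
    alone and can be unfolded into one expression. *)
Fixpoint sublists (s : seq nat) : seq (seq nat) :=
  if s is x :: s' then sublists s' ++ map (cons x) (sublists s') else [:: [::]].

Lemma mem_sublists (s mu : seq nat) : (mu \in sublists s) = subseq mu s.
Proof.
elim: s mu => [|x s IH] mu /=; first by rewrite inE; case: mu.
rewrite mem_cat IH; case: mu => [|y mu] /=; first by rewrite sub0seq.
have [->|yx] := eqVneq y x.
  rewrite (mem_map (f := cons x)) ?IH; last by move=> a b [].
  apply/orP/idP => [[|//]|]; last by right.
  exact: subseq_trans (subseq_cons _ _).
rewrite (_ : _ \in map _ _ = false) ?orbF //.
by apply/mapP => -[z _ [/eqP]]; rewrite (negPf yx).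
Qed.

Section Kernel.
Variables (N r k : nat) (tup : nat -> seq nat) (good kept : pred nat).
Hypotheses (tup_uniq : forall j, good j -> uniq (tup j))
  (tup_size : forall j, size (tup j) = r)
  (keptE : forall j, j < N -> kept j = good j &&
     all (fun mu => \sum_(j' < j) (kept j' && all (fun i => nth 0 (tup j) i \in tup j') mu)
                      < k.+1 ^ (r - size mu))
         (sublists (iota 0 r))).

Lemma kept_good j : j < N -> kept j -> good j.
Proof. by move=> /keptE -> /andP[]. Qed.

(** If a kept tuple contains [X], the positions of [X] in it form one of the tested [mu]; so the
    count was still below the bound when that tuple raised it by one. *)
Lemma kept_degree n (X : seq nat) : n <= N -> uniq X ->
  \sum_(j < n) (kept j && all [in tup j] X) <= k.+1 ^ (r - size X).
Proof.
move=> nN UX; elim: n nN => [|n IH] nN; first by rewrite big_ord0.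
rewrite big_ord_recr /=; have := IH (ltnW nN).
have [/andP[kn /allP Xn]|_] := boolP (kept n && _); last by rewrite addn0.
move=> _; rewrite addn1.
have gn := kept_good nN kn; move: kn; rewrite keptE // gn /= => /allP.
pose mu := [seq i <- iota 0 r | nth 0 (tup n) i \in X].
have mapmu : [seq nth 0 (tup n) i | i <- mu] = [seq x <- tup n | x \in X].
  by rewrite -[in RHS](mkseq_nth 0 (tup n)) /mkseq tup_size filter_map.
have Xmu : [seq x <- tup n | x \in X] =i X.
  by move=> x; rewrite mem_filter; have [/Xn|] := boolP (x \in X).
have szmu : size mu = size X.
  rewrite -(size_map (nth 0 (tup n))) mapmu; apply/eqP.
  by rewrite -(uniq_size_uniq UX) ?filter_uniq ?tup_uniq // => x; rewrite Xmu.
move/(_ mu); rewrite mem_sublists filter_subseq szmu => /(_ isT); apply: leq_ltn_trans.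
rewrite leq_eqVlt; apply/orP; left; apply/eqP; apply: eq_bigr => j _; congr (nat_of_bool (_ && _)).
rewrite -(all_map (nth 0 (tup n)) [in tup j]) mapmu; apply: eq_all_r.
by move=> x; rewrite Xmu.
Qed.

Lemma card_kept : \sum_(j < N) kept j <= k.+1 ^ r.
Proof.
have := @kept_degree N [::] (leqnn _) isT; rewrite subn0; apply: leq_trans.
by apply: leq_sum => j _; rewrite andbT.
Qed.

(** Let [X] be the subset for which a tuple was dropped, and suppose [S] misses [X]. Each kept tuple
    containing [X] is then hit by some [s] outside [X], and each [s] accounts for at most
    [k.+1 ^ (r - size X - 1)] of them. With at most [k] such [s] this falls short of
    [k.+1 ^ (r - size X)], so [S] hits [X] and thus the dropped tuple. *)
Lemma kept_hits (S : seq nat) : size S <= k ->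
    (forall j, j < N -> kept j -> has (mem S) (tup j)) ->
  forall j, j < N -> good j -> has (mem S) (tup j).
Proof.
move=> Sk hit j jN gj; have [|] := boolP (kept j); first exact: hit.
rewrite keptE // gj /= => /allPn[mu]; rewrite mem_sublists -leqNgt => sub.
pose X := [seq nth 0 (tup j) i | i <- mu].
have mu_r i : i \in mu -> i < r by move/(mem_subseq sub); rewrite mem_iota.
have Umu : uniq mu by apply: subseq_uniq sub (iota_uniq _ _).
have UX : uniq X.
  rewrite map_inj_in_uniq // => a b /mu_r ar /mu_r br /eqP.
  by rewrite nth_uniq ?tup_size ?tup_uniq // => /eqP.
have Xj : {subset X <= tup j}.
  by move=> x /mapP[i /mu_r ir ->]; rewrite mem_nth ?tup_size.
have szX : size X <= r.
  by rewrite -(tup_size j); apply: uniq_leq_size.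
have -> : \sum_(j' < j) (kept j' && all (fun i => nth 0 (tup j) i \in tup j') mu) =
    \sum_(j' < j) (kept j' && all [in tup j'] X).
  by apply: eq_bigr => j' _; rewrite all_map.
rewrite -(size_map (nth 0 (tup j)) mu) -/X => big.
have [/hasP[x xX xS]|nhit] := boolP (has (mem S) X).
  by apply/hasP; exists x => //; apply: Xj.
exfalso; have ltN (j' : 'I_j) : j' < N by apply: ltn_trans jN.
have cov (j' : 'I_j) : kept j' && all [in tup j'] X <=
    \sum_(s <- S) (kept j' && all [in tup j'] (s :: X)) * (s \notin X).
  have [/andP[kj aX]|//] := boolP (kept j' && _).
  have /hasP[s sj /= sS] := hit _ (ltN j') kj.
  rewrite (big_rem s) //= kj sj aX (_ : s \notin X) ?leq_addr //.
  by apply: contra nhit => sX; apply/hasP; exists s.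
have : k.+1 ^ (r - size X) <= \sum_(j' < j) \sum_(s <- S)
    (kept j' && all [in tup j'] (s :: X)) * (s \notin X).
  by apply: leq_trans big _; apply: leq_sum => j' _; apply: cov.
rewrite exchange_big /=.
(* For [size X = r] no exponent is left to lower; but then a tuple containing [X] has no further
   vertex, and the sum vanishes. *)
move: szX; rewrite leq_eqVlt => /orP[/eqP szX|szX].
  rewrite szX subnn expn0 big1 // => s _; rewrite big1 // => j' _.
  have [/and3P[kj sj /allP aX]|//] := boolP (_ && _).
  rewrite (_ : s \in X) //.
  have gj' := kept_good (ltN j') kj.
  have szj : size (tup j') <= size X by rewrite tup_size szX.
  by have [_ ->] := uniq_min_size UX aX szj.
move/leq_trans/(_ (_ : _ <= size S * k.+1 ^ (r - (size X).+1))) => h.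
have {h} : k.+1 ^ (r - size X) <= size S * k.+1 ^ (r - (size X).+1).
  apply: h; rewrite -sum1_size big_distrl /=; apply: leq_sum => s _; rewrite mul1n.
  rewrite -big_distrl /=; have [sX|sX] := boolP (s \in X); first by rewrite muln0.
  by rewrite muln1; apply: (@kept_degree j (s :: X)); rewrite ?(ltnW jN) //= sX.
rewrite -(subnSK szX) expnS leq_pmul2r ?expn_gt0 // => /leq_trans/(_ Sk).
by rewrite ltnn.
Qed.

End Kernel.

(** * A compiled expression language *)

Definition run (p : program) (s : state) (t : nat) (Q : state -> Prop) : Prop :=
  exists t' s', [/\ exec p s t' s', t' <= t & Q s'].

Lemma run_weaken p s t t' (Q Q' : state -> Prop) :
  run p s t Q -> t <= t' -> (forall s', Q s' -> Q' s') -> run p s t' Q'.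
Proof.
case=> u [s' [ex ut Qs']] tt' QQ'; exists u, s'; split=> //; last exact: QQ'.
exact: leq_trans tt'.
Qed.

Lemma run_seq p q s t1 t2 (Q : state -> Prop) :
  run p s t1 (fun s' => run q s' t2 Q) -> run (Seq p q) s (t1 + t2) Q.
Proof.
case=> u [s1 [ex1 ut [v [s2 [ex2 vt Qs2]]]]]; exists (u + v), s2; split=> //.
  exact: ExecSeq ex1 ex2.
exact: leq_add.
Qed.

Lemma run_const i c s (Q : state -> Prop) : Q (set_reg s i c) -> run (Const i c) s 1 Q.
Proof. by exists 1, (set_reg s i c); split=> //; constructor. Qed.

Lemma run_add i j l s (Q : state -> Prop) :
  Q (set_reg s i (reg s j + reg s l)) -> run (Add i j l) s 1 Q.
Proof. by eexists 1, _; split; first constructor. Qed.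

Lemma run_sub i j l s (Q : state -> Prop) :
  Q (set_reg s i (reg s j - reg s l)) -> run (Defs.Sub i j l) s 1 Q.
Proof. by eexists 1, _; split; first constructor. Qed.

Lemma run_read i j s (Q : state -> Prop) :
  Q (set_reg s i (Defs.mem s (reg s j))) -> run (Read i j) s 1 Q.
Proof. by eexists 1, _; split; first constructor. Qed.

Lemma run_write i j s (Q : state -> Prop) :
  Q (set_mem s (reg s i) (reg s j)) -> run (Write i j) s 1 Q.
Proof. by eexists 1, _; split; first constructor. Qed.

Lemma run_loop x p t (P : nat -> state -> Prop) n s :
    (forall j s', P j.+1 s' -> reg s' x <> 0) -> (forall s', P 0 s' -> reg s' x = 0) ->
    (forall j s', j < n -> P j.+1 s' -> run p s' t (P j)) -> P n s ->
  run (While x p) s (n * t.+1).+1 (P 0).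
Proof.
move=> pos zero; elim: n s => [|n IH] s body Ps.
  by exists 1, s; split=> //; constructor; apply: zero.
have [u [s1 [ex1 ut Ps1]]] := body n s (ltnSn n) Ps.
have [|v [s2 [ex2 vt Ps2]]] := IH s1 _ Ps1.
  by move=> j s' jn; apply: body; apply: ltnW.
exists (u + v).+1, s2; split=> //; first exact: ExecWhileTrue (pos _ _ Ps) ex1 ex2.
by rewrite ltnS mulSn; apply: leq_trans (leq_add ut vt) _; rewrite addnS addSn.
Qed.

(** Bounded sums are the only loops and there are no conditionals, so every expression terminates.
    Products and quotients are computed by repeated addition and subtraction, so their times are
    governed by values. *)
Inductive expr :=
  | ECst (c : nat)
  | EVar (i : nat)
  | EGet (e : expr)
  | EAdd (a b : expr)
  | ESub (a b : expr)
  | EMul (a b : expr)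
  | EDiv (a b : expr)
  | ELet (a b : expr)
  | ESum (a b : expr).

(* Variables are levels: a binder adds its variable at the end of [env]. *)
Fixpoint eval (e : expr) (env : seq nat) (M : nat -> nat) : nat :=
  match e with
  | ECst c => c
  | EVar i => nth 0 env i
  | EGet a => M (eval a env M)
  | EAdd a b => eval a env M + eval b env M
  | ESub a b => eval a env M - eval b env M
  | EMul a b => eval a env M * eval b env M
  | EDiv a b => eval a env M %/ eval b env M
  | ELet a b => eval b (rcons env (eval a env M)) M
  | ESum a b => \sum_(i < eval a env M) eval b (rcons env i) M
  end.

(* The value is left in register [t]; registers below [t] are preserved,
   and the variable of level [i] lives in register [nth 0 rho i]. *)
Fixpoint compile (rho : seq nat) (t : nat) (e : expr) : program :=
  match e with
  | ECst c => Const t c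
  | EVar i => if i < size rho then Seq (Const t.+1 0) (Add t (nth 0 rho i) t.+1) else Const t 0
  | EGet a => Seq (compile rho t a) (Read t t)
  | EAdd a b => Seq (compile rho t a) (Seq (compile rho t.+1 b) (Add t t t.+1))
  | ESub a b => Seq (compile rho t a) (Seq (compile rho t.+1 b) (Defs.Sub t t t.+1))
  | EMul a b => Seq (compile rho t a) (Seq (compile rho t.+1 b)
      (Seq (Const (t + 2) 0) (Seq (Const (t + 3) 1)
      (Seq (While t (Seq (Add (t + 2) (t + 2) t.+1) (Defs.Sub t t (t + 3))))
           (Add t t (t + 2))))))
  | EDiv a b => Seq (compile rho t a) (Seq (compile rho t.+1 b)
      (Seq (Const (t + 2) 0) (Seq (Const (t + 3) 1)
      (Seq (If t.+1 (Seq (Add t t (t + 3)) (Seq (Defs.Sub t t t.+1)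
              (While t (Seq (Add (t + 2) (t + 2) (t + 3)) (Defs.Sub t t t.+1)))))
              (Const t 0))
           (Add t t (t + 2))))))
  | ELet a b => Seq (compile rho t a) (Seq (compile (rcons rho t) t.+1 b)
      (Seq (Const t 0) (Add t t t.+1)))
  | ESum a b => Seq (compile rho t a)
      (Seq (Const t.+1 0) (Seq (Const (t + 2) 0)
      (Seq (While t (Seq (compile (rcons rho (t + 2)) (t + 3) b)
                    (Seq (Add t.+1 t.+1 (t + 3))
                    (Seq (Const (t + 3) 1)
                    (Seq (Add (t + 2) (t + 2) (t + 3)) (Defs.Sub t t (t + 3)))))))
           (Add t t t.+1))))
  end.

Definition keeps (t : nat) (s s' : state) (v : nat) : Prop :=
  [/\ forall x, x < t -> reg s' x = reg s x, Defs.mem s' = Defs.mem s & reg s' t = v].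

Lemma reg_set (s : state) i v j : reg (set_reg s i v) j = if j == i then v else reg s j.
Proof. by []. Qed.

Lemma reg_set_mem (s : state) a v j : reg (set_mem s a v) j = reg s j.
Proof. by []. Qed.

Ltac regs := rewrite ?(reg_set, reg_set_mem);
  repeat first [case: eqP => [?|_]; [exfalso; lia|] | case: eqP => [_|?]; [|exfalso; lia]].

Lemma run_mul t s :
  run (Seq (Const (t + 2) 0) (Seq (Const (t + 3) 1)
      (Seq (While t (Seq (Add (t + 2) (t + 2) t.+1) (Defs.Sub t t (t + 3))))
           (Add t t (t + 2))))) s (8 * (reg s t).+1)
    (fun s' => keeps t s s' (reg s t * reg s t.+1)).
Proof.
set x := reg s t; set y := reg s t.+1.
apply: (@run_weaken _ _ (1 + (1 + ((x * 3).+1 + 1)))); first last.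
- by move=> s'; apply.
- lia.
apply/run_seq/run_const/run_seq/run_const/run_seq.
pose P j s' := [/\ forall z, z < t -> reg s' z = reg s z, Defs.mem s' = Defs.mem s &
  [/\ reg s' t = j, reg s' t.+1 = y, reg s' (t + 3) = 1 & reg s' (t + 2) + j * y = x * y]].
apply: (@run_weaken _ _ (x * 3).+1 _ (P 0)) => //.
  apply: run_loop.
  - by move=> j s' [_ _ [-> _ _ _]].
  - by move=> s' [_ _ [-> _ _ _]].
  - move=> j s' _ [ag mm [rt ry r1 r2]].
    apply: (run_seq (t1 := 1) (t2 := 1)); apply/run_add/run_sub; split=> //.
      by move=> z zt; regs; apply: ag.
    by split; regs; rewrite ?rt ?ry ?r1 ?subn1 //; lia.
  - split=> //; first by move=> z zt; regs.
    by split; regs => //; rewrite add0n.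
move=> s' [ag mm [rt _ _ r2]]; apply: run_add; split=> //.
  by move=> z zt; regs; apply: ag.
by regs; rewrite rt add0n; lia.
Qed.

Lemma run_div t s :
  run (Seq (Const (t + 2) 0) (Seq (Const (t + 3) 1)
      (Seq (If t.+1 (Seq (Add t t (t + 3)) (Seq (Defs.Sub t t t.+1)
              (While t (Seq (Add (t + 2) (t + 2) (t + 3)) (Defs.Sub t t t.+1)))))
              (Const t 0))
           (Add t t (t + 2))))) s (8 * (reg s t).+1)
    (fun s' => keeps t s s' (reg s t %/ reg s t.+1)).
Proof.
set x := reg s t; set y := reg s t.+1.
apply: (@run_weaken _ _ (1 + (1 + ((1 + (1 + (x * 3).+1)).+1 + 1)))); first last.
- by move=> s'; apply.
- lia.
apply/run_seq/run_const/run_seq/run_const/run_seq.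
(* The dividend is raised by one so that, under truncated subtraction, the tested register is
   nonzero exactly when the next quotient [i], one more than the current, still has [i * y <= x]. *)
pose P j s' := [/\ forall z, z < t -> reg s' z = reg s z, Defs.mem s' = Defs.mem s &
  [/\ reg s' (t + 2) + j = x %/ y, reg s' t.+1 = y, reg s' (t + 3) = 1 &
      reg s' t = x.+1 - (reg s' (t + 2)).+1 * y]].
pose Q s' := [/\ forall z, z < t -> reg s' z = reg s z, Defs.mem s' = Defs.mem s,
  reg s' (t + 2) = x %/ y & reg s' t = 0].
suff : run (If t.+1 (Seq (Add t t (t + 3)) (Seq (Defs.Sub t t t.+1)
              (While t (Seq (Add (t + 2) (t + 2) (t + 3)) (Defs.Sub t t t.+1)))))
              (Const t 0)) (set_reg (set_reg s (t + 2) 0) (t + 3) 1)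
           (1 + (1 + (x * 3).+1)).+1 Q.
  move/run_weaken; apply=> // s' [ag mm r2 rt]; apply: run_add; split=> //.
    by move=> z zt; regs; apply: ag.
  by regs; rewrite rt r2.
(* The loop would not end for a zero divisor; the test in front of it returns 0, as [%/] does. *)
have [y0|y0] := posnP y.
  exists 2; eexists; split; [|by []|].
  - by apply: ExecIfFalse; [regs; rewrite -/y y0|constructor].
  - by split; first (by move=> z zt; regs); regs; rewrite ?y0.
have [u [s' [ex ut Qs']]] : run (Seq (Add t t (t + 3)) (Seq (Defs.Sub t t t.+1)
              (While t (Seq (Add (t + 2) (t + 2) (t + 3)) (Defs.Sub t t t.+1)))))
    (set_reg (set_reg s (t + 2) 0) (t + 3) 1) (1 + (1 + (x * 3).+1)) Q.
  apply/run_seq/run_add/run_seq/run_sub.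
  apply: (@run_weaken _ _ ((x %/ y) * 3).+1 _ (P 0)).
  - apply: run_loop.
    + move=> j s' [_ _ [rj _ _ ->]].
      have : (reg s' (t + 2)).+1 * y <= x.
        apply: leq_trans (leq_divM x y); rewrite leq_mul2r; apply/orP; right; lia.
      lia.
    + move=> s' [_ _ [rj _ _ ->]]; have := ltn_ceil x y0.
      move: rj; rewrite addn0 => ->; lia.
    + move=> j s' _ [ag mm [rj ry r1 rt]].
      apply: (run_seq (t1 := 1) (t2 := 1)); apply/run_add/run_sub; split=> //.
        by move=> z zt; regs; apply: ag.
      by split; regs; rewrite ?rt ?ry ?r1 //; lia.
    + split=> //; first by move=> z zt; regs.
      by split; regs => //; rewrite -/x -/y; lia.
  - by rewrite ltnS leq_mul2r leq_div.
  - move=> s' [ag mm [rj ry r1 rt]]; split=> //; first by move: rj; rewrite addn0.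
    by rewrite rt; have := ltn_ceil x y0; move: rj; rewrite addn0 => ->; lia.
exists u.+1, s'; split=> //.
by apply: ExecIfTrue ex; regs; rewrite -/y; lia.
Qed.

Lemma map_reg_agree (s s' : state) (rho : seq nat) (t : nat) :
  (forall x, x < t -> reg s' x = reg s x) -> all (fun x => x < t) rho ->
  map (reg s') rho = map (reg s) rho.
Proof. by move=> h /allP rt; apply/eq_in_map => x /rt /h. Qed.

(* With [L] bounding registers and memory, values and running times are
   bounded by a power of [L + 2] whose exponent depends on [e] only. *)
Definition compiles (e : expr) (D : nat) : Prop := forall rho t s L,
    all (fun x => x < t) rho ->
    (forall x, x \in rho -> reg s x <= L) -> (forall a, Defs.mem s a <= L) ->
  eval e (map (reg s) rho) (Defs.mem s) <= (L + 2) ^ D /\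
  run (compile rho t e) s ((L + 2) ^ D)
    (fun s' => keeps t s s' (eval e (map (reg s) rho) (Defs.mem s))).

(** With a base of at least 2, constant factors turn into summands of the exponent. *)
Lemma pow_prod x a b c : 2 ^ c * ((x + 2) ^ a * (x + 2) ^ b) <= (x + 2) ^ (a + b + c).
Proof.
rewrite mulnC !expnD leq_mul2l; apply/orP; right.
by case: c => // c; rewrite leq_exp2r // addn2.
Qed.

Lemma compiles_binary (f : nat -> nat -> nat) (tail : nat -> program) (a b e : expr) Da Db :
    (forall t s, run (tail t) s (8 * (reg s t).+1)
       (fun s' => keeps t s s' (f (reg s t) (reg s t.+1)))) ->
    (forall x y, f x y <= x.+1 * y.+1) ->
    (forall env M, eval e env M = f (eval a env M) (eval b env M)) ->
    (forall rho t, compile rho t e = Seq (compile rho t a) (Seq (compile rho t.+1 b) (tail t))) ->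
  compiles a Da -> compiles b Db -> compiles e (Da + Db + 5).
Proof.
move=> tailP fb evE coE IHa IHb rho t s L rt rL ML.
have [va ra] := IHa rho t s L rt rL ML; have [vb _] := IHb rho t s L rt rL ML.
have u0 : 0 < (L + 2) ^ Da by rewrite expn_gt0 addn2.
have v0 : 0 < (L + 2) ^ Db by rewrite expn_gt0 addn2.
have bnd := pow_prod L Da Db 5; rewrite evE coE; split.
  apply: leq_trans bnd; apply: leq_trans (fb _ _) _; nia.
apply: run_weaken (_ : _ <= _) _; last by move=> s'; apply.
  apply: run_seq; apply: run_weaken ra (leqnn _) _ => s1 [ag1 mm1 rt1].
  apply: (@run_seq _ _ _ ((L + 2) ^ Db) (8 * ((L + 2) ^ Da).+1)).
  have mE := map_reg_agree ag1 rt.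
  have [|x xr||_ rb] := IHb rho t.+1 s1 L.
  - by apply: sub_all rt => x; apply: ltnW.
  - by rewrite ag1 ?rL // (allP rt).
  - by rewrite mm1.
  apply: run_weaken rb (leqnn _) _ => s2 [ag2 mm2 rt2].
  rewrite mE mm1 in rt2.
  have rt2' : reg s2 t = eval a (map (reg s) rho) (Defs.mem s) by rewrite ag2.
  apply: run_weaken (tailP t s2) _ _; first by rewrite rt2' leq_mul2l ltnS va.
  move=> s3 [ag3 mm3 rt3]; split; last by rewrite rt3 rt2' rt2.
    by move=> x xt; rewrite ag3 // ag2 ?ag1 // ltnW.
  by rewrite mm3 mm2.
apply: leq_trans bnd; nia.
Qed.

Lemma compile_correct (e : expr) : exists D, compiles e D.
Proof.
elim: e => [c|i|a [Da IHa]|a [Da IHa] b [Db IHb]|a [Da IHa] b [Db IHb]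
  |a [Da IHa] b [Db IHb]|a [Da IHa] b [Db IHb]|a [Da IHa] b [Db IHb]|a [Da IHa] b [Db IHb]].
(* A constant enters the exponent. Constants of the graph class must therefore be variables, or the
   degree would depend on the class. *)
- exists c.+1 => rho t s L rt rL ML; split=> /=.
    apply: leq_trans (_ : 2 ^ c.+1 <= _); last by rewrite leq_exp2r // leq_addl.
    by apply/ltnW/(leq_trans (ltn_expl c (isT : 1 < 2))); rewrite leq_exp2l.
  apply: run_weaken (_ : 1 <= _) _; last by move=> s'; apply.
    by apply: run_const; split=> //; [move=> x xt; regs | regs].
  by rewrite expn_gt0 addn2.
- exists 1 => rho t s L rt rL ML; rewrite /= expn1; have [isz|isz] := ltnP i (size rho).
    rewrite (nth_map 0) //; have ri := mem_nth 0 isz; have /= ti := allP rt _ ri; split.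
      by apply: leq_trans (rL _ ri) (leq_addr _ _).
    apply: run_weaken (_ : 1 + 1 <= _) _; last by move=> s'; apply.
      by apply/run_seq/run_const/run_add; split=> //; [move=> x xt; regs | regs; rewrite addn0].
    by rewrite leq_addl.
  rewrite nth_default ?size_map //; split=> //.
  apply: run_weaken (_ : 1 <= _) _; last by move=> s'; apply.
    by apply: run_const; split=> //; [move=> x xt; regs | regs].
  by rewrite addn2.
- exists Da.+1 => rho t s L rt rL ML; have [va ra] := IHa rho t s L rt rL ML.
  have u0 : 0 < (L + 2) ^ Da by rewrite expn_gt0 addn2.
  rewrite /= expnS; split; first by apply: leq_trans (ML _) _; nia.
  apply: run_weaken (_ : (L + 2) ^ Da + 1 <= _) _; last by move=> s'; apply.
    apply: run_seq; apply: run_weaken ra (leqnn _) _ => s1 [ag1 mm1 rt1].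
    apply: run_read; split=> //; first by move=> x xt; regs; apply: ag1.
    by regs; rewrite mm1 rt1.
  nia.
- exists (Da + Db + 5).
  apply: (compiles_binary (f := addn) (tail := fun t => Add t t t.+1) _ _ _ _ IHa IHb) => //.
    move=> t s; apply: run_weaken (_ : 1 <= _) _; last by move=> s'; apply.
      by apply: run_add; split=> //; [move=> x xt; regs | regs].
    by rewrite muln_gt0.
  by move=> x y; nia.
- exists (Da + Db + 5).
  apply: (compiles_binary (f := subn) (tail := fun t => Defs.Sub t t t.+1) _ _ _ _ IHa IHb) => //.
    move=> t s; apply: run_weaken (_ : 1 <= _) _; last by move=> s'; apply.
      by apply: run_sub; split=> //; [move=> x xt; regs | regs].
    by rewrite muln_gt0.
  by move=> x y; nia.
- exists (Da + Db + 5).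
  apply: (compiles_binary (f := muln) _ _ _ _ IHa IHb) => //; first exact: run_mul.
  by move=> x y; nia.
- exists (Da + Db + 5).
  apply: (compiles_binary (f := divn) _ _ _ _ IHa IHb) => //; first exact: run_div.
  by move=> x y; apply: leq_trans (leq_div _ _) _; nia.
(* The body sees the new variable, so its bound is [(L + 2) ^ Da + L] instead of [L]; together with
   the 2 this is at most [(L + 2) ^ (Da + 3)], and the exponents multiply. *)
- exists (Da + (Da + 3) * Db + 3) => rho t s L rt rL ML.
  have [va ra] := IHa rho t s L rt rL ML.
  set x := eval a _ _ in va ra.
  have X0 : 0 < (L + 2) ^ Da by rewrite expn_gt0 addn2.
  have L'E : (L + 2) ^ Da + L + 2 <= (L + 2) ^ (Da + 3).
    by rewrite expnD; move: X0; move: (_ ^ Da) => u u0; rewrite !expnS expn0; nia.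
  have powL' : ((L + 2) ^ Da + L + 2) ^ Db <= (L + 2) ^ ((Da + 3) * Db).
    by rewrite expnM; case: (Db) => // n; rewrite leq_exp2r.
  have rt' : all (fun z => z < t.+1) (rcons rho t).
    by rewrite all_rcons ltnSn; apply: sub_all rt => z; apply: ltnW.
  have step s1 : keeps t s s1 x ->
    eval b (rcons (map (reg s) rho) x) (Defs.mem s) <= (L + 2) ^ ((Da + 3) * Db) /\
    run (compile (rcons rho t) t.+1 b) s1 ((L + 2) ^ ((Da + 3) * Db))
      (fun s' => keeps t.+1 s1 s' (eval b (rcons (map (reg s) rho) x) (Defs.mem s))).
    move=> [ag1 mm1 rt1].
    have [z|z|vb rb] := IHb (rcons rho t) t.+1 s1 ((L + 2) ^ Da + L) rt'.
    - rewrite mem_rcons inE => /orP[/eqP->|zr]; first by rewrite rt1; lia.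
      by rewrite ag1 ?(allP rt) //; apply: leq_trans (rL _ zr) (leq_addl _ _).
    - by rewrite mm1; apply: leq_trans (ML _) (leq_addl _ _).
    rewrite map_rcons (map_reg_agree ag1 rt) rt1 mm1 in vb rb.
    split; first exact: leq_trans vb powL'.
    exact: run_weaken rb powL' _.
  have v0 : 0 < (L + 2) ^ ((Da + 3) * Db) by rewrite expn_gt0 addn2.
  have bnd := pow_prod L Da ((Da + 3) * Db) 3.
  split.
    have [vb _] : eval b (rcons (map (reg s) rho) x) (Defs.mem s) <= (L + 2) ^ ((Da + 3) * Db) /\ True.
      split=> //; case: ra => _ [s1 [_ _ /step[]]]; exact.
    by rewrite /= -/x; apply: leq_trans vb _; apply: leq_trans bnd; nia.
  apply: run_weaken (_ : (L + 2) ^ Da + ((L + 2) ^ ((Da + 3) * Db) + (1 + 1)) <= _) _; last by move=> s'; apply.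
    apply: run_seq; apply: run_weaken ra (leqnn _) _ => s1 k1.
    apply: run_seq; have [_ rb] := step s1 k1.
    apply: run_weaken rb (leqnn _) _ => s2 [ag2 mm2 rt2]; case: k1 => ag1 mm1 rt1.
    apply/run_seq/run_const/run_add; split.
    + by move=> z zt; regs; rewrite ag2 ?ag1 // ltnW.
    + by rewrite /= mm2 mm1.
    + by regs; rewrite rt2.
  apply: leq_trans bnd; nia.
- exists (Da + (Da + 3) * Db + 5) => rho t s L rt rL ML.
  have [va ra] := IHa rho t s L rt rL ML.
  rewrite [eval _ _ _]/=.
  set n := eval a _ _ in va ra *.
  pose f i := eval b (rcons (map (reg s) rho) i) (Defs.mem s).
  have X0 : 0 < (L + 2) ^ Da by rewrite expn_gt0 addn2.
  have L'E : (L + 2) ^ Da + L + 2 <= (L + 2) ^ (Da + 3).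
    by rewrite expnD; move: X0; move: (_ ^ Da) => u u0; rewrite !expnS expn0; nia.
  have powL' : ((L + 2) ^ Da + L + 2) ^ Db <= (L + 2) ^ ((Da + 3) * Db).
    by rewrite expnM; case: (Db) => // p; rewrite leq_exp2r.
  have rt' : all (fun z => z < t + 3) (rcons rho (t + 2)).
    rewrite all_rcons; apply/andP; split; first by lia.
    by apply: sub_all rt => z; lia.
  set v := (L + 2) ^ ((Da + 3) * Db) in powL' *.
  have step s1 i : i < n -> (forall z, z < t -> reg s1 z = reg s z) -> Defs.mem s1 = Defs.mem s ->
    reg s1 (t + 2) = i ->
    f i <= v /\ run (compile (rcons rho (t + 2)) (t + 3) b) s1 v (fun s' => keeps (t + 3) s1 s' (f i)).
    move=> lt ag1 mm1 rt1.
    have [z|z|vb rb] := IHb (rcons rho (t + 2)) (t + 3) s1 ((L + 2) ^ Da + L) rt'.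
    - rewrite mem_rcons inE => /orP[/eqP->|zr]; first by rewrite rt1; lia.
      by rewrite ag1 ?(allP rt) //; apply: leq_trans (rL _ zr) (leq_addl _ _).
    - by rewrite mm1; apply: leq_trans (ML _) (leq_addl _ _).
    rewrite map_rcons (map_reg_agree ag1 rt) rt1 mm1 in vb rb.
    split; first exact: leq_trans vb powL'.
    exact: run_weaken rb powL' _.
  have v0 : 0 < v by rewrite expn_gt0 addn2.
  have bnd := pow_prod L Da ((Da + 3) * Db) 5; rewrite -/v in bnd.
  split.
    apply: (@leq_trans (n * v)); last by apply: leq_trans bnd; nia.
    rewrite -[n in n * v]card_ord -sum_nat_const; apply: leq_sum => i _.
    have [] // := step (set_reg s (t + 2) i) i (ltn_ord i); last by regs.
    by move=> z zt; regs.
  apply: run_weaken (_ : (L + 2) ^ Da + (1 + (1 + ((n * (v + (1 + (1 + (1 + 1)))).+1).+1 + 1))) <= _) _; last by move=> s'; apply.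
    apply: run_seq; apply: run_weaken ra (leqnn _) _ => s1 [ag1 mm1 rt1].
    apply/run_seq/run_const/run_seq/run_const/run_seq.
    pose P j s' := [/\ forall z, z < t -> reg s' z = reg s z, Defs.mem s' = Defs.mem s &
      [/\ reg s' t = j, reg s' (t + 2) + j = n & reg s' t.+1 = \sum_(i < n - j) f i]].
    apply: (@run_weaken _ _ (n * (v + (1 + (1 + (1 + 1)))).+1).+1 _ (P 0)) => //.
      apply: run_loop.
      + by move=> j s' [_ _ [-> _ _]].
      + by move=> s' [_ _ [-> _ _]].
      + move=> j s' jn [ag mm [rj ri rs]].
        have lt : reg s' (t + 2) < n by lia.
        have [_ rb] := step s' _ lt ag mm erefl.
        apply: run_seq; apply: run_weaken rb (leqnn _) _ => s2 [ag2 mm2 rt2].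
        apply/run_seq/run_add/run_seq/run_const/run_seq/run_add/run_sub; split.
        * by move=> z zt; regs; rewrite ag2 ?ag //; lia.
        * by rewrite /= mm2 mm.
        * split.
          - by regs; rewrite ag2; [rewrite rj subn1|lia].
          - by regs; rewrite ag2; lia.
          - regs; rewrite ag2; last by lia.
            rewrite rs rt2 (_ : n - j = (n - j.+1).+1); last by lia.
            by rewrite big_ord_recr /=; congr (_ + f _); lia.
      + split.
        * by move=> z zt; regs; apply: ag1.
        * by [].
        * by split; regs; rewrite ?rt1 ?add0n ?subnn ?big_ord0.
    move=> s' [ag mm [rj ri rs]]; apply: run_add; split=> //.
      by move=> z zt; regs; apply: ag.
    by regs; rewrite rj rs subn0.
  apply: leq_trans bnd; nia.
Qed.

(* [Fill base len e] fills the cells [base + i], [i < len], in increasing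
   order of [i]: the value of [e] at [i] may depend on the cells before. *)
Inductive command :=
  | Define (e : expr)
  | Fill (base len e : expr).

Fixpoint fill (base : nat) (e : expr) (env : seq nat) (n : nat) (M : nat -> nat) : nat -> nat :=
  if n is n'.+1 then
    let M' := fill base e env n' M in
    [eta M' with base + n' |-> eval e (rcons env n') M']
  else M.

Fixpoint denote (cs : seq command) (env : seq nat) (M : nat -> nat) : seq nat * (nat -> nat) :=
  match cs with
  | [::] => (env, M)
  | Define e :: cs' => denote cs' (rcons env (eval e env M)) M
  | Fill b l e :: cs' => denote cs' env (fill (eval b env M) e env (eval l env M) M)
  end.

(** A defined value is polynomial in what precedes it, and there are boundedly many. Table entries
    need the explicit bound: each may read the earlier ones, so polynomial growth could compound
    along the table. Partly filled tables count, as entries are evaluated in them. *)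
Fixpoint bounded (X : nat) (cs : seq command) (env : seq nat) (M : nat -> nat) : Prop :=
  match cs with
  | [::] => True
  | Define e :: cs' => bounded X cs' (rcons env (eval e env M)) M
  | Fill b l e :: cs' =>
      (forall n a, n <= eval l env M -> fill (eval b env M) e env n M a <= X) /\
      bounded X cs' env (fill (eval b env M) e env (eval l env M) M)
  end.

Definition compile_fill (t : nat) (base len e : expr) : program :=
  Seq (compile (iota 0 t) t len) (Seq (compile (iota 0 t) t.+1 base) (Seq (Const (t + 2) 0)
    (While t (Seq (compile (rcons (iota 0 t) (t + 2)) (t + 3) e)
             (Seq (Write t.+1 (t + 3)) (Seq (Const (t + 3) 1)
             (Seq (Add t.+1 t.+1 (t + 3)) (Seq (Add (t + 2) (t + 2) (t + 3))
                  (Defs.Sub t t (t + 3)))))))))).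

Fixpoint compile_all (t : nat) (cs : seq command) : program :=
  match cs with
  | [::] => Skip
  | Define e :: cs' => Seq (compile (iota 0 t) t e) (compile_all t.+1 cs')
  | Fill b l e :: cs' => Seq (compile_fill t b l e) (compile_all t cs')
  end.

Definition represents (s : state) (env : seq nat) (M : nat -> nat) : Prop :=
  map (reg s) (iota 0 (size env)) = env /\ Defs.mem s = M.

Lemma bounded_mono X Y cs env M : X <= Y -> bounded X cs env M -> bounded Y cs env M.
Proof.
move=> XY; elim: cs env M => [//|[e|b l e] cs IH] env M /=; first exact: IH.
by case=> h /IH; split=> // n a /h/leq_trans; apply.
Qed.

Lemma iota_lt t : all (fun x => x < t) (iota 0 t).
Proof. by apply/allP => x; rewrite mem_iota. Qed.

Lemma compile_fill_correct base len e : exists D, forall s env M X,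
    represents s env M -> (forall x, x \in env -> x <= X) -> (forall a, M a <= X) ->
    (forall n a, n <= eval len env M -> fill (eval base env M) e env n M a <= X) ->
  run (compile_fill (size env) base len e) s ((X + 2) ^ D)
    (fun s' => represents s' env (fill (eval base env M) e env (eval len env M) M)).
Proof.
have [Db cb] := compile_correct base; have [Dl cl] := compile_correct len.
have [De ce] := compile_correct e.
exists (Db + (Dl + (Dl + 3) * De + 5)) => s env M X [envE ME] envX MX bnd.
set t := size env in envE *.
have regX x : x < t -> reg s x <= X.
  by move=> xt; apply: envX; rewrite -envE; apply: map_f; rewrite mem_iota.
have regX' x : x \in iota 0 t -> reg s x <= X by rewrite mem_iota => /regX.
have MsX a : Defs.mem s a <= X by rewrite ME.
have [vl rl] := cl _ t s X (iota_lt t) regX' MsX.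
rewrite envE ME in vl rl; set n := eval len env M in vl rl bnd *.
set b := eval base env M in bnd *.
have X0 : 0 < (X + 2) ^ Dl by rewrite expn_gt0 addn2.
have X1 : 0 < (X + 2) ^ Db by rewrite expn_gt0 addn2.
have L'E : (X + 2) ^ Dl + X + 2 <= (X + 2) ^ (Dl + 3).
  by rewrite expnD; move: X0; move: (_ ^ Dl) => u u0; rewrite !expnS expn0; nia.
have powL' : ((X + 2) ^ Dl + X + 2) ^ De <= (X + 2) ^ ((Dl + 3) * De).
  by rewrite expnM; case: (De) => // p; rewrite leq_exp2r.
set v := (X + 2) ^ ((Dl + 3) * De) in powL' *.
have v0 : 0 < v by rewrite expn_gt0 addn2.
have bnd1 := pow_prod X Dl ((Dl + 3) * De) 5; rewrite -/v in bnd1.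
rewrite expnD; apply: (@run_weaken _ _ ((X + 2) ^ Dl + ((X + 2) ^ Db + (1 +
   (n * (v + (1 + (1 + (1 + (1 + 1))))).+1).+1)))); first last.
- by move=> s'; apply.
- apply: leq_trans (_ : (X + 2) ^ Db * (2 ^ 5 * ((X + 2) ^ Dl * v)) <= _); last by rewrite leq_mul2l bnd1 orbT.
  move: X1 X0 v0 vl; rewrite -/v; move: (_ ^ Db) (_ ^ Dl) => y u y0 u0 v0 nu.
  have uv1 : 0 < u * v by rewrite muln_gt0 u0.
  have nv : n * (v + (1 + (1 + (1 + (1 + 1))))).+1 <= 7 * (u * v) by nia.
  apply: (@leq_trans (u + (y + (1 + (7 * (u * v)).+1)))); first by rewrite !leq_add2l ltnS.
  have h1 : u <= u * v by rewrite leq_pmulr.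
  have h2 : y <= y * (u * v) by rewrite leq_pmulr.
  have h3 : u * v <= y * (u * v) by rewrite leq_pmull.
  rewrite [leqRHS]mulnCA; move: (y * (u * v)) h2 h3 => w h2 h3; lia.
apply: run_seq; apply: run_weaken rl (leqnn _) _ => s1 [ag1 mm1 rt1].
have mapE1 := map_reg_agree ag1 (iota_lt t).
apply: run_seq; have [|x xt||_ rb] := cb (iota 0 t) t.+1 s1 X.
- by apply: sub_all (iota_lt t) => x; apply: ltnW.
- by rewrite ag1 ?regX' //; move: xt; rewrite mem_iota.
- by rewrite mm1.
rewrite mapE1 envE mm1 ME -/b in rb.
apply: run_weaken rb (leqnn _) _ => s2 [ag2 mm2 rt2].
apply/run_seq/run_const.
have ag2t x : x < t -> reg s2 x = reg s x by move=> xt; rewrite ag2 ?ag1 // ltnW.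
pose P j s' := [/\ forall z, z < t -> reg s' z = reg s z, Defs.mem s' = fill b e env (n - j) M &
   [/\ reg s' t = j, reg s' (t + 2) + j = n & reg s' t.+1 = b + (n - j)]].
apply: (@run_weaken _ _ (n * (v + (1 + (1 + (1 + (1 + 1))))).+1).+1 _ (P 0)) => //.
  apply: run_loop.
  - by move=> j s' [_ _ [-> _ _]].
  - by move=> s' [_ _ [-> _ _]].
  - move=> j s' jn [ag mm [rj ri ra]].
    have lt : reg s' (t + 2) < n by lia.
    have mapE := map_reg_agree ag (iota_lt t).
    have [|z|z|ve re] := ce (rcons (iota 0 t) (t + 2)) (t + 3) s' ((X + 2) ^ Dl + X).
    + rewrite all_rcons; apply/andP; split; first by lia.
      by apply: sub_all (iota_lt t) => z; lia.
    + rewrite mem_rcons inE => /orP[/eqP->|]; first by lia.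
      rewrite mem_iota => /andP[_ zt]; rewrite ag //.
      by apply: leq_trans (regX _ zt) (leq_addl _ _).
    + rewrite mm; apply: leq_trans (bnd _ _ _) (leq_addl _ _); exact: leq_subr.
    rewrite map_rcons mapE envE mm in re.
    apply: run_seq; apply: run_weaken re powL' _ => s3 [ag3 mm3 rt3].
    apply/run_seq/run_write/run_seq/run_const/run_seq/run_add/run_seq/run_add/run_sub.
    split.
    + by move=> z zt; regs; rewrite ag3 ?ag //; lia.
    + rewrite /= ag3; last by lia.
      rewrite (_ : n - j = (n - j.+1).+1); last by lia.
      rewrite /= mm3 mm rt3 ra.
      by rewrite (_ : reg s' (t + 2) = n - j.+1) //; lia.
    + by split; regs; rewrite ag3 ?rj ?ra; lia.
  - split.
    + by move=> z zt; regs; rewrite ag2t.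
    + by rewrite /= mm2 mm1 ME subnn.
    + split; regs; first by rewrite ag2 ?rt1.
        by rewrite add0n.
      by rewrite rt2 subnn addn0.
move=> s' [ag mm [rj ri _]]; split; last by rewrite mm subn0.
by rewrite (map_reg_agree ag (iota_lt t)).
Qed.

Lemma compile_all_correct cs : exists D, forall s env M X,
    represents s env M -> (forall x, x \in env -> x <= X) -> (forall a, M a <= X) ->
    bounded X cs env M ->
  run (compile_all (size env) cs) s ((X + 2) ^ D)
    (fun s' => represents s' (denote cs env M).1 (denote cs env M).2).
Proof.
elim: cs => [|[e|b l e] cs [D IH]].
- exists 1 => s env M X rep _ _ _; exists 1, s; split; [constructor | by rewrite expn1 addn2 | by []].
- have [De ce] := compile_correct e.
  exists (De + (De + 3) * D + 2) => s env M X [envE ME] envX MX /= bnd.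
  set t := size env in envE *.
  have regX' x : x \in iota 0 t -> reg s x <= X.
    by move=> xt; apply: envX; rewrite -envE; apply: map_f.
  have MsX a : Defs.mem s a <= X by rewrite ME.
  have [ve re] := ce _ t s X (iota_lt t) regX' MsX; rewrite envE ME in ve re.
  have X0 : 0 < (X + 2) ^ De by rewrite expn_gt0 addn2.
  have L'E : (X + 2) ^ De + X + 2 <= (X + 2) ^ (De + 3).
    by rewrite expnD; move: X0; move: (_ ^ De) => u u0; rewrite !expnS expn0; nia.
  have powL' : ((X + 2) ^ De + X + 2) ^ D <= (X + 2) ^ ((De + 3) * D).
    by rewrite expnM; case: (D) => // p; rewrite leq_exp2r.
  apply: run_weaken (_ : (X + 2) ^ De + (X + 2) ^ ((De + 3) * D) <= _) _; last by move=> s'; apply.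
    apply: run_seq; apply: run_weaken re (leqnn _) _ => s1 [ag1 mm1 rt1].
    have := IH s1 (rcons env (eval e env M)) M ((X + 2) ^ De + X); rewrite size_rcons -/t.
    move/(_ _ _ _ _)/run_weaken; apply => //.
    + split; last by rewrite mm1.
      rewrite size_rcons -/t -[t.+1]addn1 iotaD map_cat /= add0n rt1 cats1.
      by rewrite (map_reg_agree ag1 (iota_lt t)) envE.
    + move=> x; rewrite mem_rcons inE => /orP[/eqP->|/envX xX].
        exact: leq_trans ve (leq_addr _ _).
      exact: leq_trans xX (leq_addl _ _).
    + by move=> a; apply: leq_trans (MX a) (leq_addl _ _).
    + exact: bounded_mono (leq_addl _ _) bnd.
  apply: leq_trans (pow_prod X De ((De + 3) * D) 2).
  have : 0 < (X + 2) ^ ((De + 3) * D) by rewrite expn_gt0 addn2.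
  by nia.
- have [Df cf] := compile_fill_correct b l e.
  exists (Df + D + 2) => s env M X rep envX MX /= [bnd1 bnd2].
  apply: run_weaken (_ : (X + 2) ^ Df + (X + 2) ^ D <= _) _; last by move=> s'; apply.
    apply: run_seq; apply: run_weaken (cf s env M X rep envX MX bnd1) (leqnn _) _ => s1 rep1.
    by apply: IH => // a; apply: bnd1.
  apply: leq_trans (pow_prod X Df D 2).
  have : 0 < (X + 2) ^ Df by rewrite expn_gt0 addn2.
  have : 0 < (X + 2) ^ D by rewrite expn_gt0 addn2.
  by nia.
Qed.

Definition table (base len : nat) (f : nat -> nat) (M : nat -> nat) (a : nat) : nat :=
  if base <= a < base + len then f (a - base) else M a.

(** Turns a run of updates into a recurrence: the entry [f i] is the expression evaluated where only
    the entries below [i] are present. *)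
Lemma fill_table base e env len M : exists2 f : nat -> nat,
    forall n, n <= len -> fill base e env n M = table base n f M
  & forall i, i < len -> f i = eval e (rcons env i) (table base i f M).
Proof.
pose f i := eval e (rcons env i) (fill base e env i M).
have fillE n : fill base e env n M = table base n f M.
  elim: n => [|n IH]; apply/funext => a; rewrite /table.
    by rewrite addn0; case: ltnP; rewrite ?andbF // => /ltnW; rewrite leqNgt; case: ltnP.
  rewrite /=; have [->|ne] := eqVneq a (base + n).
    by rewrite leq_addr addnS ltnSn addKn.
  rewrite IH /table.
  by rewrite addnS ltnS [a <= _]leq_eqVlt (negPf ne).
exists f => [n _|i _]; first exact: fillE.
by rewrite -fillE.
Qed.

(** * Tests, powers and tuples as arithmetic expressions *)

Definition ENot (e : expr) : expr := ESub (ECst 1) e.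
Definition ENz (e : expr) : expr := ENot (ENot e).
Definition ELe (a b : expr) : expr := ENot (ESub a b).
Definition ELt (a b : expr) : expr := ELe (EAdd a (ECst 1)) b.
Definition EEq (a b : expr) : expr := ENot (EAdd (ESub a b) (ESub b a)).
Definition EMod (a b : expr) : expr := ESub a (EMul (EDiv a b) b).
Definition EPow (a : expr) (i : nat) : expr := iter i (EMul a) (ECst 1).
Definition EAll (es : seq expr) : expr := foldr EMul (ECst 1) es.
Definition EHas (es : seq expr) : expr := ENz (foldr EAdd (ECst 0) es).
Definition EAt (base i : expr) : expr := EGet (EAdd base i).

Section EvalMacros.
Variables (env : seq nat) (M : nat -> nat).
Notation ev e := (eval e env M).

Lemma eval_not e : ev (ENot e) = (ev e == 0) :> nat.
Proof. by rewrite /=; case: (ev e). Qed.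

Lemma eval_nz e : ev (ENz e) = (ev e != 0) :> nat.
Proof. by rewrite /ENz eval_not eval_not; case: (ev e). Qed.

Lemma eval_le a b : ev (ELe a b) = (ev a <= ev b) :> nat.
Proof. by rewrite /ELe eval_not. Qed.

Lemma eval_lt a b : ev (ELt a b) = (ev a < ev b) :> nat.
Proof. by rewrite /ELt eval_le /= addn1. Qed.

Lemma eval_eq a b : ev (EEq a b) = (ev a == ev b) :> nat.
Proof. by rewrite /EEq eval_not /= addn_eq0 !subn_eq0 -eqn_leq. Qed.

Lemma eval_mod a b : ev (EMod a b) = ev a %% ev b.
Proof. by rewrite /= {1}(divn_eq (ev a) (ev b)) addKn. Qed.

Lemma eval_pow a i : ev (EPow a i) = ev a ^ i.
Proof. by elim: i => //= i IH; rewrite expnS -IH. Qed.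

Lemma eval_all (T : eqType) (s : seq T) (g : T -> expr) (b : pred T) :
  (forall x, x \in s -> ev (g x) = b x) -> ev (EAll (map g s)) = all b s.
Proof.
elim: s => //= x s IH h; rewrite h ?mem_head // -/(EAll _) IH => [|y ys].
  by rewrite mulnb.
by apply: h; rewrite inE ys orbT.
Qed.

Lemma eval_sum_has (T : eqType) (s : seq T) (g : T -> expr) (b : pred T) :
  (forall x, x \in s -> ev (g x) = b x) ->
  (ev (foldr EAdd (ECst 0) (map g s)) == 0) = ~~ has b s.
Proof.
elim: s => //= x s IH h; rewrite h ?mem_head // addn_eq0 negb_or IH => [|y ys].
  by case: (b x).
by apply: h; rewrite inE ys orbT.
Qed.

Lemma eval_has (T : eqType) (s : seq T) (g : T -> expr) (b : pred T) :
  (forall x, x \in s -> ev (g x) = b x) -> ev (EHas (map g s)) = has b s.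
Proof. by move=> h; rewrite /EHas eval_nz (eval_sum_has h) negbK. Qed.

Lemma eval_at a i : ev (EAt a i) = M (ev a + ev i).
Proof. by []. Qed.

End EvalMacros.

Definition digit (n i j : nat) : nat := (j %/ n ^ i) %% n.
Definition digits (n r j : nat) : seq nat := [seq digit n i j | i <- iota 0 r].

(* Variable 0 is the number of vertices. *)
Definition EDigit (i : nat) (e : expr) : expr := EMod (EDiv e (EPow (EVar 0) i)) (EVar 0).
Definition EIn (r : nat) (x e : expr) : expr := EHas [seq EEq (EDigit i e) x | i <- iota 0 r].

Lemma eval_digit env M i e : eval (EDigit i e) env M = digit (nth 0 env 0) i (eval e env M).
Proof. by rewrite /EDigit eval_mod [eval (EDiv _ _) _ _]/= eval_pow. Qed.

Lemma eval_in env M r x e :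
  eval (EIn r x e) env M = (eval x env M \in digits (nth 0 env 0) r (eval e env M)) :> nat.
Proof.
rewrite /EIn (eval_has (b := fun i => digit (nth 0 env 0) i (eval e env M) == eval x env M)).
  congr nat_of_bool; apply/hasP/mapP => [[i ir /eqP <-]|[i ir ->]]; first by exists i.
  by exists i.
by move=> i _; rewrite eval_eq eval_digit.
Qed.

(** * The program *)

Definition pairs (r : nat) : seq (nat * nat) :=
  [seq p <- [seq (i, i') | i <- iota 0 r, i' <- iota 0 r] | p.1 < p.2].

(** [EPow] unfolds an exponent known in advance; [b] is a variable, so the powers [x^y] are
    tabulated, each computed from the cell before it. *)
Definition powers_expr : expr :=
  let y := EMod (EVar 6) (EAdd (EVar 4) (ECst 1)) in
  EAdd (ENot y) (EMul (ENz y) (EMul (EDiv (EVar 6) (EAdd (EVar 4) (ECst 1)))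
    (EAt (EVar 5) (ESub (EVar 6) (ECst 1))))).

Definition depth_expr : expr :=
  EMul (EVar 2) (ESum (EVar 1)
    (ELt (EAt (EVar 5) (EAdd (EMul (EVar 6) (EAdd (EVar 4) (ECst 1))) (EVar 4)))
         (EAt (EVar 5) (EAdd (EMul (EVar 1) (EAdd (EVar 4) (ECst 1))) (EVar 3))))).

(** The entries of a tuple must increase: they are then distinct, and every clique is listed
    once. *)
Definition good_expr (r : nat) : expr :=
  EAll [seq EMul (ELt (EDigit p.1 (EVar 9)) (EDigit p.2 (EVar 9)))
     (ENz (EGet (EAdd (EMul (EDigit p.1 (EVar 9)) (EVar 0)) (EDigit p.2 (EVar 9)))))
   | p <- pairs r].

Definition kept_expr (r : nat) : expr :=
  EMul (good_expr r)
    (EAll [seq ELt (ESum (EVar 9) (EMul (EAt (EVar 8) (EVar 10))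
                      (EAll [seq EIn r (EDigit i (EVar 9)) (EVar 10) | i <- mu])))
                   (EPow (EAdd (EVar 1) (ECst 1)) (r - size mu))
          | mu <- sublists (iota 0 r)]).

(** Search by summation: the only nonzero contribution comes from the kept tuple preceded by exactly
    as many kept ones as the cell number. *)
Definition list_expr : expr :=
  ESum (EVar 7) (EMul (EVar 12) (EMul (EAt (EVar 8) (EVar 12))
    (EEq (ESum (EVar 12) (EAt (EVar 8) (EVar 13))) (EVar 11)))).

Definition vertex_expr (r : nat) : expr :=
  foldr EAdd (ECst 0) [seq EMul (EEq (EDiv (EVar 12) (EVar 9)) (ECst i))
    (EDigit i (EAt (EVar 10) (EMod (EVar 12) (EVar 9)))) | i <- iota 0 r].

Definition base_expr : expr :=
  EAdd (ENot (EVar 14)) (EMul (ENz (EVar 14))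
    (EMul (EVar 13) (EAt (EVar 12) (ESub (EVar 14) (ECst 1))))).

Definition choice_expr (c i : nat) : expr :=
  EMod (EDiv (EVar c) (EAt (EVar 12) (EVar i))) (EVar 13).

Definition vertex_of (ch : nat) : expr := EAt (EVar 11) (EDiv (EVar ch) (ECst 2)).

Definition live_expr (r : nat) : expr :=
  ELet (EMod (EVar 16) (EVar 9))
  (ELet (EDiv (EVar 16) (EVar 9))
  (ELet (EMod (EVar 18) (EVar 14))
  (ELet (ESub (EVar 6) (EDiv (EVar 18) (EVar 14)))
  (ENot (ESum (EVar 20) (ELet (choice_expr 19 21)
     (EMul (EMod (EVar 22) (ECst 2)) (EIn r (vertex_of 22) (EAt (EVar 10) (EVar 17)))))))))).

Definition adjacent_expr (r : nat) : expr :=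
  ELet (EMod (EVar 17) (EVar 9))
  (ELet (EMod (EDiv (EVar 17) (EVar 9)) (EVar 9))
  (ELet (EDiv (EDiv (EVar 17) (EVar 9)) (EVar 9))
  (ELet (EMod (EVar 20) (EVar 14))
  (ELet (ESub (EVar 6) (EDiv (EVar 20) (EVar 14)))
  (EMul (EAt (EVar 15) (EAdd (EMul (EVar 20) (EVar 9)) (EVar 19)))
  (EMul (EAt (EVar 15) (EAdd (EMul (EVar 20) (EVar 9)) (EVar 18)))
  (EHas [seq EMul (EIn r (EDigit i (EAt (EVar 10) (EVar 19))) (EAt (EVar 10) (EVar 18)))
     (ENot (ESum (EVar 22) (ELet (choice_expr 21 23)
        (EMul (ENot (EMod (EVar 24) (ECst 2)))
              (EEq (vertex_of 24) (EDigit i (EAt (EVar 10) (EVar 19))))))))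
   | i <- iota 0 r]))))))).

(** The table has a layer for each number of steps from 0 to [m]; the previous layer of the same
    node lies [m * m] cells back. *)
Definition reach_expr : expr :=
  ELet (EMod (EVar 18) (EVar 9))
  (ELet (EMod (EDiv (EVar 18) (EVar 9)) (EVar 9))
  (ELet (EMod (EDiv (EDiv (EVar 18) (EVar 9)) (EVar 9)) (EAdd (EVar 9) (ECst 1)))
  (ELet (EDiv (EDiv (EDiv (EVar 18) (EVar 9)) (EVar 9)) (EAdd (EVar 9) (ECst 1)))
  (ELet (ESub (EVar 18) (EMul (EVar 9) (EVar 9)))
  (EAdd (EMul (ENot (EVar 21)) (EEq (EVar 20) (EVar 19)))
  (EMul (ENz (EVar 21)) (ENz (EAdd (EAt (EVar 17) (EVar 23))
     (ESum (EVar 9) (EMul (EAt (EVar 17) (EAdd (ESub (EVar 23) (EVar 19)) (EVar 24)))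
        (EAt (EVar 16) (EAdd (EMul (EAdd (EMul (EVar 22) (EVar 9)) (EVar 24)) (EVar 9)) (EVar 19))))))))))))).

Definition conn_at (q i j : nat) : expr :=
  EAt (EVar 17) (EAdd (EMul (EAdd (EMul (EAdd (EMul (EVar q) (EAdd (EVar 9) (ECst 1))) (EVar 9))
    (EVar 9)) (EVar i)) (EVar 9)) (EVar j)).

(** The number of choices left leads the index, so the children of a node are in cells already
    filled. When it is 0, all [k + 1] tests succeed and give [k + 1]. *)
Definition cost_expr : expr :=
  ELet (EMod (EVar 19) (EVar 9))
  (ELet (EDiv (EVar 19) (EVar 9))
  (ELet (EMod (EVar 21) (EVar 14))
  (ELet (EDiv (EVar 21) (EVar 14))
  (EMul (EMul (EAt (EVar 15) (EAdd (EMul (EVar 21) (EVar 9)) (EVar 20)))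
              (ENot (ESum (EVar 20) (conn_at 21 24 20))))
  (ESum (EAdd (EVar 1) (ECst 1)) (ENot (EMul (ENz (EVar 23)) (ENz
    (ESum (EVar 13) (ELe (EAdd (EMod (EVar 25) (ECst 2))
       (ESum (EVar 9) (EMul (ENz (conn_at 21 20 26)) (EAt (EVar 18)
          (EAdd (EMul (EAdd (EMul (ESub (EVar 23) (ECst 1)) (EVar 14))
                            (EAdd (EMul (EVar 22) (EVar 13)) (EVar 25))) (EVar 9)) (EVar 26))))))
       (EVar 24))))))))))).

Definition answer_expr : expr :=
  ELe (ESum (EVar 9) (EAt (EVar 18) (EAdd (EMul (EMul (EVar 6) (EVar 14)) (EVar 9)) (EVar 19))))
      (EVar 1).

(* The number of nodes [q = d * W + c]: [d] is the number of choices left, and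
   the base-[B] digits of [c] are the choices made. *)
Definition nodes_expr : expr := EMul (EAdd (EVar 6) (ECst 1)) (EVar 14).

(* Variables 0 to 19: n, k, C, a, b; the address of the powers x^y; the depth;
   n^r; the address of the kept tuples; their number m; the addresses of their
   list, of their vertices and of the powers of the number of choices; the number
   of choices; the number W of codes of paths; the addresses of the tables for
   live, adjacent, connected sets and for costs; the answer. *)
Definition solver (r : nat) : seq command :=
  [:: Define (EMul (EVar 0) (EVar 0));
      Fill (EVar 5) (EMul (EAdd (EVar 1) (ECst 1)) (EAdd (EVar 4) (ECst 1))) powers_expr;
      Define depth_expr;
      Define (EPow (EVar 0) r);
      Define (EAdd (EVar 5) (EMul (EAdd (EVar 1) (ECst 1)) (EAdd (EVar 4) (ECst 1))));
      Fill (EVar 8) (EVar 7) (kept_expr r);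
      Define (ESum (EVar 7) (EAt (EVar 8) (EVar 9)));
      Define (EAdd (EVar 8) (EVar 7));
      Fill (EVar 10) (EVar 9) list_expr;
      Define (EAdd (EVar 10) (EVar 9));
      Fill (EVar 11) (EAdd (EMul (ECst r) (EVar 9)) (ECst 1)) (vertex_expr r);
      Define (EAdd (EVar 11) (EAdd (EMul (ECst r) (EVar 9)) (ECst 1)));
      Define (EMul (ECst 2) (EAdd (EMul (ECst r) (EVar 9)) (ECst 1)));
      Fill (EVar 12) (EAdd (EVar 6) (ECst 1)) base_expr;
      Define (EAt (EVar 12) (EVar 6));
      Define (EAdd (EVar 12) (EAdd (EVar 6) (ECst 1)));
      Fill (EVar 15) (EMul nodes_expr (EVar 9)) (live_expr r);
      Define (EAdd (EVar 15) (EMul nodes_expr (EVar 9)));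
      Fill (EVar 16) (EMul (EMul nodes_expr (EVar 9)) (EVar 9)) (adjacent_expr r);
      Define (EAdd (EVar 16) (EMul (EMul nodes_expr (EVar 9)) (EVar 9)));
      Fill (EVar 17) (EMul (EMul (EMul nodes_expr (EAdd (EVar 9) (ECst 1))) (EVar 9)) (EVar 9)) reach_expr;
      Define (EAdd (EVar 17) (EMul (EMul (EMul nodes_expr (EAdd (EVar 9) (ECst 1))) (EVar 9)) (EVar 9)));
      Fill (EVar 18) (EMul nodes_expr (EVar 9)) cost_expr;
      Define answer_expr].

(** * The tables of the program *)

Definition evalE := (eval_not, eval_nz, eval_le, eval_lt, eval_eq, eval_mod,
  eval_pow, eval_at, eval_digit, eval_in).

Ltac ev := repeat progress
  (cbn beta iota zeta delta [eval nth rcons]; rewrite ?evalE).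

Definition stored (M : nat -> nat) (base len : nat) (f : nat -> nat) : Prop :=
  forall i, i < len -> M (base + i) = f i.

Lemma stored_table M base len f base' len' f' :
  stored M base len f -> base + len <= base' -> stored (table base' len' f' M) base len f.
Proof.
move=> st le i il; rewrite /table leqNgt (leq_trans _ le) ?ltn_add2l //; exact: st.
Qed.

Lemma table_stored base len f M : stored (table base len f M) base len f.
Proof. by move=> i il; rewrite /table leq_addr ltn_add2l il addKn. Qed.

Lemma stored_below M M' base len f base' :
  stored M base len f -> base + len <= base' -> (forall a, a < base' -> M' a = M a) ->
  stored M' base len f.
Proof. by move=> st le MM i il; rewrite MM ?st // (leq_trans _ le) ?ltn_add2l. Qed.

Definition meets (X : nat) (cs : seq command) (env : seq nat) (M : nat -> nat)
    (Q : seq nat -> Prop) : Prop :=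
  (forall a, M a <= X) -> bounded X cs env M /\ Q (denote cs env M).1.

Lemma meets_define X e v cs env M Q :
  eval e env M = v -> meets X cs (rcons env v) M Q -> meets X (Define e :: cs) env M Q.
Proof. by move=> <-. Qed.

(** The remaining commands are treated for any memory that holds the new table and agrees with the
    old one below [base], so earlier fills leave no trace in later terms. The entries are bounded by
    induction along the table. *)
Lemma meets_fill X b l e base len cs env M Q :
    eval b env M = base -> eval l env M = len ->
    (forall f, (forall i, i < len -> f i = eval e (rcons env i) (table base i f M)) ->
      (forall a, M a <= X) ->
      (forall i, i < len -> (forall j, j < i -> f j <= X) -> f i <= X) /\
      (forall M', stored M' base len f -> (forall a, a < base -> M' a = M a) ->
        meets X cs env M' Q)) ->
  meets X (Fill b l e :: cs) env M Q.
Proof.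
move=> bE lE h MX; rewrite /= bE lE.
have [f fillE fE] := fill_table base e env len M.
have [fX' rest] := h f fE MX.
have fX i : i < len -> f i <= X.
  elim/ltn_ind: i => i IH il; apply: fX' => // j ji; apply: IH => //; exact: ltn_trans il.
have bnd n a : n <= len -> fill base e env n M a <= X.
  move=> nl; rewrite fillE // /table; case: ifP => // /andP[ba abn].
  by apply: fX; rewrite ltn_subLR // (leq_trans abn) // leq_add2l.
rewrite fillE //; have [|||bd qd] := rest (table base len f M).
- exact: table_stored.
- by move=> a ab; rewrite /table leqNgt ab.
- by move=> a; rewrite -fillE //; apply: bnd.
- by split=> //; split=> // n a nl; apply: bnd.
Qed.

Section Stages.
Variables (n k C a b r : nat).

Lemma powers_eval b0 f M i :
    (forall i, i < k.+1 * b.+1 ->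
       f i = eval powers_expr (rcons [:: n; k; C; a; b; b0] i) (table b0 i f M)) ->
  i < k.+1 * b.+1 -> f i = (i %/ b.+1) ^ (i %% b.+1).
Proof.
move=> fE; elim/ltn_ind: i => i IH il; rewrite fE // /powers_expr; ev.
rewrite !addn1; have [->|y0] := eqVneq (i %% b.+1) 0; first by rewrite expn0.
have i0 : 0 < i by case: i y0 {IH il} => //; rewrite mod0n.
have pi : i - 1 < i by lia.
rewrite mul1n add0n table_stored // IH //; last exact: ltn_trans il.
have y1 : 0 < i %% b.+1 by rewrite lt0n.
have e1 : i - 1 = i %/ b.+1 * b.+1 + (i %% b.+1).-1 by rewrite {1}(divn_eq i b.+1); lia.
have lt : (i %% b.+1).-1 < b.+1 by apply: leq_ltn_trans (leq_pred _) _; rewrite ltn_mod.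
rewrite e1 divnMDl // (divn_small lt) addn0 modnMDl (modn_small lt).
by rewrite -expnS prednK.
Qed.
End Stages.

Lemma digit_lt n i j : 0 < n -> digit n i j < n.
Proof. exact: ltn_pmod. Qed.

Lemma size_digits n r j : size (digits n r j) = r.
Proof. by rewrite size_map size_iota. Qed.

Lemma nth_digits n r i j : i < r -> nth 0 (digits n r j) i = digit n i j.
Proof. by move=> ir; rewrite (nth_map 0) ?size_iota // nth_iota. Qed.

Definition good_tuple (n r : nat) (M : nat -> nat) (j : nat) : bool :=
  all (fun p => (digit n p.1 j < digit n p.2 j) &&
    (M (digit n p.1 j * n + digit n p.2 j) != 0)) (pairs r).

Lemma depth_eval n k C a b b0 M : a <= b ->
    stored M b0 (k.+1 * b.+1) (fun i => (i %/ b.+1) ^ (i %% b.+1)) ->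
  eval depth_expr [:: n; k; C; a; b; b0] M = C * \sum_(x < k) (x ^ b < k ^ a).
Proof.
move=> ab st; rewrite /depth_expr; ev; congr (C * _).
have rd x y : x <= k -> y <= b -> M (b0 + (x * (b + 1) + y)) = x ^ y.
  move=> xk yb; rewrite addn1 st.
    by rewrite divnMDl // modnMDl divn_small ?modn_small ?addn0 ?ltnS.
  have : x * b.+1 <= k * b.+1 by rewrite leq_mul2r xk orbT.
  by rewrite mulSn; lia.
apply: eq_bigr => x _; ev; rewrite !rd //; exact: ltnW.
Qed.

Lemma pair_address n r j p : p \in pairs r -> j < n ^ r ->
  digit n p.1 j * n + digit n p.2 j < n * n.
Proof.
move=> pr jN; have n0 : 0 < n.
  move: pr; rewrite mem_filter => /andP[_ /allpairsP[q [q1 q2 pq]]].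
  case: (n) jN => // + ; case: (r) q1 => // r' _; by rewrite exp0n.
have := digit_lt p.1 j n0; have := digit_lt p.2 j n0.
move: (digit _ _ _) (digit _ _ _) => u v un vn.
apply: (@leq_trans (u.+1 * n)); first by rewrite mulSn addnC ltn_add2r.
by rewrite leq_mul2r vn orbT.
Qed.

Lemma good_tuple_ext n r M M' j : j < n ^ r -> (forall a, a < n * n -> M a = M' a) ->
  good_tuple n r M j = good_tuple n r M' j.
Proof. by move=> jN MM; apply: eq_in_all => p pr; rewrite MM // (pair_address pr jN). Qed.

Lemma kept_eval n k C a b b0 h b1 r f M :
    n * n <= b1 ->
    (forall j, j < n ^ r -> f j = eval (kept_expr r)
      (rcons [:: n; k; C; a; b; b0; h; n ^ r; b1] j) (table b1 j f M)) ->
  forall j, j < n ^ r -> f j = good_tuple n r M j &&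
    all (fun mu => \sum_(j' < j) ((f j' != 0) && all (fun i => digit n i j \in digits n r j') mu)
           < k.+1 ^ (r - size mu)) (sublists (iota 0 r)) :> nat.
Proof.
move=> nb1 fE j; elim/ltn_ind: j => j IH jN.
have fb j' : j' < j -> f j' = (f j' != 0).
  move=> j'j; rewrite (IH j' j'j); last exact: ltn_trans jN.
  by case: (_ && _).
rewrite fE // /kept_expr; ev; rewrite -mulnb; congr (_ * _).
  rewrite (eval_all (b := fun p => (digit n p.1 j < digit n p.2 j) &&
    (M (digit n p.1 j * n + digit n p.2 j) != 0))) // => p pr; ev.
  rewrite mulnb; congr (nat_of_bool (_ && (_ != 0))).
  by rewrite /table leqNgt (leq_trans (pair_address pr jN) nb1).
rewrite (eval_all (b := fun mu => \sum_(j' < j) ((f j' != 0) && all (fun i => digit n i j \in digits n r j') mu)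
           < k.+1 ^ (r - size mu))) // => mu mus; ev; rewrite addn1.
congr (nat_of_bool (_ < _)); apply: eq_bigr => j' _; ev.
rewrite table_stored // -mulnb; congr (_ * _); first exact: fb.
by apply: eval_all => i _; ev.
Qed.

Section Rank.
Variable kept : pred nat.

Definition rank (j : nat) : nat := \sum_(j' < j) kept j'.

Lemma rankS j : rank j.+1 = rank j + kept j.
Proof. by rewrite /rank big_ord_recr. Qed.

Lemma rank_mono i j : i <= j -> rank i <= rank j.
Proof.
move=> /subnK <-; elim: (j - i) => // d IH; rewrite addSn rankS.
exact: leq_trans IH (leq_addr _ _).
Qed.

Lemma rank_lt i j : i < j -> kept i -> rank i < rank j.
Proof. by move=> ij ki; apply: leq_trans (rank_mono ij); rewrite rankS ki addn1. Qed.

Lemma rank_inj i j : kept i -> kept j -> rank i = rank j -> i = j.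
Proof.
move=> ki kj E; have [ij|ji|//] := ltngtP i j.
  by have := rank_lt ij ki; rewrite E ltnn.
by have := rank_lt ji kj; rewrite E ltnn.
Qed.

Lemma rank_ex N q : q < rank N -> exists j, [/\ j < N, kept j & rank j = q].
Proof.
elim: N => [|N IH]; first by rewrite /rank big_ord0.
rewrite rankS; have [lt _|ge] := ltnP q (rank N).
  by have [j [jN kj rj]] := IH lt; exists j; split=> //; apply: ltnW.
case kN : (kept N); last by rewrite addn0 ltnNge ge.
by rewrite addn1 ltnS => le; exists N; split=> //; apply/eqP; rewrite eqn_leq le ge.
Qed.

End Rank.

Lemma eval_sum (T : eqType) (s : seq T) (g : T -> expr) env M :
  eval (foldr EAdd (ECst 0) (map g s)) env M = \sum_(x <- s) eval (g x) env M.
Proof. by elim: s => [|x s IH] /=; rewrite ?big_nil // big_cons IH. Qed.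

Lemma table_le base i f M X a :
  (forall a, M a <= X) -> (forall j, j < i -> f j <= X) -> table base i f M a <= X.
Proof.
move=> MX fX; rewrite /table; case: ifP => // /andP[ba ai]; apply: fX.
by rewrite ltn_subLR // addnC.
Qed.

Lemma sum_has (p : pred nat) l : (\sum_(i < l) p i == 0) = ~~ has p (iota 0 l).
Proof.
rewrite -(big_mkord xpredT (fun i => nat_of_bool (p i))) /index_iota subn0.
elim: (iota 0 l) => [|x s IH]; first by rewrite big_nil.
by rewrite big_cons addn_eq0 IH /= negb_or; case: (p x).
Qed.

Lemma digit_le n i j : digit n i j <= j.
Proof. exact: leq_trans (leq_mod _ _) (leq_div _ _). Qed.

Section ListStages.
Variables (n k C a b b0 h NR b1 m b2 b3 r : nat) (M : nat -> nat).

Lemma list_eval (kept : pred nat) f : m = rank kept NR ->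
    stored M b1 NR kept -> b1 + NR <= b2 ->
    (forall q, q < m -> f q = eval list_expr
      (rcons [:: n; k; C; a; b; b0; h; NR; b1; m; b2] q) (table b2 q f M)) ->
  forall q, q < m -> [/\ f q < NR, kept (f q) & rank kept (f q) = q].
Proof.
move=> mE st le fE q qm; have [j [jN kj rj]] := rank_ex (etrans (congr1 (leq q.+1) (esym mE)) qm).
suff -> : f q = j by [].
have st' := stored_table q f st le.
rewrite fE // /list_expr; ev.
transitivity (\sum_(i < NR) i * (kept i && (rank kept i == q))).
  apply: eq_bigr => i _; ev; rewrite st' // mulnb; congr (_ * nat_of_bool (_ && (_ == _))).
  by apply: eq_bigr => i0 _; ev; rewrite st' //; apply: ltn_trans (ltn_ord i).
rewrite (bigD1 (Ordinal jN)) //= kj rj eqxx muln1 big1 ?addn0 // => i ij.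
case ki : (kept i); rewrite ?muln0 //=; case: eqP; rewrite ?muln0 // -rj => /(rank_inj ki kj) ij'.
by case/negP: ij; apply/eqP/val_inj.
Qed.

Lemma vertex_eval f (lst : nat -> nat) :
    stored M b2 m lst -> b2 + m <= b3 ->
    (forall y, y < r * m + 1 -> f y = eval (vertex_expr r)
      (rcons [:: n; k; C; a; b; b0; h; NR; b1; m; b2; b3] y) (table b3 y f M)) ->
  forall i q, i < r -> q < m -> f (i * m + q) = digit n i (lst q).
Proof.
move=> st le fE i q ir qm.
have ylt : i * m + q < r * m + 1.
  rewrite addn1 ltnS; apply: (@leq_trans (i.+1 * m)); first by rewrite mulSn addnC leq_add2r ltnW.
  by rewrite leq_mul2r ir orbT.
have m0 : 0 < m by apply: leq_trans qm.
have st' := stored_table (i * m + q) f st le.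
rewrite fE // /vertex_expr eval_sum.
transitivity (\sum_(i' <- iota 0 r) (i == i') * digit n i' (lst q)).
  apply: eq_bigr => i' _; ev.
  by rewrite divnMDl // (divn_small qm) addn0 modnMDl (modn_small qm) st'.
rewrite (bigD1_seq i) ?mem_iota ?iota_uniq //= eqxx mul1n big1 ?addn0 // => i' ii'.
by rewrite eq_sym (negPf ii').
Qed.

Lemma vertex_le f X : (forall a, M a <= X) ->
    (forall y, y < r * m + 1 -> f y = eval (vertex_expr r)
      (rcons [:: n; k; C; a; b; b0; h; NR; b1; m; b2; b3] y) (table b3 y f M)) ->
  forall y, y < r * m + 1 -> (forall j, j < y -> f j <= X) -> f y <= X.
Proof.
move=> MX fE y yl fX; rewrite fE // /vertex_expr eval_sum.
set c := table b3 y f M (b2 + y %% m).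
have cX : c <= X by apply: table_le.
have -> : \sum_(i <- iota 0 r) eval (EMul (EEq (EDiv (EVar 12) (EVar 9)) (ECst i))
    (EDigit i (EAt (EVar 10) (EMod (EVar 12) (EVar 9)))))
    (rcons [:: n; k; C; a; b; b0; h; NR; b1; m; b2; b3] y) (table b3 y f M) =
  \sum_(i <- iota 0 r) (y %/ m == i) * digit n i c.
  by apply: eq_bigr => i _; ev.
have [yr|yr] := boolP (y %/ m \in iota 0 r); last first.
  rewrite big_seq big1 // => i ir; case: eqP => [E|]; last by rewrite mul0n.
  by rewrite E ir in yr.
rewrite (bigD1_seq (y %/ m)) ?iota_uniq //= eqxx mul1n big1 => [|i ne].
  by rewrite addn0; apply: leq_trans (digit_le _ _ _) cX.
by rewrite eq_sym (negPf ne).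
Qed.

Lemma base_eval b4 B f :
    (forall i, i < h.+1 -> f i = eval base_expr
      (rcons [:: n; k; C; a; b; b0; h; NR; b1; m; b2; b3; b4; B] i) (table b4 i f M)) ->
  forall i, i < h.+1 -> f i = B ^ i.
Proof.
move=> fE; elim/ltn_ind => -[|i] IH il; rewrite fE // /base_expr; ev.
by rewrite add0n mul1n subn1 /= table_stored // IH // ?expnS // ltnW.
Qed.

End ListStages.

(** The latest choice is the lowest digit, so a child has code [c * B + ch] and its path is obtained
    by consing. *)
Definition path_of (B l c : nat) : seq nat := [seq (c %/ B ^ i) %% B | i <- iota 0 l].

Lemma path_of_cons B l c ch : ch < B -> path_of B l.+1 (c * B + ch) = ch :: path_of B l c.
Proof.
move=> chB; have B0 : 0 < B by apply: leq_trans chB.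
rewrite /path_of /= expn0 divn1 modnMDl modn_small // (iotaDl 1 0) -map_comp; congr cons.
apply: eq_map => i /=; rewrite add1n expnS divnMA divnMDl // (divn_small chB) addn0 //.
Qed.

Section PathStages.
Variables (n k C a b b0 h NR b1 m b2 b3 b4 B W b5 r : nat) (M : nat -> nat).
Variables (lst vtx : nat -> nat).
Hypotheses (B_def : B = 2 * (r * m + 1))
  (st2 : stored M b2 m lst) (st3 : stored M b3 (r * m + 1) vtx)
  (st4 : stored M b4 h.+1 (expn B))
  (le23 : b2 + m <= b3) (le34 : b3 + (r * m + 1) <= b4) (le45 : b4 + h.+1 <= b5).
Let tup T := digits n r (lst T).
Let xv ch := vtx (ch %/ 2).
Let path_at q := path_of B (h - q %/ W) (q %% W).

Lemma mod_B_half x : x %% B %/ 2 < r * m + 1.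
Proof. by rewrite ltn_divLR // mulnC -B_def ltn_pmod // B_def addn1 muln_gt0. Qed.

Lemma live_eval f len :
    (forall i, i < len -> f i = eval (live_expr r)
      (rcons [:: n; k; C; a; b; b0; h; NR; b1; m; b2; b3; b4; B; W; b5] i) (table b5 i f M)) ->
  forall q T, q * m + T < len -> T < m ->
  f (q * m + T) = live tup xv (path_at q) T.
Proof.
move=> fE q T il Tm; have m0 : 0 < m by apply: leq_trans Tm.
have rd2 := stored_table (q * m + T) f st2 (leq_trans le23 (leq_trans (leq_addr _ _) (leq_trans le34 (leq_trans (leq_addr _ _) le45)))).
have rd3 := stored_table (q * m + T) f st3 (leq_trans le34 (leq_trans (leq_addr _ _) le45)).
have rd4 := stored_table (q * m + T) f st4 le45.
rewrite fE // /live_expr /choice_expr /vertex_of; ev.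
rewrite divnMDl // (divn_small Tm) addn0 modnMDl (modn_small Tm).
congr nat_of_bool; rewrite /live /path_at /path_of has_map -sum_has; congr (_ == 0).
apply: eq_bigr => i _; ev.
have ih : i < h.+1.
  rewrite ltnS; apply: leq_trans (leq_subr (q %/ W) h); apply: ltnW.
  exact: ltn_ord.
rewrite rd4 // rd3 ?mod_B_half // rd2 // modn2 mulnb.
by [].
Qed.

Variables (b6 b7 b8 : nat) (lv ad re : nat -> nat).
Let N := h.+1 * W.

Lemma ltn_index q T N' m' : q < N' -> T < m' -> q * m' + T < N' * m'.
Proof.
move=> qN Tm; apply: (@leq_trans (q.+1 * m')); last by rewrite leq_mul2r qN orbT.
by rewrite mulSn addnC ltn_add2r.
Qed.

Lemma divn_index x y d : y < d -> (x * d + y) %/ d = x.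
Proof. by move=> yd; rewrite divnMDl ?(leq_trans _ yd) // (divn_small yd) addn0. Qed.

Lemma modn_index x y d : y < d -> (x * d + y) %% d = y.
Proof. by move=> yd; rewrite modnMDl modn_small. Qed.

Lemma adjacent_eval f len :
    stored M b5 (N * m) lv -> b5 + N * m <= b6 ->
    (forall q T, q < N -> T < m -> lv (q * m + T) = live tup xv (path_at q) T) ->
    (forall i, i < len -> f i = eval (adjacent_expr r)
      (rcons [:: n; k; C; a; b; b0; h; NR; b1; m; b2; b3; b4; B; W; b5; b6] i) (table b6 i f M)) ->
  forall q T T', (q * m + T) * m + T' < len -> q < N -> T < m -> T' < m ->
  f ((q * m + T) * m + T') = adjacent tup xv (path_at q) T T'.
Proof.
move=> st5 le56 lvE fE q T T' il qN Tm T'm; have m0 : 0 < m by apply: leq_trans Tm.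
set idx := _ + T' in il *.
have rd5 := stored_table idx f st5 le56.
have le46 : b4 + h.+1 <= b6 := leq_trans le45 (leq_trans (leq_addr _ _) le56).
have rd2 := stored_table idx f st2 (leq_trans le23 (leq_trans (leq_addr _ _) (leq_trans le34 (leq_trans (leq_addr _ _) le46)))).
have rd3 := stored_table idx f st3 (leq_trans le34 (leq_trans (leq_addr _ _) le46)).
have rd4 := stored_table idx f st4 le46.
rewrite fE // /adjacent_expr; ev.
have -> : idx %/ m = q * m + T by rewrite /idx divnMDl // (divn_small T'm) addn0.
have -> : idx %% m = T' by rewrite /idx modnMDl (modn_small T'm).
rewrite divnMDl // (divn_small Tm) addn0 modnMDl (modn_small Tm).
rewrite !rd5 ?ltn_index // !lvE // /adjacent -!mulnb; congr (_ * (_ * _)).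
rewrite (eval_sum_has (b := fun i => (digit n i (lst T) \in tup T') && ~~ excluded xv (path_at q) (digit n i (lst T)))).
  by rewrite eqb0 negbK has_map.
move=> i _; ev; rewrite !rd2 // mulnb; congr (nat_of_bool (_ && _)).
rewrite /excluded /path_at /path_of has_map -sum_has; congr (_ == 0).
apply: eq_bigr => j _; rewrite /choice_expr /vertex_of; ev.
have jh : j < h.+1 by rewrite ltnS; apply: leq_trans (leq_subr (q %/ W) h); apply/ltnW/ltn_ord.
by rewrite rd4 // rd3 ?mod_B_half // rd2 // modn2 eqb0 mulnb.
Qed.

Fixpoint walk (e : nat -> nat -> bool) (s T T' : nat) : bool :=
  if s is s'.+1 then
    walk e s' T T' || has (fun T'' => walk e s' T T'' && e T'' T') (iota 0 m)
  else T == T'.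

(** A connecting path can be shortened until it repeats no tuple, so [m] steps suffice. *)
Lemma walk_conn p (T T' : 'I_m) : walk (adjacent tup xv p) m T T' = conn tup xv p T T'.
Proof.
apply/idP/idP.
  suff gen s (T0 : 'I_m) : walk (adjacent tup xv p) s T T0 -> conn tup xv p T T0 by apply: gen.
  elim: s T0 => [|s IH] {}T' /=; first by move/eqP/val_inj => ->; apply: connect0.
  case/orP=> [/IH //|/hasP[t]]; rewrite mem_iota => /andP[_ tm] /andP[wt et].
  apply: (conn_trans (IH (Ordinal tm) wt)); exact: connect1.
case/connectP=> q0 q0P; case/shortenP: q0P => q qP Uq _ ->{T'}.
have szq : size q <= m by have := max_card (mem (T :: q)); rewrite card_ord (card_uniqP Uq) /= => /ltnW.
have walk_path : forall s (q' : seq 'I_m),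
    path (fun i j : 'I_m => adjacent tup xv p i j) T q' -> size q' <= s ->
    walk (adjacent tup xv p) s T (last T q').
  elim=> [|s IH] q'; first by case: q' => //= _ _; apply: eqxx.
  case/lastP: q' => [|q' z] /=; first by move=> _ _; rewrite (IH [::]).
  rewrite rcons_path last_rcons size_rcons ltnS => /andP[pq' ez] sq'.
  apply/orP; right; apply/hasP; exists (last T q' : nat); first by rewrite mem_iota ltn_ord.
  by rewrite IH.
exact: walk_path qP szq.
Qed.

Lemma reach_eval f len :
    stored M b6 (N * m * m) ad -> b6 + N * m * m <= b7 ->
    (forall q T T', q < N -> T < m -> T' < m ->
       ad ((q * m + T) * m + T') = adjacent tup xv (path_at q) T T') ->
    (forall i, i < len -> f i = eval reach_expr
      (rcons [:: n; k; C; a; b; b0; h; NR; b1; m; b2; b3; b4; B; W; b5; b6; b7] i) (table b7 i f M)) ->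
  forall s q T T', ((q * m.+1 + s) * m + T) * m + T' < len -> q < N -> s < m.+1 -> T < m -> T' < m ->
  f (((q * m.+1 + s) * m + T) * m + T') = walk (adjacent tup xv (path_at q)) s T T'.
Proof.
move=> st6 le67 adE fE; elim=> [|s IH] q T T' il qN sm Tm T'm;
  rewrite fE // /reach_expr; ev; rewrite addn1 !(divn_index _ T'm, modn_index _ T'm,
    divn_index _ Tm, modn_index _ Tm, divn_index _ sm, modn_index _ sm).
  by rewrite mul1n mul0n addn0.
set idx := _ + T' in il *.
have m0 : 0 < m by apply: leq_trans Tm.
rewrite mul0n mul1n add0n.
have rd6 := stored_table idx f st6 le67.
pose Y := (q * m.+1 + s) * m + T.
have idxE : idx = m * m + (Y * m + T') by rewrite /idx addnS mulSn -addnA mulnDl -addnA.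
have mm : m <= m * m by apply: leq_pmull.
have own T'' : T'' < m -> table b7 idx f M (b7 + (((q * m.+1 + s) * m + T) * m + T'')) =
    walk (adjacent tup xv (path_at q)) s T T''.
  move=> T''m; have lt : ((q * m.+1 + s) * m + T) * m + T'' < idx.
    by clear - mm T''m idxE; rewrite idxE; lia.
  rewrite table_stored // IH //; first exact: ltn_trans il.
  exact: ltnW.
have prevE : idx - m * m = ((q * m.+1 + s) * m + T) * m + T'.
  by rewrite idxE addKn.
rewrite prevE own // addn_eq0 negb_and; congr nat_of_bool.
rewrite [RHS]/=; congr (_ || _); first by rewrite eqb0 negbK.
rewrite (_ : \sum_(i < m) _ = \sum_(i < m) (walk (adjacent tup xv (path_at q)) s T i && adjacent tup xv (path_at q) i T')).
  by rewrite (sum_has (fun i => walk (adjacent tup xv (path_at q)) s T i && adjacent tup xv (path_at q) i T')) negbK.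
by apply: eq_bigr => i _; ev; rewrite addnK own // rd6 ?adE ?ltn_index // mulnb.
Qed.

Lemma sum_has_ord l (p : pred nat) : (\sum_(i < l) p i != 0) = [exists i : 'I_l, p i].
Proof.
rewrite sum_nat_eq0 negb_forall; apply: eq_existsb => i.
by rewrite /= eqb0 negbK.
Qed.

Hypothesis W_def : W = B ^ h.

Lemma path_at_node d c : d <= h -> c < B ^ (h - d) ->
  [/\ d * W + c < N, path_at (d * W + c) = path_of B (h - d) c & c < W].
Proof.
move=> dh cB; have cW : c < W.
  apply: leq_trans cB _; rewrite W_def leq_exp2l ?leq_subr //.
  by rewrite B_def addn1 mulnS ltn_addr.
split=> //; first exact: ltn_index.
by rewrite /path_at divn_index // modn_index.
Qed.

(** Only codes [c < B ^ (h - d)] stand for paths. The other cells of the table are filled as well,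
    but nothing is claimed of them and no child of a genuine node is among them. *)
Lemma cost_eval f len :
    stored M b5 (N * m) lv -> b5 + N * m <= b8 ->
    (forall q T, q < N -> T < m -> lv (q * m + T) = live tup xv (path_at q) T) ->
    stored M b7 (N * m.+1 * m * m) re -> b7 + N * m.+1 * m * m <= b8 ->
    (forall q T T', q < N -> T < m -> T' < m ->
       re (((q * m.+1 + m) * m + T) * m + T') = walk (adjacent tup xv (path_at q)) m T T') ->
    (forall i, i < len -> f i = eval cost_expr
      (rcons [:: n; k; C; a; b; b0; h; NR; b1; m; b2; b3; b4; B; W; b5; b6; b7; b8] i) (table b8 i f M)) ->
    len = N * m ->
  forall d c (T : 'I_m), d <= h -> c < B ^ (h - d) ->
  f ((d * W + c) * m + T) = cost k B tup xv d (path_of B (h - d) c) T.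
Proof.
move=> st5 le58 lvE st7 le78 reE fE lenE.
have step d c (T : 'I_m) : d <= h -> c < B ^ (h - d) ->
    f ((d * W + c) * m + T) =
    (live tup xv (path_of B (h - d) c) T && rep tup xv (path_of B (h - d) c) T) *
    \sum_(v < k.+1) ~~ ((d != 0) && [exists ch : 'I_B, odd ch +
      \sum_(T' < m) conn tup xv (path_of B (h - d) c) T T' *
        table b8 ((d * W + c) * m + T) f M (b8 + (((d - 1) * W + (c * B + ch)) * m + T')) <= v]).
  move=> dh cB; have [qN pE cW] := path_at_node dh cB; have Tm := ltn_ord T.
  set q := _ + c in qN pE *; set idx := q * m + T.
  have il : idx < len by rewrite lenE; apply: ltn_index.
  have rd5 := stored_table idx f st5 le58; have rd7 := stored_table idx f st7 le78.
  have rdc T1 T2 : T1 < m -> T2 < m ->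
      table b8 idx f M (b7 + (((q * (m + 1) + m) * m + T1) * m + T2)) =
      walk (adjacent tup xv (path_of B (h - d) c)) m T1 T2.
    by move=> T1m T2m; rewrite addn1 rd7 ?reE ?pE // !ltn_index.
  rewrite fE // /cost_expr /conn_at; ev.
  rewrite !(divn_index _ Tm, modn_index _ Tm, divn_index _ cW, modn_index _ cW).
  rewrite rd5 ?ltn_index // lvE // pE -!mulnb; congr (_ * _ * _).
    congr nat_of_bool; apply: negb_inj.
    transitivity (\sum_(i < T) walk (adjacent tup xv (path_of B (h - d) c)) m i T != 0).
      congr (_ != 0); apply: eq_bigr => i _; ev.
      by rewrite rdc //; apply: ltn_trans (ltn_ord i) Tm.
    rewrite (sum_has_ord _ (fun i => walk (adjacent tup xv (path_of B (h - d) c)) m i T)).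
    rewrite /rep negb_forall; apply/existsP/existsP => -[i].
      move=> iT; exists (widen_ord (ltnW Tm) i); rewrite negb_imply negbK -walk_conn iT andbT.
      exact: (ltn_ord i).
    rewrite negb_imply negbK => /andP[lt cn]; exists (Ordinal lt).
    by rewrite (walk_conn _ i T).
  rewrite addn1; apply: eq_bigr => v _; ev; rewrite mulnb eqb0; congr (nat_of_bool (~~ (_ && _))).
  rewrite sum_nat_eq0 negb_forall; apply: eq_existsb => ch; rewrite implyTb.
  ev; rewrite eqb0 negbK modn2; congr (_ + _ <= _).
  apply: eq_bigr => T' _; ev; rewrite rdc // -walk_conn eqb0 negbK //.
elim=> [|d IH] c T dh cB; rewrite step //=.
  case: (_ && _); rewrite ?mul0n // mul1n.
  by rewrite sum_nat_const card_ord muln1.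
case: (_ && _); rewrite ?mul0n // mul1n; apply: eq_bigr => v _; congr (nat_of_bool (~~ _)).
apply: eq_existsb => ch; congr (_ + _ <= _).
rewrite [RHS]big_mkcond; apply: eq_bigr => T' _; case: ifP => cTT'; rewrite ?mul0n // mul1n.
have hd : h - d = (h - d.+1).+1 by rewrite subnSK.
have chB := ltn_ord ch.
have cB' : c * B + ch < B ^ (h - d) by rewrite hd expnSr; apply: ltn_index.
have [_ _ cW'] := path_at_node (ltnW dh) cB'.
rewrite subn1 /= table_stored; first by rewrite IH // ?(ltnW dh) // hd path_of_cons.
by apply: leq_trans (leq_addr _ _); apply: ltn_index => //; rewrite mulSn [W + _]addnC; clear - cW'; lia.
Qed.

End PathStages.

Ltac define v := apply: (@meets_define _ _ v); [by ev | cbn beta iota delta [rcons]].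

Lemma good_tuple_lt n r M j i i' : good_tuple n r M j -> i < i' -> i' < r ->
  digit n i j < digit n i' j /\ M (digit n i j * n + digit n i' j) != 0.
Proof.
move=> /allP gj ii' ir; have /gj/andP[] // : (i, i') \in pairs r.
rewrite mem_filter ii' /=; apply/allpairsP; exists (i, i') => /=.
by rewrite !mem_iota ir (ltn_trans ii' ir).
Qed.

Lemma good_tuple_uniq n r M j : good_tuple n r M j -> uniq (digits n r j).
Proof.
move=> gj; rewrite map_inj_in_uniq ?iota_uniq // => i i'; rewrite !mem_iota !add0n /= => ir ir' E.
have [lt|gt|//] := ltngtP i i'.
  by have [] := good_tuple_lt gj lt ir'; rewrite E ltnn.
by have [] := good_tuple_lt gj gt ir; rewrite E ltnn.
Qed.

Lemma kept_digits n k r (kept : pred nat) M j :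
    kept j = good_tuple n r M j &&
        all (fun mu => \sum_(j' < j) (kept j' && all (fun i => digit n i j \in digits n r j') mu)
           < k.+1 ^ (r - size mu)) (sublists (iota 0 r)) ->
    kept j = good_tuple n r M j &&
        all (fun mu => \sum_(j' < j) (kept j' && all (fun i => nth 0 (digits n r j) i \in digits n r j') mu)
           < k.+1 ^ (r - size mu)) (sublists (iota 0 r)).
Proof.
move=> ->; congr (_ && _); apply: eq_in_all => mu; rewrite mem_sublists => sub.
congr (_ < _); apply: eq_bigr => j' _; congr (nat_of_bool (_ && _)).
apply: eq_in_all => i /(mem_subseq sub); rewrite mem_iota => /andP[_ ir].
by rewrite nth_digits.
Qed.

Section SolverRun.
Variables (n k C a b r : nat) (M0 : nat -> nat) (X : nat).
Let h := C * \sum_(x < k) (x ^ b < k ^ a).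
Hypotheses (ab : a <= b) (X1 : k < X) (Xb : k.+1 ^ b <= X) (Xn : n ^ r <= X)
  (Xh : (2 * (r * k.+1 ^ r + 1)) ^ h <= X) (MX : forall a, M0 a <= X).

Definition solved (env : seq nat) : Prop :=
  exists (kept : pred nat) (lst vtx : nat -> nat) (m := rank kept (n ^ r)),
  [/\ forall j, j < n ^ r -> kept j = good_tuple n r M0 j &&
        all (fun mu => \sum_(j' < j) (kept j' && all (fun i => digit n i j \in digits n r j') mu)
           < k.+1 ^ (r - size mu)) (sublists (iota 0 r)),
      forall q, q < m -> [/\ lst q < n ^ r, kept (lst q) & rank kept (lst q) = q],
      forall i q, i < r -> q < m -> vtx (i * m + q) = digit n i (lst q)
    & last 0 env = (\sum_(T < m) cost k (2 * (r * m + 1)) (fun T => digits n r (lst T))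
        (fun ch => vtx (ch %/ 2)) h [::] T <= k)].

(** Every table entry is a truth value, a sum of at most [k + 1] tests, a tuple number or one of its
    digits, or a power of one of the two kinds bounded by hypothesis; the kernel bound
    [m <= k.+1 ^ r] handles the powers of the number of choices. *)
Lemma solver_meets : meets X (solver r) [:: n; k; C; a; b] M0 solved.
Proof.
rewrite /solver; define (n * n); set b0 := n * n.
set l0 := k.+1 * b.+1.
apply: (@meets_fill _ _ _ _ b0 l0) ; [by []|by ev; rewrite !addn1|move=> f0 fE _].
have f0E := powers_eval fE; split=> [i il _|M1 st0 MM1].
  rewrite f0E //; have xk : i %/ b.+1 < k.+1 by rewrite ltn_divLR.
  apply: leq_trans Xb; apply: (@leq_trans (k.+1 ^ (i %% b.+1))).
    by case: (i %% b.+1) => // y; rewrite leq_exp2r // ltnW.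
  by rewrite leq_pexp2l // -ltnS ltn_mod.
have {}st0 : stored M1 b0 l0 (fun i => (i %/ b.+1) ^ (i %% b.+1)).
  by move=> i il; rewrite st0 // f0E.
apply: (@meets_define _ _ h); first exact: depth_eval.
cbn beta iota delta [rcons].
define (n ^ r).
apply: (@meets_define _ _ (b0 + l0)); first by ev; rewrite !addn1.
cbn beta iota delta [rcons]; set b1 := b0 + l0.
have le01 : b0 <= b1 := leq_addr _ _.
apply: (@meets_fill _ _ _ _ b1 (n ^ r)) ; [by []|by []|move=> f1 {}fE _].
have f1E := kept_eval le01 fE; clear fE.
pose kept : pred nat := fun j => f1 j != 0.
have f1b j : j < n ^ r -> f1 j = kept j.
  by move=> jN; rewrite /kept (f1E _ jN); case: (_ && _).
have keptE j : j < n ^ r -> kept j = good_tuple n r M0 j &&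
        all (fun mu => \sum_(j' < j) (kept j' && all (fun i => digit n i j \in digits n r j') mu)
           < k.+1 ^ (r - size mu)) (sublists (iota 0 r)).
  move=> jN; rewrite {1}/kept (f1E _ jN) (good_tuple_ext jN MM1).
  by case: (_ && _).
split=> [i il _|M2 st1 MM2].
  by rewrite f1b //; apply: leq_trans (leq_b1 _) (leq_trans (ltn0Sn k) X1).
have {}st1 : stored M2 b1 (n ^ r) kept by move=> j jN; rewrite st1 // f1b.
set m := rank kept (n ^ r).
apply: (@meets_define _ _ m).
  by ev; apply: eq_bigr => j _; ev; rewrite st1.
cbn beta iota delta [rcons].
have m_le : m <= k.+1 ^ r.
  by apply: (card_kept (@good_tuple_uniq n r M0) (size_digits n r)
    (fun j jN => kept_digits (keptE j jN))).
define (b1 + n ^ r); set b2 := b1 + n ^ r.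
apply: (@meets_fill _ _ _ _ b2 m) ; [by []|by []|move=> lst fE _].
have lstE := list_eval (erefl m) st1 (leqnn b2) fE; clear fE.
split=> [q qm _|M3 st2 MM3].
  by have [lN _ _] := lstE q qm; apply: leq_trans (ltnW lN) Xn.
define (b2 + m); set b3 := b2 + m.
apply: (@meets_fill _ _ _ _ b3 (r * m + 1)) ; [by []|by []|move=> vtx fE MX3].
have vtxE := vertex_eval st2 (leqnn b3) fE.
split=> [y yl yX|M4 st3 MM4]; first exact: vertex_le MX3 fE y yl yX.
clear fE; have {}st2 := stored_below st2 (leqnn b3) MM4.
define (b3 + (r * m + 1)); set b4 := b3 + (r * m + 1).
(* The extra vertex cell keeps the number of choices positive when no tuple is kept. *)
define (2 * (r * m + 1)); set B := 2 * (r * m + 1).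
have B0 : 0 < B by rewrite muln_gt0 addn1.
apply: (@meets_fill _ _ _ _ b4 h.+1) ; [by []|by ev; rewrite addn1|move=> pw fE _].
have pwE := base_eval fE; clear fE.
split=> [i ih _|M5 st4 MM5].
  rewrite pwE //; apply: leq_trans Xh; apply: (@leq_trans (B ^ h)).
    by rewrite leq_pexp2l.
  by case: (h) => // h'; rewrite leq_exp2r // leq_mul2l leq_add2r leq_mul2l m_le orbT.
have {}st4 : stored M5 b4 h.+1 (expn B) by move=> i ih; rewrite st4 // pwE.
have {}st2 := stored_below st2 (leq_addr _ _) MM5.
have {}st3 := stored_below st3 (leqnn b4) MM5.
apply: (@meets_define _ _ (B ^ h)); first by ev; rewrite st4.
cbn beta iota delta [rcons]; set W := B ^ h.
apply: (@meets_define _ _ (b4 + h.+1)); first by ev; rewrite addn1.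
cbn beta iota delta [rcons]; set b5 := b4 + h.+1.
have le23 : b2 + m <= b3 := leqnn _.
have le34 : b3 + (r * m + 1) <= b4 := leqnn _.
have le24 : b2 + m <= b4 := leq_trans le23 (leq_addr _ _).
set N := h.+1 * W.
have X0 : 0 < X := leq_trans (ltn0Sn k) X1.
have bX (c : bool) : c <= X := leq_trans (leq_b1 c) X0.
apply: (@meets_fill _ _ _ _ b5 (N * m)) ; [by []|by rewrite /nodes_expr; ev; rewrite addn1|move=> lv fE _].
have lvE := live_eval (erefl B) st2 st3 st4 le23 le34 (leqnn b5) fE; clear fE.
have m_pos i l : i < l * m -> 0 < m by case: (m) => //; rewrite muln0.
split=> [i il _|M6 st5 MM6].
  have Tm : i %% m < m by rewrite ltn_mod (m_pos i N).
  by rewrite (divn_eq i m) lvE // -divn_eq.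
have {}st2 := stored_below st2 (leq_trans le24 (leq_addr _ _)) MM6.
have {}st3 := stored_below st3 (leq_trans le34 (leq_addr _ _)) MM6.
have {}st4 := stored_below st4 (leqnn b5) MM6.
apply: (@meets_define _ _ (b5 + N * m)); first by rewrite /nodes_expr; ev; rewrite addn1.
cbn beta iota delta [rcons]; set b6 := b5 + N * m.
apply: (@meets_fill _ _ _ _ b6 (N * m * m)) ; [by []|by rewrite /nodes_expr; ev; rewrite addn1|move=> ad fE _].
have lvE' q T : q < N -> T < m -> _ := fun qN Tm => lvE q T (ltn_index qN Tm) Tm.
have adE := adjacent_eval (erefl B) st2 st3 st4 le23 le34 (leqnn b5) st5 (leqnn b6) lvE' fE; clear fE.
have adE' q T T' : q < N -> T < m -> T' < m -> _ := fun qN Tm T'm =>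
  adE q T T' (ltn_index (ltn_index qN Tm) T'm) qN Tm T'm.
split=> [i il _|M7 st6 MM7].
  have m0 := m_pos _ _ il.
  have h1 : i %% m < m by rewrite ltn_mod.
  have h2 : i %/ m %% m < m by rewrite ltn_mod.
  have h3 : i %/ m %/ m < N by rewrite !ltn_divLR.
  by rewrite (divn_eq i m) {1}(divn_eq (i %/ m) m) adE // -!divn_eq.
have le56 : b5 + N * m <= b6 := leqnn _.
have {}st5 := stored_below st5 le56 MM7.
apply: (@meets_define _ _ (b6 + N * m * m)); first by rewrite /nodes_expr; ev; rewrite addn1.
cbn beta iota delta [rcons]; set b7 := b6 + N * m * m.
have le67 : b6 + N * m * m <= b7 := leqnn _.
apply: (@meets_fill _ _ _ _ b7 (N * m.+1 * m * m));
  [by []|by rewrite /nodes_expr; ev; rewrite !addn1|move=> re fE _].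
have reE := reach_eval st6 le67 adE' fE; clear fE.
split=> [i il _|M8 st7 MM8].
  have m0 := m_pos _ _ il.
  have h1 : i %% m < m by rewrite ltn_mod.
  have h2 : i %/ m %% m < m by rewrite ltn_mod.
  have h3 : i %/ m %/ m %% m.+1 < m.+1 by rewrite ltn_mod.
  have h4 : i %/ m %/ m %/ m.+1 < N by rewrite !ltn_divLR.
  by rewrite (divn_eq i m) {1}(divn_eq (i %/ m) m) {1}(divn_eq (i %/ m %/ m) m.+1) reE // -!divn_eq.
have le57 : b5 + N * m <= b7 := leq_trans le56 (leq_addr _ _).
have {}st5 := stored_below st5 le57 MM8.
apply: (@meets_define _ _ (b7 + N * m.+1 * m * m)); first by rewrite /nodes_expr; ev; rewrite !addn1.
cbn beta iota delta [rcons]; set b8 := b7 + N * m.+1 * m * m.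
have le58 : b5 + N * m <= b8 := leq_trans le57 (leq_addr _ _).
apply: (@meets_fill _ _ _ _ b8 (N * m));
  [by []|by rewrite /nodes_expr; ev; rewrite addn1|move=> cst fE _].
have reE' q T T' : q < N -> T < m -> T' < m -> _ := fun qN Tm T'm =>
  reE m q T T' (ltn_index (ltn_index (ltn_index qN (ltnSn m)) Tm) T'm) qN (ltnSn m) Tm T'm.
have cstE := cost_eval (erefl B) (erefl W) st5 le58 lvE' st7 (leqnn b8) reE' fE (erefl _).
split=> [i il _|M9 st8 _].
  have Tm : i %% m < m by rewrite ltn_mod (m_pos i N).
  have qN : i %/ m < N by rewrite ltn_divLR ?(m_pos i N).
  rewrite fE // /cost_expr; ev; apply: leq_trans X1.
  rewrite (stored_table _ _ st5 le58) ?ltn_index // lvE' // mulnb addn1.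
  case: (_ && _); rewrite ?mul0n // mul1n.
  apply: (@leq_trans (\sum_(v < k.+1) 1)); last by rewrite sum1_card card_ord.
  by apply: leq_sum => v _; ev; apply: leq_b1.
clear fE.
apply: meets_define; first by reflexivity.
move=> _; split=> //; exists kept, lst, vtx; split=> //.
rewrite /denote [LHS]last_rcons /answer_expr; ev; congr (nat_of_bool (_ <= _)).
apply: eq_bigr => T _; ev.
have h0 : 0 < B ^ (h - h) by rewrite subnn.
rewrite -(addn0 (h * W)) st8; last first.
  by apply: ltn_index => //; rewrite addn0 /N mulSn -[X in X < _]add0n ltn_add2r expn_gt0 B0.
by rewrite cstE // subnn.
Qed.

End SolverRun.

Lemma digits_ex n (s : seq nat) : all (fun x => x < n) s ->
  exists2 j, j < n ^ size s & digits n (size s) j = s.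
Proof.
elim: s => [|x s IH] /=; first by exists 0.
case/andP=> xn /IH[j jN js]; exists (j * n + x); first by rewrite expnSr ltn_index.
have -> : digits n (size s).+1 (j * n + x) = x :: digits n (size s) j := path_of_cons _ _ xn.
by rewrite js.
Qed.

(** * Correctness and running time *)

Section Decide.
Variables (G : sgraph) (num : 'I_#|G| -> G) (k r : nat).
Hypothesis num_bij : bijective num.
Let n := #|G|.
Let M0 : nat -> nat := Defs.mem (input num k).

Lemma input_edge (i j : 'I_#|G|) : (M0 (i * #|G| + j) != 0) = edge (num i) (num j).
Proof.
rewrite /M0 /input /= eqb0 negbK; apply/existsP/idP => [[i' /existsP[j' /andP[/eqP E ij]]]|ij].
  have Ei : i = i'.
    apply: val_inj; have := congr1 (divn^~ #|G|) E.
    by rewrite /= !divn_index.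
  have Ej : j = j'.
    apply: val_inj; have := congr1 (modn^~ #|G|) E.
    by rewrite /= !modn_index.
  by rewrite Ei Ej.
by exists i; apply/existsP; exists j; rewrite eqxx.
Qed.

Lemma num_code : exists code : G -> nat, [/\ injective code, forall v, code v < n,
  forall i, i < n -> exists v, code v = i
  & forall u v, (M0 (code u * n + code v) != 0) = edge u v].
Proof.
have [g gK Kg] := num_bij; exists (fun v => g v : nat); split.
- by move=> u v /val_inj/(can_inj Kg).
- by move=> v; apply: ltn_ord.
- by move=> i il; exists (num (Ordinal il)); rewrite gK.
- by move=> u v; rewrite input_edge !Kg.
Qed.

Variables (code : G -> nat).
Hypotheses (code_inj : injective code) (code_lt : forall v, code v < n)
  (code_ex : forall i, i < n -> exists v, code v = i)
  (code_edge : forall u v, (M0 (code u * n + code v) != 0) = edge u v).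

Definition tuple_set (j : nat) : {set G} := [set v | code v \in digits n r j].

Lemma digits_lt j x : j < n ^ r -> x \in digits n r j -> x < n.
Proof.
move=> jN /mapP[i]; rewrite mem_iota => /andP[_ ir] ->; apply: digit_lt.
by case: (n) jN ir => // jN; case: (r) jN => //= r' ; rewrite exp0n.
Qed.

Lemma tuple_set_clique j : j < n ^ r -> good_tuple n r M0 j ->
  clique (tuple_set j) /\ #|tuple_set j| = r.
Proof.
move=> jN gj; split.
  apply/forall_inP => u; rewrite inE => /mapP[i]; rewrite mem_iota add0n => /andP[_ ir] ui.
  apply/forall_inP => v; rewrite inE => /mapP[i']; rewrite mem_iota add0n => /andP[_ i'r] vi.
  apply/implyP => uv; have [ii'|ii'|E] := ltngtP i i'.
  - by have [_] := good_tuple_lt gj ii' i'r; rewrite -ui -vi code_edge.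
  - by have [_] := good_tuple_lt gj ii' ir; rewrite -ui -vi code_edge edge_sym.
  - by case/eqP: uv; apply: code_inj; rewrite ui vi E.
rewrite cardE -(size_map code) -[RHS](size_digits n r j); apply/perm_size/uniq_perm.
- by rewrite (map_inj_uniq code_inj) enum_uniq.
- exact: good_tuple_uniq gj.
- move=> x; apply/mapP/idP => [[v]|xj]; first by rewrite mem_enum inE => vj ->.
  have [v vx] := code_ex (digits_lt jN xj).
  by exists v; rewrite ?mem_enum ?inE ?vx.
Qed.

Lemma clique_tuple (K : {set G}) : clique K -> #|K| = r ->
  exists j, [/\ j < n ^ r, good_tuple n r M0 j & tuple_set j = K].
Proof.
move=> /forall_inP cK cardK; pose s := sort leq [seq code v | v <- enum K].
have sz : size s = r by rewrite size_sort size_map -cardE.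
have mem_s x : (x \in s) = [exists v in K, code v == x].
  rewrite mem_sort; apply/mapP/existsP => [[v]|[v /andP[vK /eqP <-]]].
    by rewrite mem_enum => vK ->; exists v; rewrite vK eqxx.
  by exists v; rewrite ?mem_enum.
have s_lt : all (fun x => x < n) s.
  by apply/allP => x; rewrite mem_s => /existsP[v /andP[_ /eqP <-]].
have [j] := digits_ex s_lt; rewrite sz => jN js; exists j; split=> //.
  apply/allP => p; rewrite mem_filter => /andP[p12 /allpairsP[[i i'] [/= ir i'r pE]]].
  rewrite pE /= in p12 *; rewrite !mem_iota !add0n /= in ir i'r.
  have lt : digit n i j < digit n i' j.
    rewrite -(nth_digits n j ir) -(nth_digits n j i'r) js.
    apply: (sorted_ltn_nth ltn_trans); rewrite ?inE ?sz //.
    rewrite ltn_sorted_uniq_leq sort_uniq (map_inj_uniq code_inj) enum_uniq /=.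
    exact: sort_sorted leq_total _.
  rewrite lt /=.
  have si : digit n i j \in s by rewrite -(nth_digits n j ir) js mem_nth ?sz.
  have si' : digit n i' j \in s by rewrite -(nth_digits n j i'r) js mem_nth ?sz.
  move: si si'; rewrite !mem_s => /existsP[u /andP[uK /eqP uE]] /existsP[v /andP[vK /eqP vE]].
  rewrite -uE -vE code_edge; have /forall_inP/(_ v vK)/implyP := cK u uK; apply.
  by apply: contraTneq lt => uv; rewrite -uE -vE uv ltnn.
apply/setP => v; rewrite inE js mem_s; apply/existsP/idP => [[u /andP[uK /eqP/code_inj <-]] //|vK].
by exists v; rewrite vK eqxx.
Qed.

Variables (h : nat).
Hypothesis elim_h : forall S : {set G}, #|S| <= k ->
  exists2 A : {set G}, S \subset A & elim (torso A) h A.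

Lemma Kr_cover_hits (S : {set G}) :
  Kr_free r (induced (~: S)) <-> (forall K : {set G}, clique K -> #|K| = r -> exists2 v, v \in S & v \in K).
Proof.
split=> [free K cK cardK|hit K /forall_inP cK cardK].
  have [//|nhit] := EM (exists2 v, v \in S & v \in K); exfalso.
  have KS v : v \in K -> v \in ~: S.
    by move=> vK; rewrite inE; apply/negP => vS; apply: nhit; exists v.
  apply: (free [set x : induced (~: S) | val x \in K]).
    apply/forall_inP => x; rewrite inE => xK; apply/forall_inP => y; rewrite inE => yK.
    apply/implyP => xy; move/forall_inP: cK => /(_ _ xK)/forall_inP/(_ _ yK)/implyP; exact.
  rewrite -cardK -(card_imset _ val_inj); apply: eq_card => v.
  apply/imsetP/idP => [[x]|vK]; first by rewrite inE => xK ->.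
  by exists (Sub v (KS v vK)); rewrite ?inE.
have [| |v vS] := hit (val @: K).
- apply/forall_inP => _ /imsetP[x xK ->]; apply/forall_inP => _ /imsetP[y yK ->].
  apply/implyP => xy; have /forall_inP/(_ y yK)/implyP := cK x xK; apply.
  by apply: contra xy => /eqP ->.
- by rewrite card_imset //; apply: val_inj.
by case/imsetP=> x xK vx; have := valP x; rewrite inE -vx vS.
Qed.

(** A table value of at most [k] gives a set hitting the kept tuples, hence all cliques. Conversely
    a cover lies in some [A], and the two clauses of its torso supply what the branching asks of [H]
    inside and outside [A]. *)
Lemma solved_correct C a b env :
    h = C * \sum_(x < k) (x ^ b < k ^ a) ->
  solved n k C a b r M0 env -> last 0 env <> 0 <-> Kr_cover r G k.
Proof.
move=> hE [kept [lst [vtx]]]; cbv zeta; set m := rank kept (n ^ r).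
case=> keptE lstE vtxE ->; rewrite -hE.
have kE j jN := kept_digits (keptE j jN).
have tupE (T : 'I_m) x : (x \in digits n r (lst T)) =
    [exists v in tuple_set (lst T), code v == x].
  have [lN _ _] := lstE T (ltn_ord T); apply/idP/existsP => [xT|[v]].
    have [v vx] := code_ex (digits_lt lN xT).
    by exists v; rewrite inE vx xT eqxx.
  by rewrite inE => /andP[vT /eqP <-].
split.
  case: leqP => // /root_sound[S Sk hit] _.
  have keptS j : j < n ^ r -> kept j -> has (mem S) (digits n r j).
    move=> jN kj; have qm : rank kept j < m by apply: rank_lt.
    have [_ kl rl] := lstE _ qm; have := hit (Ordinal qm).
    by rewrite /= (rank_inj kl kj rl).
  have goodS := kept_hits (@good_tuple_uniq n r M0) (size_digits n r) kE Sk keptS.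
  exists [set v | code v \in S].
    apply: leq_trans Sk; rewrite cardE -(size_map code); apply: uniq_leq_size.
      by rewrite (map_inj_uniq code_inj) enum_uniq.
    by move=> x /mapP[v]; rewrite mem_enum inE => vS ->.
  apply/Kr_cover_hits => K cK cardK; have [j [jN gj <-]] := clique_tuple cK cardK.
  have /hasP[x xj /= xS] := goodS j jN gj; have [v vx] := code_ex (digits_lt jN xj).
  by exists v; rewrite inE vx.
case=> S Sk /Kr_cover_hits hit; have [A SA el] := elim_h Sk.
suff -> : \sum_(T < m) cost k (2 * (r * m + 1)) (fun T : nat => digits n r (lst T))
     (fun ch : nat => vtx (ch %/ 2)) h [::] T <= k by [].
have cliqueT (T : 'I_m) : clique (tuple_set (lst T)) /\ #|tuple_set (lst T)| = r.
  have [lN kl _] := lstE T (ltn_ord T); apply: (tuple_set_clique lN).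
  by move: kl; rewrite keptE // => /andP[].
have edgeT (T : 'I_m) u v : u \in tuple_set (lst T) -> v \in tuple_set (lst T) -> u != v -> edge u v.
  by have [/forall_inP cT _] := cliqueT T; move=> uT vT; have /forall_inP/(_ v vT)/implyP := cT u uT.
apply: (@root_complete m k _ _ _ G code (fun T => tuple_set (lst T)) S A (torso A)) el Sk.
- exact: code_inj.
- exact: tupE.
- move=> T v b'; rewrite inE => /mapP[i]; rewrite mem_iota add0n => /andP[_ ir] vi.
  (* The vertex is addressed as entry [i] of tuple [T]; the parity carries the decision. *)
  exists ((i * m + T) * 2 + b'); split.
  + have : i * m + T < r * m by apply: ltn_index.
    by rewrite mulnDr; case: b' => /=; lia.
  + by rewrite oddD oddM andbF oddb.
  + by rewrite divn_index ?ltnS ?leq_b1 // vtxE.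
- exact: SA.
- by move=> T; have [cT sT] := cliqueT T; apply: hit.
- by move=> T u v uT vT _ _ uv; rewrite /torso (edgeT T).
- move=> T T' x u v xT xT' xA uT vT' uA vA uv; rewrite /torso; apply/orP; right.
  apply/existsP; exists x; rewrite xA (edgeT T) ?(edgeT T') //.
    by apply: contraNneq xA => ->.
  by apply: contraNneq xA => ->.
Qed.

End Decide.

(** * The depth as a rounded rational power *)

Lemma count_prefix (P : pred nat) k : (forall x y, x <= y -> P y -> P x) ->
  forall x, x < k -> P x = (x < \sum_(i < k) P i).
Proof.
move=> dec; have le_k n : \sum_(i < n) P i <= n.
  by rewrite -[X in _ <= X]card_ord -sum1_card; apply: leq_sum => i _; apply: leq_b1.
elim: k => // k IH x; rewrite ltnS leq_eqVlt big_ord_recr /=; case/orP=> [/eqP->|xk].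
  case Pk : (P k); last by rewrite addn0 ltnNge le_k.
  have -> : \sum_(i < k) P i = k.
    rewrite -[RHS]card_ord -sum1_card; apply: eq_bigr => i _.
    by rewrite (dec i k) // ltnW.
  by rewrite addn1 leqnn.
case Pk : (P k); last by rewrite addn0 IH.
by rewrite (dec x k) 1?ltnW // addn1 ltnS -IH // (dec x k) // ltnW.
Qed.

Section Exponents.
Local Open Scope ring_scope.
Variable R : realType.

(** The count is [k^(a/b)] rounded up. Since [a <= b], this power is at most [k], and counting only
    [x < k] loses nothing. *)
Lemma count_powR (a b k : nat) : (0 < a)%N -> (a <= b)%N ->
  let cnt := (\sum_(x < k) (x ^ b < k ^ a))%N in
  k%:R `^ (a%:R / b%:R) <= cnt%:R :> R /\ cnt%:R <= k%:R `^ (a%:R / b%:R) + 1 :> R.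
Proof.
move=> a0 ab cnt; set y : R := k%:R `^ _.
have b0 : (0 < b)%N := leq_trans a0 ab.
have y0 : 0 <= y by apply: powR_ge0.
have yb : y ^+ b = (k ^ a)%:R.
  rewrite natrX -powR_mulrn // -powRrM divfK ?pnatr_eq0 -?lt0n // powR_mulrn //.
have cmp x : (x ^ b < k ^ a)%N = (x%:R < y).
  rewrite -(ltr_nat R) -yb natrX ltr_pXn2r ?nnegrE //.
have pre := @count_prefix (fun x => (x ^ b < k ^ a)%N) k.
have cntP u : (u < k)%N -> (u ^ b < k ^ a)%N = (u < cnt)%N.
  apply: pre => {}u v uv; apply: leq_ltn_trans; case: (b) => // b'; by rewrite leq_exp2r.
have cnt_k : (cnt <= k)%N.
  by rewrite -[X in (_ <= X)%N]card_ord -sum1_card; apply: leq_sum => i _; apply: leq_b1.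
split.
  rewrite leNgt -cmp; apply/negP => lt.
  have [ck|kc] := ltnP cnt k; first by have := cntP _ ck; rewrite lt ltnn.
  have ck : cnt = k by apply/eqP; rewrite eqn_leq cnt_k.
  move: lt; rewrite ck ltnNge; case/negP.
  by case: (k) => [|k']; [rewrite exp0n | rewrite leq_pexp2l].
case c0 : cnt => [|c]; first by rewrite addr_ge0.
have ck : (c < k)%N by rewrite -ltnS -c0 ltnS.
by rewrite -natr1 lerD2r ltW // -cmp cntP // c0.
Qed.

Lemma rational_between (x y : R) : 0 <= x -> x < y -> y <= 1 ->
  exists a b : nat, [/\ (0 < a)%N, (a <= b)%N, x < a%:R / b%:R & a%:R / b%:R <= y].
Proof.
move=> x0 xy y1; pose b := Num.bound (y - x)^-1.
have yx0 : 0 < y - x by rewrite subr_gt0.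
have hb : (y - x)^-1 < b%:R by apply: archi_boundP; rewrite invr_ge0 ltW.
have b0 : 0 < b%:R :> R by apply: lt_trans hb; rewrite invr_gt0.
have hb1 : 1 < b%:R * (y - x) by rewrite -ltr_pdivrMr // mul1r.
have xb0 : 0 <= x * b%:R by rewrite mulr_ge0 // ltW.
pose a := (Num.truncn (x * b%:R)).+1; have /andP[ax xa] := truncn_itv xb0.
have ay : a%:R <= y * b%:R.
  have -> : a%:R = (Num.truncn (x * b%:R))%:R + 1 :> R by rewrite natr1.
  by clear - ax hb1; lra.
exists a, b; split=> //.
- by rewrite -(ler_nat R); apply: (le_trans ay); rewrite ler_piMl // ltW.
- by rewrite ltr_pdivlMr.
- by rewrite ler_pdivrMr.
Qed.

End Exponents.

(** * The complete program and its running time *)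

Definition kr_program (r C a b : nat) : program :=
  Seq (Const 2 C) (Seq (Const 3 a) (Seq (Const 4 b)
    (Seq (compile_all 5 (solver r)) (Seq (Const 20 0) (Add 0 19 20))))).

Lemma size_denote cs env M :
  size (denote cs env M).1 =
    size env + count (fun c => if c is Define _ then true else false) cs.
Proof.
elim: cs env M => [|[e|b' l e] cs IH] env M /=; first by rewrite addn0.
  by rewrite IH size_rcons addSn addnS.
by rewrite IH add0n.
Qed.

Lemma kr_program_run r : exists D, forall (G : sgraph) (num : 'I_#|G| -> G) (k C a b X : nat),
  let h := C * \sum_(x < k) (x ^ b < k ^ a) in
  a <= b -> k < X -> k.+1 ^ b <= X -> #|G| ^ r <= X ->
  (2 * (r * k.+1 ^ r + 1)) ^ h <= X -> #|G| <= X -> C <= X -> b <= X ->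
  bijective num ->
  (forall S : {set G}, #|S| <= k -> exists2 A : {set G}, S \subset A & elim (torso A) h A) ->
  exists t s, [/\ exec (kr_program r C a b) (input num k) t s,
     reg s 0 <> 0 <-> Kr_cover r G k & t <= (X + 2) ^ D].
Proof.
have [D hD] := compile_all_correct (solver r); exists (D + 3).
move=> G num k C a b X h ab kX bX nX hX GX CX bX' bij el.
pose s0 := set_reg (set_reg (set_reg (input num k) 2 C) 3 a) 4 b.
set n := #|G| in nX GX *.
have X1 : 0 < X by apply: leq_trans kX.
have MX0 x : Defs.mem (input num k) x <= X by apply: leq_trans (leq_b1 _) X1.
have [bd sol] := solver_meets ab kX bX nX hX MX0.
have := hD s0 [:: n; k; C; a; b] (Defs.mem (input num k)) X.
case=> [||//|//|t [s1 [ex1 t1 [envE ME]]]].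
- by [].
- move=> x; rewrite !inE => /or4P[/eqP->|/eqP->|/eqP->|/orP[]/eqP->] //; first exact: ltnW.
  exact: leq_trans bX'.
have := size_denote (solver r) [:: n; k; C; a; b] (Defs.mem (input num k)).
rewrite [X in _ = _ + X -> _](erefl : _ = 15) [X in _ = X -> _](erefl : _ = 20).
move: sol envE; move: (denote _ _ _).1 => env sol envE sz.
exists (1 + (1 + (1 + (t + (1 + 1))))), (set_reg (set_reg s1 20 0) 0 (reg s1 19 + 0)); split.
- apply: ExecSeq; first exact: ExecConst.
  apply: ExecSeq; first exact: ExecConst.
  apply: ExecSeq; first exact: ExecConst.
  apply: ExecSeq; first exact: ex1.
  apply: ExecSeq; first exact: ExecConst.
  exact: (ExecAdd (set_reg s1 20 0) 0 19 20).
- have -> : reg (set_reg (set_reg s1 20 0) 0 (reg s1 19 + 0)) 0 = last 0 env.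
    rewrite reg_set eqxx addn0 (last_nth 0) sz [RHS]/=; move: envE; rewrite sz => <-.
    by rewrite (nth_map 0).
  have [code [c1 c2 c3 c4]] := num_code k bij.
  exact: (solved_correct c1 c2 c3 c4 el (erefl _) sol).
- clear - t1; have X7 : 7 <= (X + 2) ^ 3.
    by apply: (@leq_trans (2 ^ 3)); [by []|rewrite leq_exp2r // leq_addl].
  have u0 : 0 < (X + 2) ^ D by rewrite expn_gt0 addn2.
  rewrite expnD; apply: (@leq_trans ((X + 2) ^ D * 7)); last by rewrite leq_mul2l X7 orbT.
  by move: t1 u0; move: (_ ^ D) => u t1 u0; lia.
Qed.

(** The part of the bound on table entries that does not involve [n]. *)
Definition budget (r C a b k : nat) : nat :=
  k.+1 + C + b + k.+1 ^ b + (2 * (r * k.+1 ^ r + 1)) ^ (C * \sum_(x < k) (x ^ b < k ^ a)).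

(** Once [k] exceeds the constants, every summand is below a power of [k]; only the last has an
    exponent growing with [k], a multiple of the depth. *)
Lemma budget_le r C a b k : 1 < k -> 2 * r.+1 <= k -> C + b + 3 <= k ->
  budget r C a b k + 2 <= k ^ (4 + 2 * b + (2 * r + 2) * (C * \sum_(x < k) (x ^ b < k ^ a))).
Proof.
move=> k1 rk Ck; rewrite /budget; set h := C * _.
have kk e : 0 < k ^ e by rewrite expn_gt0 ltnW.
have k2 : k.+1 <= k ^ 2 by rewrite !expnS expn0; nia.
have hu : k.+1 + C + b + 2 <= k ^ 2 by rewrite !expnS expn0; nia.
have hv : k.+1 ^ b <= k ^ (2 * b) by rewrite expnM; case: (b) => // b'; rewrite leq_exp2r.
have hw0 : 2 * (r * k.+1 ^ r + 1) <= k ^ (2 * r + 2).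
  have : k.+1 ^ r <= k ^ (2 * r) by rewrite expnM; case: (r) => // r'; rewrite leq_exp2r.
  rewrite expnD; move: (kk (2 * r)); move: (k.+1 ^ r) (k ^ (2 * r)) => x y y0 xy.
  apply: (@leq_trans (2 * r.+1 * y)); last by rewrite mulnC leq_mul2l !expnS expn0; nia.
  by nia.
have hw : (2 * (r * k.+1 ^ r + 1)) ^ h <= k ^ ((2 * r + 2) * h).
  by rewrite expnM; case: (h) => // h'; rewrite leq_exp2r.
rewrite 2!expnD -mulnA; have := kk (2 * b); have := kk ((2 * r + 2) * h).
move: hu hv hw; move: (_ ^ h) (k ^ ((2 * r + 2) * h)) (k.+1 ^ b) (k ^ (2 * b)) => w w' v v' hu hv hw w0 v0.
have k4 : 3 * (k ^ 2) <= k ^ 4.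
  have -> : k ^ 4 = k ^ 2 * k ^ 2 by rewrite -expnD.
  have k3 : 3 <= k ^ 2 by rewrite !expnS expn0; nia.
  by rewrite leq_mul2r k3 orbT.
have vw : 0 < v' * w' by rewrite muln_gt0 v0.
apply: (@leq_trans (3 * k ^ 2 * (v' * w'))); last by rewrite leq_mul2r k4 orbT.
have h1 : v' <= k ^ 2 * (v' * w') by nia.
have h2 : w' <= k ^ 2 * (v' * w') by nia.
have h3 : k ^ 2 <= k ^ 2 * (v' * w') by rewrite leq_pmulr.
rewrite -mulnA; move: (k ^ 2 * (v' * w')) (k ^ 2) h1 h2 h3 hu => z k2' h1 h2 h3 hu; lia.
Qed.

Section Budget.
Local Open Scope ring_scope.
Variable R : realType.

Lemma budget_exponent (r C a b D : nat) (beta : R) :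
    (0 < a)%N -> (a <= b)%N -> a%:R / b%:R <= beta ->
  exists (c : R) (N : nat), forall k : nat, (N <= k)%N ->
    ln ((budget r C a b k + 2) ^ D)%:R / ln 2 <= c * (k%:R `^ beta * ln k%:R).
Proof.
move=> a0 ab gb; have ln2 : 0 < ln 2 :> R by rewrite ln_gt0 // ltr1n.
exists (D%:R * (4 + 2 * b + (2 * r + 2) * (C * 2))%:R / ln 2), (2 + 2 * r.+1 + (C + b + 3))%N => k Nk.
have k1 : (1 < k)%N by lia.
have L0 : 0 <= ln k%:R :> R by rewrite ln_ge0 // ler1n ltnW.
have k0 : 0 < k%:R :> R by rewrite ltr0n ltnW.
have kb1 : 1 <= k%:R `^ beta :> R.
  apply: powR_nat_ge1; first exact: ltnW.
  by apply: le_trans gb; rewrite divr_ge0.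
have [_ cnt_le] := @count_powR R a b k a0 ab.
have h_le : (C * \sum_(x < k) (x ^ b < k ^ a))%:R <= (C * 2)%:R * k%:R `^ beta :> R.
  rewrite natrM [(C * 2)%:R]natrM -mulrA; apply: ler_wpM2l => //; apply: (le_trans cnt_le).
  have : k%:R `^ (a%:R / b%:R) <= k%:R `^ beta :> R by apply: ler_powR => //; rewrite ler1n ltnW.
  by clear - kb1; lra.
have rk : (2 * r.+1 <= k)%N by clear - Nk; lia.
have Ck : (C + b + 3 <= k)%N by clear - Nk; lia.
have := @budget_le r C a b k k1 rk Ck.
move: h_le; move: (C * \sum_(x < k) _)%N (budget r C a b k) => h Q h_le Q_le.
set E := (4 + 2 * b + (2 * r + 2) * h)%N in Q_le.
have E_le : E%:R <= (4 + 2 * b + (2 * r + 2) * (C * 2))%:R * k%:R `^ beta :> R.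
  rewrite /E natrD natrM [(4 + 2 * b + (2 * r + 2) * (C * 2))%:R]natrD mulrDl; apply: lerD.
    by rewrite -[leLHS]mulr1; apply: ler_wpM2l.
  by rewrite natrM -mulrA; apply: ler_wpM2l.
have Q0 : 0 < (Q + 2)%:R :> R by rewrite ltr0n addn2.
have lnQ : ln (Q + 2)%:R <= E%:R * ln k%:R :> R.
  rewrite mulr_natl -lnXn // ler_ln ?posrE ?exprn_gt0 // -natrX ler_nat //.
rewrite natrX lnXn // -[_ *+ D]mulr_natl ler_pdivrMr //.
apply: (@le_trans _ _ (D%:R * ((4 + 2 * b + (2 * r + 2) * (C * 2))%:R * k%:R `^ beta * ln k%:R))).
  apply: ler_wpM2l => //; apply: (le_trans lnQ); exact: ler_wpM2r.
by rewrite le_eqVlt; apply/orP; left; apply/eqP; field; rewrite gt_eqF.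
Qed.

End Budget.

Local Open Scope ring_scope.

Theorem theorem1p7 (R : realType) (r : nat) :
  exists d : nat,
  forall (alpha : R) (C : sgraph -> Prop),
  0 < alpha < 1 ->
  hereditary C ->
  (exists c N : nat, forall G : sgraph, C G -> (N <= #|G|)%N ->
     (#|cliques_lt G r| <= c * #|G|)%N) ->
  (exists (c : R) (N : nat), forall G : sgraph, C G -> (N <= #|G|)%N ->
     (treewidth G)%:R <= c * #|G|%:R `^ alpha) ->
  exists (p : program) (f : nat -> R),
    (exists (c : R) (N : nat), forall k : nat, (N <= k)%N ->
       f k <= c * (k%:R `^ (2 / (1 + alpha^-1)) * ln k%:R)) /\
    solves_within C (Kr_cover r) p
      (fun n k => 2 `^ f k * (maxn 1 n)%:R ^+ d).
Proof.
have [D runD] := kr_program_run r; exists (r.+1 * D)%N.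
move=> alpha C a01 hered _ tw; have /andP[a0 a1] := a01.
set beta := 2 / (1 + alpha^-1).
have a1p : 0 < 1 + alpha by rewrite addr_gt0.
have betaE : beta = 2 * alpha / (1 + alpha).
  by rewrite /beta; field; rewrite !gt_eqF // addrC.
have ab : alpha < beta.
  rewrite betaE ltr_pdivlMr //; nra.
have b1 : beta <= 1 by rewrite betaE ler_pdivrMr //; lra.
(* Strictly above [alpha] for the torso to have small depth, at most [beta] for the running time. *)
have [a [b [pa pab ag gb]]] := rational_between (ltW a0) ab b1.
have [c c0 sep] := hereditary_separable a0 hered tw.
have [C0 elimC0] := torso_elim (ltW c0) a01 ag.
pose K := Num.bound `|C0|.
have C0K : C0 <= K%:R by apply: le_trans (ler_norm _) (ltW (archi_boundP _)).
(* The binary logarithm of the exact bound, so that [2] to this power gives it back for every [k],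
   small ones included. *)
exists (kr_program r K a b), (fun k => ln ((budget r K a b k + 2) ^ D)%:R / ln 2).
split; first exact: budget_exponent.
move=> G num k CG bij; set n := #|G|; pose nn := maxn 1 n.
have nn0 : (0 < nn)%N by rewrite leq_max.
(* The exponent [r.+1] covers both [n] and [n ^ r], also for [r = 0]; [nn] keeps the factor positive
   for the empty graph. *)
pose X := (nn ^ r.+1 * budget r K a b k)%N.
have nr0 : (0 < nn ^ r.+1)%N by rewrite expn_gt0 nn0.
have QX : (budget r K a b k <= X)%N by apply: leq_pmull.
have Q0 : (0 < budget r K a b k)%N by rewrite /budget !addSn.
have nnX e : (e <= r.+1)%N -> (n ^ e <= X)%N.
  move=> er; apply: (@leq_trans (nn ^ r.+1)); last exact: leq_pmulr.
  apply: (@leq_trans (nn ^ e)); last by rewrite leq_pexp2l.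
  by case: e {er} => // e; rewrite leq_exp2r // leq_maxr.
have nX : (n <= X)%N by have := nnX 1%N isT; rewrite expn1.
have kQ : (k < budget r K a b k)%N by rewrite /budget !addSn ltnS -!addnA leq_addr.
have KQ : (K <= budget r K a b k)%N by rewrite /budget -!addnA addnCA leq_addr.
have bQ' : (b <= budget r K a b k)%N.
  by rewrite /budget -addnA -[X in (_ <= X + _)%N]addnC -addnA leq_addr.
have bQ : (k.+1 ^ b <= budget r K a b k)%N by rewrite /budget addnAC leq_addl.
have hQ : ((2 * (r * k.+1 ^ r + 1)) ^ (K * \sum_(x < k) (x ^ b < k ^ a)) <= budget r K a b k)%N.
  exact: leq_addl.
have elimh (S : {set G}) : (#|S| <= k)%N -> exists2 A : {set G}, S \subset A &
    elim (torso A) (K * \sum_(x < k) (x ^ b < k ^ a))%N A.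
  move=> Sk; have [A SA el] := elimC0 G (sep G CG) S; exists A => //; apply: el.
  have [cnt_ge _] := @count_powR R a b k pa pab.
  rewrite natrM; apply: (@le_trans _ _ (K%:R * #|S|%:R `^ (a%:R / b%:R))).
    by apply: ler_wpM2r => //; apply: powR_ge0.
  apply: ler_wpM2l => //; apply: le_trans cnt_ge; apply: powR_leN => //.
  by rewrite divr_ge0.
have [t [s [ex ans tle]]] := runD G num k K a b X pab (leq_trans kQ QX) (leq_trans bQ QX)
  (nnX r (leqnSn r)) (leq_trans hQ QX) nX (leq_trans KQ QX) (leq_trans bQ' QX) bij elimh.
exists t, s; split=> //.
have -> : 2 `^ (ln ((budget r K a b k + 2) ^ D)%:R / ln 2) = ((budget r K a b k + 2) ^ D)%:R :> R.
  rewrite /powR pnatr_eq0 /= divfK; last by rewrite gt_eqF // ln_gt0 // ltr1n.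
  by rewrite lnK // posrE ltr0n expn_gt0 addn2.
rewrite -natrX -natrM ler_nat; apply: (leq_trans tle).
rewrite expnM -expnMn mulnC; case: (D) => // D'; rewrite leq_exp2r //.
by rewrite /X mulnDr leq_add2l leq_pmull.
Qed.
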